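(* Let $R$ be a CDGA over $\mathbb{Q}$, $A$ a CDGA over $R$, $M$ a strict line bundle over $A$, and $k\ge1$. Given $\Delta\in((G*\tilde F)^2Q\widehat{\mathrm{Pol}}(M,-1)/G^k)^1$, there is a morphism $$\mu(-,\Delta):\mathrm{DR}'(A/R)[\hbar]/G^k\to T_\Delta Q\widehat{\mathrm{Pol}}(M,-1)/G^k$$ of graded associative $R[\hbar]/\hbar^k$-algebras, respecting the filtrations $(G*\tilde F)$, induced by the graded algebra map on $A^{\otimes\bullet+1}$ (with the cup product) determined by $\mu(1\otimes1,\Delta)=\Delta$ and $\mu(a,\Delta)=a$ for $a\in A$. Given $\rho\in((G*\tilde F)^pT_\Delta Q\widehat{\mathrm{Pol}}(M,-1)/G^k)^r$, there is then an $R[\hbar]/\hbar^k$-linear $\mu(-,\Delta)$-derivation $$\nu(-,\Delta,\rho):(\mathrm{DR}'(A/R)[\hbar]/\hbar^k,(G*\tilde F)^\bullet)\to(T_\Delta Q\widehat{\mathrm{Pol}}(M,-1)[r-1]/G^k,(G*\tilde F)^{\bullet+p}),$$ respecting the filtrations as indicated, induced by the $\mu(-,\Delta)$-derivation on $A^{\otimes\bullet+1}$ determined by $\nu(1\otimes1,\Delta,\rho)=\rho$ and vanishing on $A$.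
   Context: CDGA: graded-commutative differential algebra, cohomologically graded. For $A$-modules $M,N$ in cochain complexes, $\mathrm{Diff}(M,N)\subset\underline{\mathrm{Hom}}_R(M,N)$ is the union of $F_0\mathrm{Diff}(M,N)=\underline{\mathrm{Hom}}_A(M,N)$ and $F_{k+1}\mathrm{Diff}(M,N)=\{u:[a,u]\in F_k\mathrm{Diff}(M,N)\ \forall a\in A\}$, $[a,u]=au-(-1)^{\deg a\deg u}ua$ ($F_k=0$ for $k<0$); $\mathscr{D}(M)=\mathrm{Diff}(M,M)$, an associative DG algebra under composition. A strict line bundle $M$ over $A$ is an $A$-module in cochain complexes whose underlying graded module is projective of rank $1$ over the underlying graded algebra of $A$; $a\in A$ is regarded as the operator in $F_0\mathscr{D}(M)$ of multiplication by $a$. $Q\widehat{\mathrm{Pol}}(M,-1)=\prod_{p\ge0}F_p\mathscr{D}(M)\hbar^{p-1}$ ($\hbar$ of degree $0$), with $\tilde F^i=\prod_{j\ge i}F_j\mathscr{D}(M)\hbar^{j-1}$, $G^i=\hbar^iQ\widehat{\mathrm{Pol}}(M,-1)$, $(G*\tilde F)^p=\sum_{i+j=p}G^i\cap\tilde F^j$, explicitly $\prod_{j<p}F_{2j-p}\mathscr{D}(M)\hbar^{j-1}\times\prod_{j\ge p}F_j\mathscr{D}(M)\hbar^{j-1}$. $T_\Delta Q\widehat{\mathrm{Pol}}(M,-1)=\prod_{p\ge0}F_p\mathscr{D}(M)\hbar^p$ as a graded associative algebra (when $\Delta$ is Maurer–Cartan it carries the differential $\delta+[\Delta,-]$, but here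 only the graded algebra is used), with $\tilde F^i=\prod_{p\ge i}F_p\mathscr{D}(M)\hbar^p$, $G^i=\hbar^i T_\Delta Q\widehat{\mathrm{Pol}}(M,-1)$ and $(G*\tilde F)^p=\sum_{i+j=p}G^i\cap\tilde F^j$. Note $Q\widehat{\mathrm{Pol}}(M,-1)=\hbar^{-1}T_\Delta Q\widehat{\mathrm{Pol}}(M,-1)$ inside $T_\Delta Q\widehat{\mathrm{Pol}}(M,-1)[\hbar^{-1}]$; the algebra map on $A^{\otimes\bullet+1}$ takes values in the latter algebra (using any lift of $\Delta$), products being products of differential operators. $A^{\otimes\bullet+1}$ is the cosimplicial CDGA $n\mapsto A^{\otimes_R(n+1)}$ (Čech nerve), filtered by powers $F^p=I^p$ of $I=\ker(A^{\otimes\bullet+1}\to A)$ (diagonal), with completion $\hat A^{\otimes\bullet+1}$; the cup product is $(a_0\otimes\dots\otimes a_m)\smile(b_0\otimes\dots\otimes b_n)=a_0\otimes\dots\otimes a_{m-1}\otimes(a_mb_0)\otimes b_1\otimes\dots\otimes b_n$, so $1\otimes1\in A^{\otimes2}$ has degree $1$. $N\hat A^{\bullet+1}$ is the conormalisation ($N^n$ is the intersection of the kernels of the $n$ multiplication maps $\hat A^{\otimes n+1}\to\hat A^{\otimes n}$). $\mathrm{DR}'(A/R)=\mathrm{Tot}^{\Pi}N\hat A^{\bullet+1}$ (product total complex), $F^p\mathrm{DR}'=\mathrm{Tot}^{\Pi}NF^p\hat A^{\bullet+1}$ ($F^p=F^0$ for $p\le0$). On $\mathrm{DR}'(A/R)[[\hbar]]$,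 $G^k=(\hbar^k)$ and $(G*\tilde F)^p=\prod_{i\ge0}F^{p-2i}\mathrm{DR}'(A/R)\hbar^i$, inducing filtrations on $\mathrm{DR}'(A/R)[\hbar]/\hbar^k=\mathrm{DR}'(A/R)[\hbar]/G^k$. *)

(* Defs.v *)
From HB Require Import structures.
From mathcomp Require Import all_boot all_order all_algebra.
From mathcomp Require Import boolp classical_sets functions fsbigop.
From mathcomp Require Import freeg.

Set Implicit Arguments.
Unset Strict Implicit.
Unset Printing Implicit Defensive.

Import GRing.Theory.
Local Open Scope classical_set_scope.
Local Open Scope ring_scope.
Local Open Scope quotient_scope.

(* the subgroup generated by S *)
Inductive span (V : zmodType) (S : set V) : set V :=
| span0 : span S 0
| span_in x of S x : span S x
| spanB x y of span S x & span S y : span S (x - y).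

Definition spanb (V : zmodType) (S : set V) : {pred V} :=
  fun x => `[< span S x >].

Lemma spanb_closed (V : zmodType) (S : set V) : zmod_closed (spanb S).
Proof.
by split=> [|x y /asboolP Sx /asboolP Sy]; apply/asboolP;
  [exact: span0 | exact: spanB].
Qed.

HB.instance Definition _ (V : zmodType) (S : set V) :=
  GRing.isZmodClosed.Build V (spanb S) (spanb_closed S).

Definition quo (V : zmodType) (S : set V) : zmodType := Quotient.quot (spanb S).
Definition cls (V : zmodType) (S : set V) (x : V) : quo S :=
  \pi_(Quotient.quot (spanb S)) x.
Definition rep (V : zmodType) (S : set V) (x : quo S) : V :=
  repr (x : Quotient.quot (spanb S)).

Definition ksgn (n : int) (V : zmodType) (x : V) : V :=
  if odd `|n|%N then - x else x.

Definition grading (V : zmodType) (V_ : int -> set V) : Prop :=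
  [/\ forall i, V_ i 0,
      forall i x y, V_ i x -> V_ i y -> V_ i (x - y),
      forall x, exists (s : seq int) (f : int -> V),
        (forall i, V_ i (f i)) /\ x = \sum_(i <- s) f i
    & forall (s : seq int) (f : int -> V), uniq s ->
        (forall i, V_ i (f i)) -> \sum_(i <- s) f i = 0 ->
        forall i, i \in s -> f i = 0].

Record gcring := GCRing {
  gcr_car :> pzRingType;
  gdeg : int -> set gcr_car;
  gdeg_grading : grading gdeg;
  gdeg1 : gdeg 0 1;
  gdegM : forall i j x y, gdeg i x -> gdeg j y -> gdeg (i + j) (x * y);
  gcr_comm : forall i j x y,
    gdeg i x -> gdeg j y -> x * y = ksgn (i * j) (y * x) }.

Record cdga := CDGA {
  cdga_gcr :> gcring;
  cdga_d : cdga_gcr -> cdga_gcr;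
  cdga_dD : forall x y, cdga_d (x + y) = cdga_d x + cdga_d y;
  cdga_d_deg : forall i x, gdeg i x -> gdeg (i + 1) (cdga_d x);
  cdga_dd : forall x, cdga_d (cdga_d x) = 0;
  cdga_leibniz : forall i x y, gdeg i x ->
    cdga_d (x * y) = cdga_d x * y + ksgn i (x * cdga_d y) }.

Record cdga_hom (R A : cdga) := CDGAHom {
  hom_map :> {rmorphism R -> A};
  hom_deg : forall i x, gdeg i x -> gdeg i (hom_map x);
  hom_d : forall x, hom_map (cdga_d x) = cdga_d (hom_map x) }.

Record gmod (A : gcring) := GMod {
  gm_car :> lmodType A;
  mdeg : int -> set gm_car;
  mdeg_grading : grading mdeg;
  mdegZ : forall i j (a : A) (m : gm_car),
    gdeg i a -> mdeg j m -> mdeg (i + j) (a *: m) }.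

Record dgmod (A : cdga) := DGMod {
  dgm_gm :> gmod A;
  dgm_d : dgm_gm -> dgm_gm;
  dgm_dD : forall x y, dgm_d (x + y) = dgm_d x + dgm_d y;
  dgm_d_deg : forall i x, mdeg i x -> mdeg (i + 1) (dgm_d x);
  dgm_dd : forall x, dgm_d (dgm_d x) = 0;
  dgm_leibniz : forall i (a : A) x, gdeg i a ->
    dgm_d (a *: x) = cdga_d a *: x + ksgn i (a *: dgm_d x) }.

Definition gmod_hom (A : gcring) (M N : gmod A) (f : M -> N) : Prop :=
  [/\ forall x y, f (x + y) = f x + f y,
      forall (a : A) x, f (a *: x) = a *: f x
    & forall i x, mdeg i x -> mdeg i (f x)].

Definition gprojective (A : gcring) (P : gmod A) : Prop :=
  forall (M N : gmod A) (p : M -> N) (f : P -> N),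
    gmod_hom p -> (forall y, exists x, p x = y) -> gmod_hom f ->
    exists g : P -> M, gmod_hom g /\ (forall x, p (g x) = f x).

Definition prime_deg0 (A : gcring) (p : set A) : Prop :=
  [/\ p `<=` gdeg 0, p 0, ~ p 1,
      forall x y, p x -> p y -> p (x - y)
    & (forall a x, gdeg 0 a -> p x -> p (a * x)) /\
      forall a b, gdeg 0 a -> gdeg 0 b -> p (a * b) -> p a \/ p b].

(* A localisation of A at a prime of A^0 is graded-local, so "rank 1" means
   that each M_p is free over A_p on one homogeneous generator, which can be
   taken to be the image of some m in M.  The last two clauses say that
   a |-> a m is surjective, resp. injective, after localisation at p. *)
Definition rank1 (A : gcring) (M : gmod A) : Prop :=
  forall p : set A, prime_deg0 p -> exists (i : int) (m : M),
    [/\ mdeg i m,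
        forall x : M, exists (s a : A),
          [/\ gdeg 0 s, ~ p s & s *: x = a *: m]
      & forall a : A, a *: m = 0 ->
          exists s : A, [/\ gdeg 0 s, ~ p s & s * a = 0]].

Record strict_line_bundle (A : cdga) := StrictLineBundle {
  slb_mod :> dgmod A;
  slb_proj : gprojective slb_mod;
  slb_rank : rank1 slb_mod }.

Section Operators.
Variables (R A : cdga) (iota : cdga_hom R A) (M : dgmod A).

Definition op := M -> M.

(* degree d part of the graded internal Hom *)
Definition homR (d : int) : set op := [set u |
  [/\ forall x y, u (x + y) = u x + u y,
      forall i x, mdeg i x -> mdeg (d + i) (u x)
    & forall e (r : R) x, gdeg e r ->
        u (iota r *: x) = ksgn (e * d) (iota r *: u x)]].

Definition homA (d : int) : set op := [set u |
  [/\ forall x y, u (x + y) = u x + u y,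
      forall i x, mdeg i x -> mdeg (d + i) (u x)
    & forall e (a : A) x, gdeg e a ->
        u (a *: x) = ksgn (e * d) (a *: u x)]].

Definition op_comm (e d : int) (a : A) (u : op) : op :=
  fun x => a *: u x - ksgn (e * d) (u (a *: x)).

Fixpoint Dop_nat (k : nat) (d : int) : set op :=
  match k with
  | 0 => homA d
  | k'.+1 => [set u | homR d u /\
      forall e (a : A), gdeg e a -> Dop_nat k' (e + d) (op_comm e d a u)]
  end.

(* Dop k d = (F_k D(M))^d *)
Definition Dop (k d : int) : set op :=
  if k is Posz n then Dop_nat n d else [set fun _ => 0].

(* u : ser stands for the formal sum over m : int of u_m hbar^m *)
Definition ser := int -> M -> M.

(* The sum is finite for the series used here, whose exponents are bounded
   below. *)
Definition ser_mul (u v : ser) : ser :=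
  fun n x => \sum_(i \in [set: int]) u i (v (n - i) x).

Definition ser_const (a : A) : ser := fun n x => if n == 0 then a *: x else 0.

Definition hshift (i : int) (u : ser) : ser := fun n => u (n - i).

(* Pol s d is the degree d part of \prod_(p >= 0) F_p D(M) hbar^(p - s) *)
Definition Pol (s d : int) : set ser := [set u | forall m, Dop (m + s) d (u m)].

Definition QPol : int -> set ser := Pol 1.
Definition TPol : int -> set ser := Pol 0.

Definition TLaurent (d : int) : set ser :=
  [set u | exists i : nat, TPol d (hshift i%:Z u)].

Definition Gfil (s : int) (i : nat) (d : int) : set ser :=
  [set hshift i%:Z u | u in Pol s d].

Definition Ffil (s j d : int) : set ser :=
  [set u | Pol s d u /\ forall m, m + s < j -> u m = 0].

(* Degree d part of (G * F~)^p: the sum of the G^i ∩ F~^j with i + j = p.  As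
   F~^j is everything for j <= 0, so is (G * F~)^p for p <= 0. *)
Definition GFfil (s p d : int) : set ser :=
  span [set u | exists (i : nat) (j : int),
    [/\ i%:Z + j = p, Gfil s i d u & Ffil s j d u]].

(* Polk_deg s k d is the degree d part of Pol s / G^k.  The type Polk s k is the
   quotient of all of ser, so its elements outside these parts are junk; the
   operations below are given on representatives, whose choice is immaterial
   on the homogeneous parts. *)
Definition Polk (s : int) (k : nat) : zmodType :=
  quo [set u : ser | exists d, Gfil s k d u].
Definition Polk_cls (s : int) (k : nat) (u : ser) : Polk s k := cls _ u.
Definition Polk_deg (s : int) (k : nat) (d : int) : set (Polk s k) :=
  [set Polk_cls s k u | u in Pol s d].
Definition Polk_GF (s : int) (k : nat) (p d : int) : set (Polk s k) :=
  [set Polk_cls s k u | u in GFfil s p d].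

Definition QPolk (k : nat) := Polk 1 k.
Definition TPolk (k : nat) := Polk 0 k.

Definition Tk_mul (k : nat) (x y : TPolk k) : TPolk k :=
  Polk_cls 0 k (ser_mul (rep x) (rep y)).
Definition Tk_one (k : nat) : TPolk k := Polk_cls 0 k (ser_const 1).

(* the image of \sum_(i < k) c_i hbar^i *)
Definition Tk_scal (k : nat) (c : 'I_k -> R) : TPolk k :=
  Polk_cls 0 k (fun n x => \sum_(i < k | i%:Z == n) iota (c i) *: x).

End Operators.

Section Nerve.
Variables (R A : cdga) (iota : cdga_hom R A).

Definition helt := {x : int * A | `[< gdeg x.1 x.2 >]}.
Definition hd (x : helt) : int := (val x).1.
Definition hv (x : helt) : A := (val x).2.

Lemma hP (x : helt) : gdeg (hd x) (hv x). Proof. exact/asboolP/(valP x). Qed.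

Lemma helt0P : `[< @gdeg A 0 0 >].
Proof. by apply/asboolP; case: (gdeg_grading A). Qed.
Definition helt0 : helt := Sub (0, 0) helt0P.

Definition mkh (e : int) (a : A) : helt := insubd helt0 (e, a).

Lemma hmulP (x y : helt) : `[< gdeg (hd x + hd y) (hv x * hv y) >].
Proof. by apply/asboolP/gdegM; exact: hP. Qed.
Definition hmul (x y : helt) : helt :=
  Sub (hd x + hd y, hv x * hv y) (hmulP x y).

(* (a0, [:: a1; ...; an]) stands for the tensor a0 ⊗ ... ⊗ an *)
Definition word := (helt * seq helt)%type.

Definition words := {freeg word / int}.
Definition word1 (w : word) : words := << w >>.

Definition lift1 (V : zmodType) (f : word -> V) (x : words) : V :=
  \sum_(w <- dom x) f w *~ coeff w x.

Definition splice (u : seq helt) (a : helt) (v : seq helt) : word :=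
  if u is h :: u' then (h, u' ++ a :: v) else (a, v).

Definition tens_rel : set words := [set x |
  (exists u v a b c, [/\ hd a = hd c, hd b = hd c, hv c = hv a + hv b
     & x = word1 (splice u c v) - word1 (splice u a v) - word1 (splice u b v)])
  \/
  (exists u v a b e (r : R), gdeg e r /\
     let r' := mkh e (iota r) in
     x = word1 (splice u (hmul a r') (b :: v))
         - word1 (splice u a (hmul r' b :: v)))].

(* All tensor powers at once: a direct sum over n, as tens_rel preserves the
   length of words. *)
Definition tens : zmodType := quo tens_rel.
Definition pure (w : word) : tens := cls tens_rel (word1 w).

Definition wdeg (w : word) : int := \sum_(a <- w.1 :: w.2) hd a.

Definition tens_n (n : nat) : set tens :=
  span [set pure w | w in [set w : word | size w.2 = n]].
Definition tens_ne (n : nat) (e : int) : set tens :=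
  span [set pure w | w in [set w : word | size w.2 = n /\ wdeg w = e]].

(* (Bi)additive extension of a map given on pure tensors.  Each f below respects
   tens_rel, so the choice of representatives is immaterial. *)
Definition tlift1 (V : zmodType) (f : word -> V) (x : tens) : V :=
  lift1 f (rep x).
Definition tlift2 (V : zmodType) (f : word -> word -> V) (x y : tens) : V :=
  lift1 (fun w => lift1 (f w) (rep y)) (rep x).

Definition diag : tens -> A :=
  tlift1 (fun w => \prod_(a <- w.1 :: w.2) hv a).

Fixpoint merge_word (i : nat) (a : helt) (s : seq helt) : word :=
  match s, i with
  | [::], _ => (a, [::])
  | b :: s', 0 => (hmul a b, s')
  | b :: s', i'.+1 => let w := merge_word i' b s' in (a, w.1 :: w.2)
  end.
Definition codegen (i : nat) : tens -> tens :=
  tlift1 (fun w => pure (merge_word i w.1 w.2)).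

Fixpoint koszul (s t : seq helt) : int :=
  match s, t with
  | _ :: s', b :: t' => (\sum_(a <- s') hd a) * hd b + koszul s' t'
  | _, _ => 0
  end.

(* Product in each cosimplicial degree separately. *)
Definition level_mul : tens -> tens -> tens :=
  tlift2 (fun v w =>
    if size v.2 == size w.2 then
      ksgn (koszul (v.1 :: v.2) (w.1 :: w.2))
        (pure (hmul v.1 w.1, [seq hmul x.1 x.2 | x <- zip v.2 w.2]))
    else 0).

Definition diag_ideal (n : nat) : set tens :=
  [set x | tens_n n x /\ diag x = 0].
Fixpoint diag_pow (n p : nat) : set tens :=
  if p is p'.+1 then
    span [set z | exists x y,
      [/\ diag_ideal n x, diag_pow n p' y & z = level_mul x y]]
  else tens_n n.

(* The total complex carries the cup product with the Koszul sign (-1)^(m q),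
   where v has cosimplicial degree m and w has internal degree q; without it
   R would not be graded-central and 1 ⊗ 1 would not behave as an element of
   degree 1. *)
Fixpoint glue (a : helt) (s : seq helt) (w : word) : word :=
  if s is b :: s' then let w' := glue b s' w in (a, w'.1 :: w'.2)
  else (hmul a w.1, w.2).
Definition cup : tens -> tens -> tens :=
  tlift2 (fun v w => ksgn ((size v.2)%:Z * wdeg w) (pure (glue v.1 v.2 w))).

Definition tens_of (e : int) (a : A) : tens := pure (mkh e a, [::]).
Definition one_one : tens := pure (mkh 0 1, [:: mkh 0 1]).

Definition filidx (p : int) : nat := if p is Posz n then n else 0.

(* lim_p of A^(⊗ n+1) / I^p: sequences y with y_(p+1) = y_p modulo I^p, modulo
   those with y_p in I^p for all p. *)
Definition hat_zero : set (nat -> tens) :=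
  [set y | exists n, forall p, diag_pow n p (y p)].
Definition hat : zmodType := quo hat_zero.
Definition hat_cls (y : nat -> tens) : hat := cls hat_zero y.

Definition coherent (n : nat) (e : int) : set (nat -> tens) :=
  [set y | forall p, tens_ne n e (y p) /\ diag_pow n p (y p.+1 - y p)].

Definition hat_fil (q : int) (n : nat) (e : int) : set hat :=
  [set hat_cls y | y in
    [set y | coherent n e y /\ diag_pow n (filidx q) (y (filidx q))]].

Definition hat_codegen (i : nat) (x : hat) : hat :=
  hat_cls (fun p => codegen i (rep x p)).
Definition hat_cup (x y : hat) : hat :=
  hat_cls (fun p => cup (rep x p) (rep y p)).
Definition hat_const (x : tens) : hat := hat_cls (fun _ => x).

Definition norm_tens (n : nat) (e : int) : set tens :=
  [set x | tens_ne n e x /\ forall i, (i < n)%N -> codegen i x = 0].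
Definition norm_fil (q : int) (n : nat) (e : int) : set hat :=
  [set x | hat_fil q n e x /\ forall i, (i < n)%N -> hat_codegen i x = 0].

(* degree d part of F^q DR' *)
Definition DRcar := nat -> hat.
Definition DRfil (q d : int) : set DRcar :=
  [set x | forall n : nat, norm_fil q n (d - n%:Z) (x n)].
Definition DRmul (x y : DRcar) : DRcar :=
  fun n => \sum_(m < n.+1) hat_cup (x m) (y (n - m)%N).

(* DR'[hbar] / hbar^k: x stands for \sum_(i < k) x_i hbar^i *)
Section Truncated.
Variable k : nat.
Definition DRk := 'I_k -> nat -> hat.

Definition DRk_deg (d : int) : set DRk :=
  [set x | forall i, DRfil 0 d (x i)].
Definition DRk_GF (p d : int) : set DRk :=
  [set x | forall i : 'I_k, DRfil (p - (2 * i)%N%:Z) d (x i)].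

Definition DRk_mul (x y : DRk) : DRk :=
  fun l => \sum_(i < k) \sum_(j < k | (i + j == l)%N) DRmul (x i) (y j).

Definition DRk_emb (n : nat) (x : tens) : DRk :=
  fun i n' => if (val i == 0%N) && (n' == n) then hat_const x else 0.

Definition DRk_one : DRk := DRk_emb 0 (tens_of 0 1).

(* the image of \sum_(i < k) c_i hbar^i, where the c_i have degree e *)
Definition DRk_scal (e : int) (c : 'I_k -> R) : DRk :=
  fun i n => if n == 0%N then hat_const (tens_of e (iota (c i))) else 0.
End Truncated.

End Nerve.

Arguments DRk_emb {R A iota} k n x _ _.
Arguments DRk_one {R A} iota k _ _.

Section Maps.
Variables (R A : cdga) (iota : cdga_hom R A) (M : dgmod A) (k : nat).

Local Notation ser := (ser M).
Local Notation tens := (tens iota).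
Local Notation DRk := (DRk iota k).
Local Notation TPolk := (TPolk iota M k).
Local Notation cls := (Polk_cls iota 0 k).

Record nerve_map (D : ser) (phi : tens -> ser) : Prop := NerveMap {
  nm_add : forall x y, phi (x + y) = phi x + phi y;
  nm_deg : forall n e x, tens_ne n e x -> TLaurent iota (n%:Z + e) (phi x);
  nm_cup : forall x y, phi (cup x y) = ser_mul (phi x) (phi y);
  nm_A : forall e (a : A), gdeg e a -> phi (tens_of iota e a) = ser_const a;
  nm_11 : phi (one_one iota) = D }.

Record nerve_der (phi : tens -> ser) (r : int) (rho : ser) (psi : tens -> ser)
    : Prop := NerveDer {
  nd_add : forall x y, psi (x + y) = psi x + psi y;
  nd_deg : forall n e x, tens_ne n e x ->
    TLaurent iota (n%:Z + e + (r - 1)) (psi x);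
  nd_cup : forall n e x y, tens_ne n e x ->
    psi (cup x y) = ser_mul (psi x) (phi y)
                    + ksgn ((r - 1) * (n%:Z + e)) (ser_mul (phi x) (psi y));
  nd_A : forall e (a : A), gdeg e a -> psi (tens_of iota e a) = 0;
  nd_11 : psi (one_one iota) = rho }.

(* The uncompleted conormalised nerve is dense in DR', so this determines a
   filtered f. *)
Definition induced_by (phi : tens -> ser) (f : DRk -> TPolk) : Prop :=
  forall n e x, norm_tens n e x -> f (DRk_emb k n x) = cls (phi x).

(* Morphisms are only constrained on homogeneous elements. *)
Record is_alg_morphism (mu : DRk -> TPolk) : Prop := IsAlgMorphism {
  am_deg : forall d x, DRk_deg d x -> Polk_deg d (mu x);
  am_add : forall d x y, DRk_deg d x -> DRk_deg d y -> mu (x + y) = mu x + mu y;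
  am_one : mu (DRk_one iota k) = Tk_one iota M k;
  am_mul : forall d e x y, DRk_deg d x -> DRk_deg e y ->
    mu (DRk_mul x y) = Tk_mul (mu x) (mu y);
  am_scal : forall d e x (c : 'I_k -> R), DRk_deg d x ->
    (forall i, gdeg e (c i)) ->
    mu (DRk_mul (DRk_scal iota e c) x) = Tk_mul (Tk_scal iota M c) (mu x) }.

(* R[hbar]/hbar^k-linear mu-derivations DR'[hbar]/hbar^k -> (T/G^k)[r - 1] *)
Record is_derivation (mu : DRk -> TPolk) (r : int) (nu : DRk -> TPolk)
    : Prop := IsDerivation {
  de_deg : forall d x, DRk_deg d x -> Polk_deg (d + (r - 1)) (nu x);
  de_add : forall d x y, DRk_deg d x -> DRk_deg d y -> nu (x + y) = nu x + nu y;
  de_mul : forall d e x y, DRk_deg d x -> DRk_deg e y ->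
    nu (DRk_mul x y) = Tk_mul (nu x) (mu y)
                       + ksgn ((r - 1) * d) (Tk_mul (mu x) (nu y));
  de_scal : forall d e x (c : 'I_k -> R), DRk_deg d x ->
    (forall i, gdeg e (c i)) ->
    nu (DRk_mul (DRk_scal iota e c) x)
      = ksgn ((r - 1) * e) (Tk_mul (Tk_scal iota M c) (nu x)) }.

Definition shifts_GF (p s : int) (f : DRk -> TPolk) : Prop :=
  forall q d x, DRk_GF q d x -> Polk_GF (q + p) (d + s) (f x).

End Maps.

(* Main.v *)
(* A @ ... @ A is generated under the cup product by A and delta = 1 @ 1, so mu and
   nu are forced on it:
     mu(a0 @ ... @ an)  =  (-1)^(|a1| + 2 |a2| + ... + n |an|) a0 Delta a1 Delta ... Delta an,
   and nu replaces one Delta by rho, with Koszul signs, and sums over the positions.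

   Multiplying the slots j and j + 1 by h and subtracting turns the j-th Delta into
   [h, Delta].  As the diagonal ideal I is generated by such differences, I^q is
   spanned by the a0 c1 a1 ... cn an, where c1, ..., cn are iterated commutators of
   delta with q commutations in total.  Commuting with A lowers the order of a
   differential operator by one and Delta_m has order at most min(m + 1, 2 m), so the
   hbar^m coefficient of mu(I^q) has order at most 2 m - q.  Hence every coefficient
   of mu is I-adically locally constant, and mu extends to the completion.

   The projector built from the maps 1 - d^i s^i shows that the normalised n-cochains
   are spanned by the a0 [a1, delta] ... [an, delta], also modulo I^q.  On these mu
   has coefficients of order at most m, and a change of Delta in hbar^k Qpol, although
   of size hbar^(k - 1) F_0, changes mu only by elements of G^k, since commutators
   with A kill F_0.  Orders add under products, which gives the filtrations. *)
From Pilot Require Import Defs.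
From HB Require Import structures.
From mathcomp Require Import all_boot all_order all_algebra.
From mathcomp Require Import boolp classical_sets functions fsbigop.
From mathcomp Require Import freeg.
From mathcomp Require Import zify.
Import Pilot.Defs.

Set Implicit Arguments.
Unset Strict Implicit.
Unset Printing Implicit Defensive.

Import GRing.Theory.
Local Open Scope classical_set_scope.
Local Open Scope ring_scope.

(** * Additive maps, signs and quotients *)

(** Two bounds are carried for the order of the coefficient of hbar^m: at most m, valid on
    normalised cochains only and placing the values in T_Delta itself instead of its localisation;
    and at most 2 m - q on I^q. The second controls two infinite processes at once. It kills I^q for
    q > 2 m, and also the normalised n-cochains for n > 2 m, since a product of n commutators
    [a, delta] lies in I^n; so the product over all n in DR' becomes a finite sum in each power of
    hbar. This is where the precision 2 m + 1 comes from. The main obstacle is the interaction of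
    normalisation and completion: level p of a sequence representing a normalised element has
    codegeneracies that vanish only modulo I^p. Each level is therefore replaced, modulo I^p, by its
    image under the projector. A second obstacle is that equality in the quotients only writes a
    difference as a sum of elements of unspecified degrees, and representatives need not be
    homogeneous. The degree is recovered from the grading of M, so that an order bound on the
    summands passes to a homogeneous sum. *)

Section Additive.
Variables U V W : zmodType.
Implicit Types (f : U -> V) (S : set U).

Lemma zm0 f : zmod_morphism f -> f 0 = 0.
Proof. by move=> fB; rewrite -[0 in LHS](subr0 0) fB subrr. Qed.

Lemma zmN f : zmod_morphism f -> forall x, f (- x) = - f x.
Proof. by move=> fB x; rewrite -[- x]sub0r fB zm0 // sub0r. Qed.

Lemma zmD f : zmod_morphism f -> forall x y, f (x + y) = f x + f y.
Proof. by move=> fB x y; rewrite -{1}(opprK y) fB zmN // opprK. Qed.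

Lemma zm_of_add f : (forall x y, f (x + y) = f x + f y) -> zmod_morphism f.
Proof. by move=> fD x y; apply/esym/eqP; rewrite subr_eq -fD subrK. Qed.

Lemma zm_sum f : zmod_morphism f ->
  forall I (r : seq I) (P : pred I) F,
  f (\sum_(i <- r | P i) F i) = \sum_(i <- r | P i) f (F i).
Proof. by move=> fB I r P F; apply: big_morph; [exact: zmD | exact: zm0]. Qed.

Lemma zm_mulz f : zmod_morphism f -> forall x (n : int), f (x *~ n) = f x *~ n.
Proof.
move=> fB x n.
have fMn m : f (x *+ m) = f x *+ m.
  by elim: m => [|m IHm]; [exact: zm0 | rewrite !mulrS zmD // IHm].
by case: n => n; rewrite -?pmulrn ?fMn // NegzE !mulrNz -!pmulrn zmN // fMn.
Qed.

Lemma zm_ksgn f : zmod_morphism f -> forall n x, f (ksgn n x) = ksgn n (f x).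
Proof. by move=> fB n x; rewrite /ksgn; case: ifP => // _; exact: zmN. Qed.

Lemma spanN S x : span S x -> span S (- x).
Proof. by move=> Sx; rewrite -sub0r; apply: spanB => //; exact: span0. Qed.

Lemma spanD S x y : span S x -> span S y -> span S (x + y).
Proof. by move=> Sx Sy; rewrite -(opprK y); apply: spanB => //; exact: spanN. Qed.

Lemma span_sum S I (r : seq I) (P : pred I) F :
  (forall i, P i -> span S (F i)) -> span S (\sum_(i <- r | P i) F i).
Proof. by move=> FS; apply: big_ind => //; [exact: span0 | exact: spanD]. Qed.

Lemma span_ksgn S n x : span S x -> span S (ksgn n x).
Proof. by rewrite /ksgn; case: ifP => // _; exact: spanN. Qed.

Lemma span_mulz S x (n : int) : span S x -> span S (x *~ n).
Proof.
move=> Sx.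
have SMn m : span S (x *+ m).
  by elim: m => [|m IHm]; [exact: span0 | rewrite mulrS; exact: spanD].
by case: n => n; rewrite -?pmulrn // NegzE mulrNz -pmulrn; apply: spanN.
Qed.

Lemma span_ind (P : set U) S : P 0 -> (forall x y, P x -> P y -> P (x - y)) ->
  (forall x, S x -> P x) -> forall x, span S x -> P x.
Proof.
by move=> P0 PB SP x; elim=> [//|y Sy|y z _ Py _ Pz]; [exact: SP|exact: PB].
Qed.

Lemma zm_comp (g : V -> W) f :
  zmod_morphism g -> zmod_morphism f -> zmod_morphism (fun x => g (f x)).
Proof. by move=> gB fB x y; rewrite fB gB. Qed.

Lemma zm_ksgn_fun f n : zmod_morphism f -> zmod_morphism (fun x => ksgn n (f x)).
Proof.
by move=> fB x y; rewrite /ksgn; case: ifP => _; rewrite fB // opprB addrC opprK.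
Qed.

Lemma span_map f S (T : set V) : zmod_morphism f ->
  (forall x, S x -> span T (f x)) -> forall x, span S x -> span T (f x).
Proof.
move=> fB ST; apply: span_ind => [|x y fx fy|//].
  by rewrite zm0 //; exact: span0.
by rewrite fB; exact: spanB.
Qed.

Lemma zm_eq_span f g S : zmod_morphism f -> zmod_morphism g ->
  (forall x, S x -> f x = g x) -> forall x, span S x -> f x = g x.
Proof.
move=> fB gB; apply: (@span_ind (fun x => f x = g x)); first by rewrite !zm0.
by move=> x y fx fy; rewrite fB gB fx fy.
Qed.

End Additive.

Arguments zm_eq_span {U V f g} S.

Lemma zm_id (V : zmodType) : zmod_morphism (@id V). Proof. by []. Qed.

Lemma zm_sub (U V : zmodType) (f g : U -> V) : zmod_morphism f ->
  zmod_morphism g -> zmod_morphism (fun x => f x - g x).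
Proof. by move=> fB gB x y; rewrite /= fB gB !opprD !opprK addrACA. Qed.

Lemma zm_add (U V : zmodType) (f g : U -> V) : zmod_morphism f ->
  zmod_morphism g -> zmod_morphism (fun x => f x + g x).
Proof. by move=> fB gB x y; rewrite /= fB gB opprD addrACA. Qed.

(** * Parities and Koszul signs *)

Section Sign.
Variable V : zmodType.
Implicit Types (m n : int) (x y : V).

Definition iodd n : bool := odd `|n|%N.

Lemma ioddD m n : iodd (m + n) = iodd m (+) iodd n.
Proof. by rewrite /iodd; lia. Qed.
Lemma ioddN m : iodd (- m) = iodd m.
Proof. by rewrite /iodd abszN. Qed.
Lemma ioddM m n : iodd (m * n) = iodd m && iodd n.
Proof. by rewrite /iodd abszM oddM. Qed.
Lemma iodd1 : iodd 1 = true. Proof. by []. Qed.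
Lemma iodd0 : iodd 0 = false. Proof. by []. Qed.
Lemma ioddS (n : nat) : iodd n.+1%:Z = ~~ iodd n%:Z.
Proof. by rewrite /iodd. Qed.

Lemma ksgnE m x : ksgn m x = if iodd m then - x else x. Proof. by []. Qed.

Lemma ksgn_eq m n x : iodd m = iodd n -> ksgn m x = ksgn n x.
Proof. by rewrite !ksgnE => ->. Qed.

Lemma ksgn_even m x : iodd m = false -> ksgn m x = x.
Proof. by rewrite ksgnE => ->. Qed.

Lemma ksgn_add m n x : ksgn m (ksgn n x) = ksgn (m + n) x.
Proof. by rewrite !ksgnE ioddD; case: iodd; case: iodd; rewrite /= ?opprK. Qed.

Lemma ksgn_zm m : zmod_morphism (@ksgn m V).
Proof. exact: (zm_ksgn_fun m (@zm_id V)). Qed.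

Lemma ksgnB m x y : ksgn m (x - y) = ksgn m x - ksgn m y.
Proof. exact: ksgn_zm. Qed.
Lemma ksgnD m x y : ksgn m (x + y) = ksgn m x + ksgn m y.
Proof. exact: (zmD (@ksgn_zm m)). Qed.
Lemma ksgn0 m : ksgn m (0 : V) = 0.
Proof. exact: (zm0 (@ksgn_zm m)). Qed.
Lemma ksgnK m : involutive (@ksgn m V).
Proof. by move=> x; rewrite ksgn_add ksgn_even // ioddD addbb. Qed.

Lemma ksgn_fct (T : Type) m (f : T -> V) t : (ksgn m f) t = ksgn m (f t).
Proof. by rewrite /ksgn; case: ifP. Qed.

End Sign.

(** Signs matter only modulo 2: every exponent becomes a boolean polynomial in the parities of its
    atoms, and the resulting identity is checked by cases. *)
Ltac sgn_parity :=
  rewrite ?(ioddD, ioddN, ioddM, ioddS, iodd1, iodd0);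
  repeat match goal with |- context [iodd ?e] => case: (iodd e) end;
  by [].

(** * Quotients by a spanned subgroup *)

Section Quo.
Variables (V : zmodType) (S : set V).

Lemma cls_zm : zmod_morphism (@cls V S).
Proof. by move=> x y; rewrite /cls -raddfB. Qed.

Lemma cls_eqP (x y : V) : cls S x = cls S y <-> span S (x - y).
Proof.
split=> [/eqP|Sxy]; rewrite /cls.
  by rewrite -Quotient.idealrBE => /asboolP.
by apply/eqP; rewrite -Quotient.idealrBE; apply/asboolP.
Qed.

Lemma repK (x : quo S) : cls S (rep x) = x.
Proof. exact: reprK. Qed.

Lemma rep_cls (x : V) : span S (rep (cls S x) - x).
Proof. by apply/cls_eqP; rewrite repK. Qed.

Lemma rep_add (x y : quo S) : span S (rep (x + y) - (rep x + rep y)).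
Proof. by apply/cls_eqP; rewrite repK (zmD cls_zm) !repK. Qed.

Lemma rep0 : span S (rep (0 : quo S)).
Proof. by rewrite -[rep 0]subr0; apply/cls_eqP; rewrite repK (zm0 cls_zm). Qed.

Lemma cls_eq0 (x : V) : cls S x = 0 <-> span S x.
Proof. by rewrite -{2}[x]subr0 -cls_eqP (zm0 cls_zm). Qed.

End Quo.

(** * Tensors as classes of words *)

Section Lift.
Variables (A : cdga) (V : zmodType).
Implicit Types (f : word A -> V) (x y : words A).

(** Two combinations with different supports can only be compared after both are summed over one
    common list of words; this is how additivity of [lift1] is obtained. *)
Lemma lift1_wide f x (s : seq (word A)) : uniq s -> {subset dom x <= s} ->
  lift1 f x = \sum_(w <- s) f w *~ coeff w x.
Proof.
move=> Us xs; rewrite /lift1 [RHS](bigID (fun w => w \in dom x)) /=.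
rewrite [X in _ + X]big1 ?addr0 => [|w /coeff_outdom ->]; last by rewrite mulr0z.
rewrite -[RHS]big_filter; apply/perm_big/uniq_perm.
- exact: uniq_dom.
- exact: filter_uniq.
by move=> w; rewrite mem_filter andb_idr //; exact: xs.
Qed.

Lemma lift1_zm f : zmod_morphism (lift1 f).
Proof.
move=> x y; pose s := undup (dom x ++ dom y ++ dom (x - y)).
have Us : uniq s by exact: undup_uniq.
rewrite !(@lift1_wide _ _ s) //; try by move=> w; rewrite mem_undup !mem_cat => ->; rewrite ?orbT.
by rewrite -sumrB; apply: eq_bigr => w _; rewrite coeffB mulrzBr.
Qed.

Lemma lift1_word1 f w : lift1 f (word1 w) = f w.
Proof. by rewrite /lift1 domU1 big_seq1 /word1 coeffU eqxx mulr1. Qed.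

Lemma words_sumE x : x = \sum_(w <- dom x) word1 w *~ coeff w x.
Proof.
rewrite -[LHS]freeg_sumE; apply: eq_bigr => w _.
by rewrite /word1 freegU_mulz; congr << _ *g w >>; rewrite intz.
Qed.

(** Universal property of the free abelian group on words. *)
Lemma words_morph (g : words A -> V) : zmod_morphism g ->
  forall x, g x = lift1 (fun w => g (word1 w)) x.
Proof.
move=> gB x; rewrite {1}[x]words_sumE zm_sum //.
by apply: eq_bigr => w _; rewrite zm_mulz.
Qed.

Lemma eq_lift1 f1 f2 : f1 =1 f2 -> lift1 f1 =1 lift1 f2.
Proof. by move=> eqf x; apply: eq_bigr => w _; rewrite eqf. Qed.
End Lift.

Section Words.
Variables (R A : cdga) (iota : cdga_hom R A).
Local Notation helt := (helt A).
Local Notation tens := (tens iota).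
Local Notation rho e r := (mkh e (iota r)).

Lemma mkhK e (a : A) : gdeg e a -> val (mkh e a) = (e, a).
Proof. by move=> ea; rewrite /mkh insubdK //; apply/asboolP. Qed.

Lemma hd_mkh e (a : A) : gdeg e a -> hd (mkh e a) = e.
Proof. by move=> /mkhK; rewrite /hd => ->. Qed.

Lemma hv_mkh e (a : A) : gdeg e a -> hv (mkh e a) = a.
Proof. by move=> /mkhK; rewrite /hv => ->. Qed.

Lemma mkh_hdv (h : helt) : mkh (hd h) (hv h) = h.
Proof.
apply/val_inj; rewrite mkhK; last exact: hP.
by rewrite /hd /hv -surjective_pairing.
Qed.

Lemma helt_eq (h g : helt) : hd h = hd g -> hv h = hv g -> h = g.
Proof. by move=> e v; rewrite -[h]mkh_hdv e v mkh_hdv. Qed.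

Lemma hd_mul (a b : helt) : hd (hmul a b) = hd a + hd b. Proof. by []. Qed.
Lemma hv_mul (a b : helt) : hv (hmul a b) = hv a * hv b. Proof. by []. Qed.

Lemma hmulA (a b c : helt) : hmul a (hmul b c) = hmul (hmul a b) c.
Proof. by apply: helt_eq; rewrite ?hd_mul ?hv_mul (addrA, mulrA). Qed.

Definition h1 : helt := mkh 0 1.
Lemma hd_h1 : hd h1 = 0. Proof. by rewrite hd_mkh //; exact: gdeg1. Qed.
Lemma hv_h1 : hv h1 = 1. Proof. by rewrite hv_mkh //; exact: gdeg1. Qed.

Lemma hmul1h (a : helt) : hmul h1 a = a.
Proof. by apply: helt_eq; rewrite ?hd_mul ?hv_mul ?hd_h1 ?hv_h1 (add0r, mul1r). Qed.
Lemma hmulh1 (a : helt) : hmul a h1 = a.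
Proof. by apply: helt_eq; rewrite ?hd_mul ?hv_mul ?hd_h1 ?hv_h1 (addr0, mulr1). Qed.

Lemma hv_comm (a b : helt) : hv a * hv b = ksgn (hd a * hd b) (hv b * hv a).
Proof. by apply: gcr_comm; exact: hP. Qed.

Lemma gdeg_rho e (r : R) : gdeg e r -> gdeg e (iota r).
Proof. exact: hom_deg. Qed.

Definition swd (s : seq helt) : int := \sum_(a <- s) hd a.

Lemma swd_cons a s : swd (a :: s) = hd a + swd s. Proof. exact: big_cons. Qed.
Lemma swd_nil : swd [::] = 0. Proof. exact: big_nil. Qed.
Lemma swd_cat s t : swd (s ++ t) = swd s + swd t. Proof. exact: big_cat. Qed.

Definition sq (w : word A) : seq helt := w.1 :: w.2.

Lemma sq_splice u (a : helt) v : sq (splice u a v) = u ++ a :: v.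
Proof. by case: u. Qed.

(* Tensors are handled as non-empty sequences; [pw] of the empty sequence is junk. *)
Definition pw (s : seq helt) : tens :=
  if s is a :: s' then pure iota (a, s') else 0.

Lemma pureE w : pure iota w = pw (sq w).
Proof. by case: w. Qed.

(** * Functions of sequences that descend to tensors *)

Section Respect.
Variable V : zmodType.
Implicit Type F : seq helt -> V.

(** The two families of relations in [tens_rel], read on concatenated sequences: additivity in each
    slot and balancing over R between adjacent slots. *)
Record respects F : Prop := Respects {
  resp_add : forall u v a b c, hd a = hd c -> hd b = hd c ->
    hv c = hv a + hv b -> F (u ++ c :: v) = F (u ++ a :: v) + F (u ++ b :: v);
  resp_bal : forall u v a b e (r : R), gdeg e r ->
    F (u ++ hmul a (rho e r) :: b :: v) = F (u ++ a :: hmul (rho e r) b :: v) }.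

Definition tl F : tens -> V := tlift1 (fun w => F (sq w)).

Lemma lift1_span F : respects F ->
  forall x, span (tens_rel iota) x -> lift1 (fun w => F (sq w)) x = 0.
Proof.
case=> Fadd Fbal; have lB := lift1_zm (fun w => F (sq w)).
apply: (@span_ind _ (fun x => lift1 _ x = 0)) => [|x y x0 y0|x].
- exact: zm0.
- by rewrite lB x0 y0 subr0.
case=> [[u [v [a [b [c [ac bc cab ->]]]]]]|[u [v [a [b [e [r [er /= ->]]]]]]]].
  rewrite !lB !lift1_word1 !sq_splice (Fadd u v a b c) //.
  by rewrite addrAC addrK subrr.
by rewrite !lB !lift1_word1 !sq_splice Fbal // subrr.
Qed.

Lemma tl_cls F : respects F ->
  forall x, tl F (cls (tens_rel iota) x) = lift1 (fun w => F (sq w)) x.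
Proof.
move=> rF x; apply/eqP; rewrite -subr_eq0 /tl /tlift1 -lift1_zm; apply/eqP.
by apply: lift1_span => //; exact: rep_cls.
Qed.

Lemma tl_zm F : respects F -> zmod_morphism (tl F).
Proof.
move=> rF x y; rewrite -{1}[x]repK -{1}[y]repK -cls_zm tl_cls //.
exact: lift1_zm.
Qed.

Lemma tl_pw F : respects F -> forall a s, tl F (pw (a :: s)) = F (a :: s).
Proof. by move=> rF a s; rewrite /pw /pure tl_cls // lift1_word1. Qed.

(* Relations away from the first slot are inherited from the tail.  [P] is needed because
   multiplication of series is additive only on series bounded below. *)
Lemma respects_recP F (F' : seq helt -> V) (P : set V)
    (G : helt -> int -> nat -> V -> V) :
  (respects F' \/ F' = F) -> (forall s, P (F' s)) ->
  (forall h d n x y, P x -> P y -> G h d n (x + y) = G h d n x + G h d n y) ->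
  (forall h a s, F (h :: a :: s) = G h (swd (a :: s)) (size s) (F' (a :: s))) ->
  (forall v a b c, hd a = hd c -> hd b = hd c ->
    hv c = hv a + hv b -> F (c :: v) = F (a :: v) + F (b :: v)) ->
  (forall v a b e (r : R), gdeg e r ->
    F (hmul a (rho e r) :: b :: v) = F (a :: hmul (rho e r) b :: v)) ->
  respects F.
Proof.
move=> rF' PF' Gz Frec Fadd Fbal.
have Frec' h u a s : F (h :: u ++ a :: s) =
    G h (swd (u ++ a :: s)) (size u + size s)%N (F' (u ++ a :: s)).
  by case: u => [|b u]; rewrite ?cat_cons Frec // size_cat /= addnS.
split.
  elim=> [|h u IHu] v a b c ac bc cab; first exact: Fadd.
  rewrite !cat_cons !Frec' !swd_cat !swd_cons ac bc.
  rewrite -Gz //; congr (G _ _ _ _).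
  case: rF' => [[rF' _]|eqF]; rewrite ?eqF.
    exact (rF' u v a b c ac bc cab).
  exact: IHu.
elim=> [|h u IHu] v a b e r er; first exact: Fbal.
rewrite !cat_cons !Frec' !swd_cat !swd_cons !hd_mul !addrA /=.
congr (G _ _ _ _).
case: rF' => [[_ rF']|eqF]; rewrite ?eqF.
  exact (rF' u v a b e r er).
exact: IHu.
Qed.

Lemma respects_rec F (F' : seq helt -> V) (G : helt -> int -> nat -> V -> V) :
  (respects F' \/ F' = F) ->
  (forall h d n, zmod_morphism (G h d n)) ->
  (forall h a s, F (h :: a :: s) = G h (swd (a :: s)) (size s) (F' (a :: s))) ->
  (forall v a b c, hd a = hd c -> hd b = hd c ->
    hv c = hv a + hv b -> F (c :: v) = F (a :: v) + F (b :: v)) ->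
  (forall v a b e (r : R), gdeg e r ->
    F (hmul a (rho e r) :: b :: v) = F (a :: hmul (rho e r) b :: v)) ->
  respects F.
Proof.
move=> rF' Gz; apply: (@respects_recP F F' setT G) => // h d n x y _ _.
exact: zmD (Gz h d n) x y.
Qed.

End Respect.

Lemma pw_respects : respects pw.
Proof.
have pwE u a v : pw (u ++ a :: v) = cls (tens_rel iota) (word1 (splice u a v)).
  by case: u.
split=> [u v a b c ac bc cab|u v a b e r er]; rewrite !pwE.
  rewrite -(zmD (@cls_zm _ _)); apply/cls_eqP; rewrite opprD addrA.
  by apply: span_in; left; exists u, v, a, b, c.
by apply/cls_eqP; apply: span_in; right; exists u, v, a, b, e, r.
Qed.

Lemma tens_span (x : tens) : span [set pure iota w | w in [set: word A]] x.
Proof.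
rewrite -[x]repK; set y := rep x; rewrite [y]words_sumE.
rewrite (zm_sum (@cls_zm _ _)); apply: span_sum => w _.
rewrite (zm_mulz (@cls_zm _ _)); apply: span_mulz.
by apply: span_in; exists w.
Qed.

Lemma tens_ext (V : zmodType) (f g : tens -> V) : zmod_morphism f ->
  zmod_morphism g -> (forall a s, f (pw (a :: s)) = g (pw (a :: s))) -> f =1 g.
Proof.
move=> fB gB fg x.
apply: (zm_eq_span [set pure iota w | w in [set: word A]]) => //; last exact: tens_span.
by move=> _ [[a s] _ <-]; exact: fg.
Qed.

Lemma tens_n_ext n (V : zmodType) (f g : tens -> V) : zmod_morphism f ->
  zmod_morphism g ->
  (forall a s, size s = n -> f (pw (a :: s)) = g (pw (a :: s))) ->
  forall x, tens_n n x -> f x = g x.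
Proof.
move=> fB gB fg x; apply: zm_eq_span => // _ [[a s] /= sn <-]; exact: fg.
Qed.

Lemma tens_ne_ext n e (V : zmodType) (f g : tens -> V) : zmod_morphism f ->
  zmod_morphism g ->
  (forall a s, size s = n -> swd (a :: s) = e ->
    f (pw (a :: s)) = g (pw (a :: s))) ->
  forall x, tens_ne n e x -> f x = g x.
Proof.
by move=> fB gB fg x; apply: zm_eq_span => // _ [[a s] /= [sn se] <-]; exact: fg.
Qed.

Lemma tens_ne_n n e (x : tens) : tens_ne n e x -> tens_n n x.
Proof.
apply: span_ind => [|y z|y [w [sw _] <-]]; [exact: span0|exact: spanB|].
by apply: span_in; exists w.
Qed.

Lemma pw_tens_ne a s : tens_ne (size s) (swd (a :: s)) (pw (a :: s)).
Proof. by apply: span_in; exists (a, s). Qed.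

Lemma pw_tens_n a s : tens_n (size s) (pw (a :: s)).
Proof. by apply: span_in; exists (a, s). Qed.

Lemma tens_n_map n (V : zmodType) (f : tens -> V) (T : set V) : zmod_morphism f ->
  (forall a s, size s = n -> span T (f (pw (a :: s)))) ->
  forall x, tens_n n x -> span T (f x).
Proof.
by move=> fB fT; apply: span_map => // _ [[a s] /= sn <-]; exact: fT.
Qed.

Lemma tens_ne_map n e (V : zmodType) (f : tens -> V) (T : set V) :
  zmod_morphism f ->
  (forall a s, size s = n -> swd (a :: s) = e -> span T (f (pw (a :: s)))) ->
  forall x, tens_ne n e x -> span T (f x).
Proof.
by move=> fB fT; apply: span_map => // _ [[a s] /= [sn se] <-]; exact: fT.
Qed.

End Words.

(** * Operations on tensors *)

Section TensorOps.
Variables (R A : cdga) (iota : cdga_hom R A).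
Local Notation helt := (helt A).
Local Notation tens := (tens iota).
Local Notation rho e r := (mkh e (iota r)).
Local Notation pw := (@pw _ _ iota).
Implicit Types (a b c h g : helt) (s t u v : seq helt) (x y z : tens).
Local Notation respects := (respects iota).

Lemma respects_zm (V W : zmodType) (f : V -> W) (F : seq helt -> V) :
  zmod_morphism f -> respects F -> respects (fun s => f (F s)).
Proof.
move=> fB [Fadd Fbal]; split=> [u v a b c ac bc cab|u v a b e r er].
  by rewrite (Fadd u v a b c) // zmD.
by rewrite Fbal.
Qed.

Lemma respects_size (V : zmodType) (F : seq helt -> V) m :
  respects F -> respects (fun s => if size s == m then F s else 0).
Proof.
case=> [Fadd Fbal]; split=> [u v a b c ac bc cab|u v a b e r er].
  rewrite (Fadd u v a b c) // !size_cat /=; case: ifP => // _.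
  by rewrite addr0.
by rewrite Fbal // !size_cat.
Qed.

Lemma respects_sgn (V : zmodType) (F : seq helt -> V) :
  respects F -> respects (fun s => ksgn (swd s) (F s)).
Proof.
case=> [Fadd Fbal]; split=> [u v a b c ac bc cab|u v a b e r er].
  by rewrite (Fadd u v a b c) // ksgnD !swd_cat !swd_cons ac bc.
by rewrite Fbal // !swd_cat !swd_cons !hd_mul !addrA.
Qed.

Lemma pw_add a b c s : hd a = hd c -> hd b = hd c -> hv c = hv a + hv b ->
  pw (c :: s) = pw (a :: s) + pw (b :: s).
Proof. exact: (resp_add (pw_respects iota) [::]). Qed.

Lemma pw_zero a s : hv a = 0 -> pw (a :: s) = 0.
Proof.
move=> a0; have /(_ s) := @pw_add a a a; rewrite a0 addr0 => /(_ erefl erefl erefl).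
by move/eqP; rewrite -{1}[pw (a :: s)]addr0 (can_eq (addKr _)) eq_sym => /eqP.
Qed.

(** A slot carries its own degree, and negation is not an operation on slots; the sign is extracted
    from the additive relation a + b = 0 in the common degree. *)
Lemma pw_sgn n a b s : hd a = hd b -> hv a = ksgn n (hv b) ->
  pw (a :: s) = ksgn n (pw (b :: s)).
Proof.
rewrite /ksgn; case: ifP => _ ab e; last by rewrite (helt_eq ab e).
apply/eqP; rewrite -addr_eq0; apply/eqP.
have c0 : gdeg (hd b) (0 : A) by case: (gdeg_grading A).
rewrite -(@pw_add a b (mkh (hd b) 0)) ?hd_mkh //.
  by rewrite pw_zero // hv_mkh.
by rewrite hv_mkh // e addNr.
Qed.

Lemma pw_mulC h g a s : pw (hmul h (hmul g a) :: s) =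
  ksgn (hd h * hd g) (pw (hmul g (hmul h a) :: s)).
Proof.
apply: pw_sgn; first by rewrite !hd_mul addrCA.
rewrite !hv_mul mulrA hv_comm /ksgn; case: ifP => _; first by rewrite mulNr mulrA.
by rewrite mulrA.
Qed.

Lemma hmul_addr h a b c : hd a = hd c -> hd b = hd c -> hv c = hv a + hv b ->
  [/\ hd (hmul h a) = hd (hmul h c), hd (hmul h b) = hd (hmul h c)
    & hv (hmul h c) = hv (hmul h a) + hv (hmul h b)].
Proof. by move=> ac bc cab; rewrite !hd_mul !hv_mul ac bc cab mulrDr. Qed.

Lemma hmul_addl h a b c : hd a = hd c -> hd b = hd c -> hv c = hv a + hv b ->
  [/\ hd (hmul a h) = hd (hmul c h), hd (hmul b h) = hd (hmul c h)
    & hv (hmul c h) = hv (hmul a h) + hv (hmul b h)].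
Proof. by move=> ac bc cab; rewrite !hd_mul !hv_mul ac bc cab mulrDl. Qed.

(** * Prepending a slot and multiplying in one slot *)

Definition pre a : tens -> tens := tl (fun s => pw (a :: s)).

Lemma pre_respects a : respects (fun s => pw (a :: s)).
Proof.
case: (pw_respects iota) => padd pbal.
split=> [u v b c d bd cd dbc|u v b c e r er].
  exact: (padd (a :: u)).
exact: (pbal (a :: u)).
Qed.

Lemma pre_zm a : zmod_morphism (pre a).
Proof. exact/tl_zm/pre_respects. Qed.

Lemma pre_pw a b s : pre a (pw (b :: s)) = pw (a :: b :: s).
Proof. exact/tl_pw/pre_respects. Qed.

Lemma pre_add a b c x : hd a = hd c -> hd b = hd c -> hv c = hv a + hv b ->
  pre c x = pre a x + pre b x.
Proof.
move=> ac bc cab; apply: (tens_ext (g := fun x => pre a x + pre b x)).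
- exact: pre_zm.
- by apply: zm_add; exact: pre_zm.
by move=> d s; rewrite !pre_pw; exact: pw_add.
Qed.

Lemma pre_bal a e (r : R) b s : gdeg e r ->
  pre (hmul a (rho e r)) (pw (b :: s)) = pre a (pw (hmul (rho e r) b :: s)).
Proof.
by move=> er; rewrite !pre_pw; exact: (resp_bal (pw_respects iota) [::]).
Qed.

Lemma ksgn_pre n a x : pre a (ksgn n x) = ksgn n (pre a x).
Proof. exact/zm_ksgn/pre_zm. Qed.

(** Left multiplication of slot [i] by [h], with the Koszul sign for moving [h] past the earlier
    slots. An index beyond the end acts on the last slot. *)
Fixpoint Lw (i : nat) h s : tens :=
  if s is a :: s' then
    if i is i'.+1 then
      if s' is _ :: _ then ksgn (hd h * hd a) (pre a (Lw i' h s'))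
      else pw [:: hmul h a]
    else pw (hmul h a :: s')
  else 0.

Lemma L0_respects h : respects (Lw 0 h).
Proof.
apply: (@respects_rec _ _ _ _ _ pw (fun a _ _ => pre (hmul h a))).
- by left; exact: pw_respects.
- by move=> a _ _; exact: pre_zm.
- by move=> a b s; rewrite pre_pw.
- by move=> v a b c ac bc /(hmul_addr h ac bc) [? ? ?]; exact: pw_add.
move=> v a b e r er; rewrite /= hmulA.
exact: (resp_bal (pw_respects iota) [::]).
Qed.

Local Notation L i h := (@tl _ _ iota _ (Lw i h)).

Lemma L0_pw h a s : L 0 h (pw (a :: s)) = pw (hmul h a :: s).
Proof. exact/tl_pw/L0_respects. Qed.

Lemma L0_zm h : zmod_morphism (L 0 h).
Proof. exact/tl_zm/L0_respects. Qed.

Lemma L0_pre h a x : L 0 h (pre a x) = pre (hmul h a) x.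
Proof.
apply: (tens_ext (f := fun x => L 0 h (pre a x))).
- exact: (zm_comp (@L0_zm h) (@pre_zm a)).
- exact: pre_zm.
by move=> b s; rewrite !pre_pw L0_pw.
Qed.

Lemma pre_balL a e (r : R) x : gdeg e r ->
  pre (hmul a (rho e r)) x = pre a (L 0 (rho e r) x).
Proof.
move=> er; apply: (tens_ext (g := fun x => pre a (L 0 (rho e r) x))).
- exact: pre_zm.
- exact: (zm_comp (@pre_zm a) (@L0_zm _)).
by move=> b s; rewrite pre_bal // L0_pw.
Qed.

(** This is what balancing requires: a scalar moved into the first slot of the tail can be pulled
    out through the multiplication by [h], at the cost of a Koszul sign. *)
Lemma Lw_L0 i h g b s :
  Lw i h (hmul g b :: s) = ksgn (hd h * hd g) (L 0 g (Lw i h (b :: s))).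
Proof.
case: i => [|i]; first by rewrite L0_pw; exact: pw_mulC.
case: s => [|c s]; first by rewrite L0_pw; exact: pw_mulC.
rewrite [in LHS]/= [Lw _ _ (b :: _)]/=.
rewrite (zm_ksgn (@L0_zm g)) L0_pre ksgn_add; apply: ksgn_eq.
by rewrite hd_mul mulrDr.
Qed.

Lemma Lw_respects i h : respects (Lw i h).
Proof.
elim: i => [|i IHi]; first exact: L0_respects.
apply: (@respects_rec _ _ _ _ _ (Lw i h)
  (fun a _ _ x => ksgn (hd h * hd a) (pre a x))).
- by left.
- by move=> a _ _; apply: zm_ksgn_fun; exact: pre_zm.
- by [].
- move=> [|d v] a b c ac bc cab /=.
    by have [? ? ?] := hmul_addr h ac bc cab; exact: pw_add.
  by rewrite ac bc -ksgnD (pre_add _ ac bc cab).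
move=> v a b e r er; rewrite [LHS]/= [RHS]/= Lw_L0 ksgn_pre ksgn_add -pre_balL //.
by apply: ksgn_eq; rewrite hd_mul mulrDr.
Qed.

Lemma L_zm i h : zmod_morphism (L i h).
Proof. exact/tl_zm/Lw_respects. Qed.

Lemma L_pw i h a s : L i h (pw (a :: s)) = Lw i h (a :: s).
Proof. exact/tl_pw/Lw_respects. Qed.

Lemma ksgn_L n i h x : L i h (ksgn n x) = ksgn n (L i h x).
Proof. exact/zm_ksgn/L_zm. Qed.

Lemma LS_pre i h a x : L i.+1 h (pre a x) = ksgn (hd h * hd a) (pre a (L i h x)).
Proof.
apply: (tens_ext (f := fun x => L i.+1 h (pre a x))
  (g := fun x => ksgn (hd h * hd a) (pre a (L i h x)))).
- exact: (zm_comp (@L_zm _ h) (@pre_zm a)).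
- by apply: zm_ksgn_fun; exact: (zm_comp (@pre_zm a) (@L_zm _ h)).
by move=> b s; rewrite pre_pw !L_pw.
Qed.

Lemma L_single i h a : L i h (pw [:: a]) = pw [:: hmul h a].
Proof. by rewrite L_pw; case: i. Qed.

(** Both operators are multiplications by elements of the tensor power of A, which is
    graded-commutative. *)
Lemma LL_comm i j h g x :
  L i h (L j g x) = ksgn (hd h * hd g) (L j g (L i h x)).
Proof.
move: x; apply: tens_ext.
- exact: (zm_comp (@L_zm _ h) (@L_zm _ g)).
- by apply: zm_ksgn_fun; exact: (zm_comp (@L_zm _ g) (@L_zm _ h)).
move=> a s; elim: s a i j => [|b s IHs] a i j.
  by rewrite !L_single pw_mulC.
rewrite -!pre_pw; case: i => [|i]; case: j => [|j].
- by rewrite !L0_pre !pre_pw pw_mulC.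
- rewrite !(L0_pre, LS_pre, ksgn_L, ksgn_add); apply: ksgn_eq.
  by rewrite hd_mul; sgn_parity.
- rewrite !(L0_pre, LS_pre, ksgn_L, ksgn_add); apply: ksgn_eq.
  by rewrite hd_mul; sgn_parity.
rewrite !(LS_pre, ksgn_L, ksgn_add) IHs ksgn_pre ksgn_add; apply: ksgn_eq.
by sgn_parity.
Qed.

Lemma L0_mul h g x : L 0 h (L 0 g x) = L 0 (hmul h g) x.
Proof.
move: x; apply: tens_ext.
- exact: (zm_comp (@L_zm _ h) (@L_zm _ g)).
- exact: L_zm.
by move=> a s; rewrite !L0_pw hmulA.
Qed.

Lemma tens_ne_pre a n e x : tens_ne n e x -> tens_ne n.+1 (hd a + e) (pre a x).
Proof.
apply: tens_ne_map; first exact: pre_zm.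
move=> b s <- <-; rewrite pre_pw -swd_cons; exact (pw_tens_ne iota a (b :: s)).
Qed.

Lemma tens_n_pre a n x : tens_n n x -> tens_n n.+1 (pre a x).
Proof.
apply: tens_n_map; first exact: pre_zm.
by move=> b s <-; rewrite pre_pw; exact (pw_tens_n iota a (b :: s)).
Qed.

Lemma tens_ne_L i h n e x : tens_ne n e x -> tens_ne n (hd h + e) (L i h x).
Proof.
move: x; apply: tens_ne_map; first exact: L_zm.
move=> a s sn se.
suff : tens_ne n (hd h + e) (L i h (pw (a :: s))) by [].
elim: s a i n e sn se => [|b s IHs] a i n e <- <-.
  rewrite L_single swd_cons swd_nil addr0.
  by have := pw_tens_ne iota (hmul h a) [::]; rewrite swd_cons swd_nil addr0.
rewrite -pre_pw; case: i => [|i].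
  rewrite L0_pre pre_pw swd_cons addrA -hd_mul -swd_cons.
  exact (pw_tens_ne iota (hmul h a) (b :: s)).
rewrite LS_pre; apply: span_ksgn; rewrite swd_cons addrCA.
by apply: tens_ne_pre; exact: IHs.
Qed.

Lemma tens_n_L i h n x : tens_n n x -> tens_n n (L i h x).
Proof.
move: x; apply: tens_n_map; first exact: L_zm.
move=> a s <-; have /(tens_ne_L i h) := pw_tens_ne iota a s.
exact: tens_ne_n.
Qed.

(** * The cup product *)

Definition sg : tens -> tens := tl (fun s => ksgn (swd s) (pw s)).

Lemma sg_zm : zmod_morphism sg.
Proof. exact/tl_zm/respects_sgn/pw_respects. Qed.

Lemma sg_pw a s : sg (pw (a :: s)) = ksgn (swd (a :: s)) (pw (a :: s)).
Proof. exact/tl_pw/respects_sgn/pw_respects. Qed.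

Lemma sg_ne n e x : tens_ne n e x -> sg x = ksgn e x.
Proof.
apply: tens_ne_ext; [exact: sg_zm|exact: ksgn_zm|].
by move=> a s _ <-; rewrite sg_pw.
Qed.

Lemma sg_pre a x : sg (pre a x) = ksgn (hd a) (pre a (sg x)).
Proof.
move: x; apply: tens_ext.
- exact: (zm_comp sg_zm (@pre_zm a)).
- by apply: zm_ksgn_fun; exact: (zm_comp (@pre_zm a) sg_zm).
by move=> b s; rewrite pre_pw !sg_pw ksgn_pre pre_pw ksgn_add swd_cons.
Qed.

Lemma sg_L i h x : sg (L i h x) = ksgn (hd h) (L i h (sg x)).
Proof.
move: x; apply: tens_ext.
- exact: (zm_comp sg_zm (@L_zm i h)).
- by apply: zm_ksgn_fun; exact: (zm_comp (@L_zm i h) sg_zm).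
move=> a s; rewrite (sg_ne (tens_ne_L i h (pw_tens_ne iota a s))).
by rewrite sg_pw ksgn_L ksgn_add.
Qed.

(** The sign (-1)^(m q) of the cup product is spread over the m steps of the left factor: each step
    applies [sg] once to the right factor. *)
Fixpoint cupw s y : tens :=
  if s is a :: s' then
    if s' is _ :: _ then pre a (cupw s' (sg y)) else L 0 a y
  else 0.

Lemma cupw_zm s : zmod_morphism (cupw s).
Proof.
elim: s => [|a [|b s] IHs]; first by move=> x y; rewrite subr0.
  exact: L_zm.
exact: (zm_comp (zm_comp (@pre_zm a) IHs) sg_zm).
Qed.

Lemma cupw_L0 h b s y : cupw (hmul h b :: s) y = L 0 h (cupw (b :: s) y).
Proof. by case: s => [|c s] /=; rewrite ?L0_pre ?L0_mul. Qed.

Lemma L0_add a b c x : hd a = hd c -> hd b = hd c -> hv c = hv a + hv b ->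
  L 0 c x = L 0 a x + L 0 b x.
Proof.
move=> ac bc cab; apply: (tens_ext (g := fun x => L 0 a x + L 0 b x)).
- exact: L_zm.
- by apply: zm_add; exact: L_zm.
move=> d s; rewrite !L0_pw; have [? ? ?] := hmul_addl d ac bc cab; exact: pw_add.
Qed.

Lemma cupwS a b s y : cupw (a :: b :: s) y = pre a (cupw (b :: s) (sg y)).
Proof. by []. Qed.

Lemma cupw_respects y : respects (cupw ^~ y).
Proof.
have cupS a u b s z : cupw (a :: u ++ b :: s) z = pre a (cupw (u ++ b :: s) (sg z)).
  by case: u.
split=> [u|u].
  elim: u y => [|d u IHu] y v a b c ac bc cab; last first.
    by rewrite !cat_cons !cupS (IHu _ v a b c) // (zmD (@pre_zm d)).
  by case: v => [|d v] /=; [exact: L0_add | exact: pre_add].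
elim: u y => [|d u IHu] y v a b e r er; last by rewrite !cat_cons !cupS IHu.
by rewrite !cupwS cupw_L0 pre_balL.
Qed.

Lemma glueE a s (w : word A) : ksgn ((size s)%:Z * wdeg w) (pure iota (glue a s w))
  = cupw (a :: s) (pw (sq w)).
Proof.
elim: s a => [|b s IHs] a.
  by rewrite mul0r ksgn_even //= L0_pw.
rewrite cupwS sg_pw (zm_ksgn (@cupw_zm _)) ksgn_pre -IHs.
rewrite /= pureE -pre_pw -pureE ksgn_pre ksgn_add.
by apply: ksgn_eq; rewrite /= /wdeg -/(swd _); sgn_parity.
Qed.

(** The bilinear extension on representatives is traded for two linear ones, each of which is known
    to descend; additivity of [cup] in both variables follows. *)
Lemma cupE x y : cup x y = tl (cupw ^~ y) x.
Proof.
rewrite /cup /tlift2 /tl /tlift1; apply: eq_lift1 => v.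
rewrite -{2}[y]repK; set Y := rep y.
rewrite [RHS](words_morph (g := fun Y => cupw (sq v) (cls (tens_rel iota) Y))).
  by apply: eq_lift1 => w; case: v => a s; rewrite glueE -pureE.
exact: (zm_comp (@cupw_zm _) (@cls_zm _ _)).
Qed.

Lemma cup_zml y : zmod_morphism (fun x => cup x y).
Proof. by move=> x x'; rewrite !cupE; apply: tl_zm; exact: cupw_respects. Qed.

Lemma cup_pw a s y : cup (pw (a :: s)) y = cupw (a :: s) y.
Proof. by rewrite cupE tl_pw //; exact: cupw_respects. Qed.

Lemma cup_zmr x : zmod_morphism (fun y => cup x y).
Proof.
move=> y y'; move: x; apply: tens_ext.
- exact: cup_zml.
- by apply: zm_sub; exact: cup_zml.
by move=> a s; rewrite !cup_pw cupw_zm.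
Qed.

Lemma cup_single a y : cup (pw [:: a]) y = L 0 a y.
Proof. by rewrite cup_pw. Qed.

Lemma cup_pre a x y : cup (pre a x) y = pre a (cup x (sg y)).
Proof.
move: x; apply: tens_ext.
- exact: (zm_comp (@cup_zml y) (@pre_zm a)).
- exact: (zm_comp (@pre_zm a) (@cup_zml _)).
by move=> b s; rewrite pre_pw !cup_pw.
Qed.

Lemma L0_cup h x y : L 0 h (cup x y) = cup (L 0 h x) y.
Proof.
move: x; apply: tens_ext.
- exact: (zm_comp (@L_zm 0 h) (@cup_zml y)).
- exact: (zm_comp (@cup_zml y) (@L_zm 0 h)).
by move=> a s; rewrite L0_pw !cup_pw cupw_L0.
Qed.

Lemma L_cupl n i h x y : tens_n n x -> (i <= n)%N ->
  L i h (cup x y) = cup (L i h x) y.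
Proof.
move=> xn; move: x xn; move=> x xn le_in; move: x xn; apply: tens_n_ext.
- exact: (zm_comp (@L_zm i h) (@cup_zml y)).
- exact: (zm_comp (@cup_zml y) (@L_zm i h)).
move=> a s; elim: s a i n le_in y => [|b s IHs] a i n le_in y sn.
  by move: le_in; rewrite -sn leqn0 => /eqP ->; rewrite L0_cup.
rewrite -pre_pw; case: i le_in => [|i] le_in; first by rewrite L0_cup.
rewrite cup_pre !LS_pre (zm_ksgn (@cup_zml y)) cup_pre.
by rewrite (IHs _ _ n.-1) //; move: sn => /=; lia.
Qed.

(** Slot j of [y] becomes slot n + j of the product. The sign sees the total degree e + n of [x]: e
    from passing [h] over its slots, n because [h] changes the internal degree of [y] in the sign of
    the cup product. *)
Lemma L_cupr n e j h x y : tens_ne n e x ->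
  cup x (L j h y) = ksgn (hd h * (e + n%:Z)) (L (n + j) h (cup x y)).
Proof.
move: x; apply: tens_ne_ext.
- exact: cup_zml.
- by apply: zm_ksgn_fun; exact: (zm_comp (@L_zm _ h) (@cup_zml y)).
move=> a s; elim: s a n e y => [|b s IHs] a n e y.
  rewrite swd_cons swd_nil => <- <-; rewrite !cup_single LL_comm.
  by apply: ksgn_eq; rewrite !addr0 mulrC.
move=> <- <-; rewrite -pre_pw !cup_pre sg_L (zm_ksgn (@cup_zmr _)) ksgn_pre.
rewrite (IHs _ _ _ _ erefl erefl) ksgn_pre ksgn_add addSn LS_pre ksgn_add.
by apply: ksgn_eq; rewrite [swd (a :: _)]swd_cons /=; sgn_parity.
Qed.

Lemma cup_ne m n d e x y : tens_ne m d x -> tens_ne n e y ->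
  tens_ne (m + n) (d + e) (cup x y).
Proof.
move=> xm yn; move: x xm; apply: tens_ne_map; first exact: cup_zml.
move=> a s; elim: s a m d y yn => [|b s IHs] a m d y yn <- <-.
  rewrite cup_single swd_cons swd_nil addr0; exact: tens_ne_L.
rewrite -pre_pw cup_pre swd_cons -addrA; apply: tens_ne_pre.
apply: IHs => //; rewrite (sg_ne yn); exact: span_ksgn.
Qed.

(** * Codegeneracies and cofaces *)

Definition cw i s : tens := if s is a :: s' then pure iota (merge_word i a s') else 0.

Lemma cwS i a b s : cw i.+1 (a :: b :: s) = pre a (cw i (b :: s)).
Proof. by rewrite /= pureE -pre_pw -pureE. Qed.

Lemma cw_L0 i h b s : cw i (hmul h b :: s) = L 0 h (cw i (b :: s)).
Proof.
case: s => [|c s]; first by case: i => [|i]; exact (esym (L0_pw h b [::])).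
case: i => [|i]; last by rewrite !cwS L0_pre.
by rewrite /cw /= -hmulA; exact (esym (L0_pw h (hmul b c) s)).
Qed.

Lemma cw_respects i : respects (cw i).
Proof.
elim: i => [|i IHi].
  apply: (@respects_rec _ _ _ _ _ pw (fun a _ _ => L 0 a)).
  - by left; exact: pw_respects.
  - by move=> a _ _; exact: L_zm.
  - by move=> a b s; rewrite L0_pw.
  - move=> [|d v] a b c ac bc cab; first exact: pw_add.
    have [? ? ?] := hmul_addl d ac bc cab; exact: pw_add.
  by move=> v a b e r er; rewrite /= hmulA.
apply: (@respects_rec _ _ _ _ _ (cw i) (fun a _ _ => pre a)).
- by left.
- by move=> a _ _; exact: pre_zm.
- by move=> a b s; rewrite cwS.
- move=> [|d v] a b c ac bc cab; first exact: pw_add.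
  by rewrite !cwS; exact: pre_add.
by move=> v a b e r er; rewrite !cwS cw_L0 pre_balL.
Qed.

Lemma codegenE i : @codegen _ _ iota i = tl (cw i).
Proof. by []. Qed.

Lemma codegen_zm i : zmod_morphism (@codegen _ _ iota i).
Proof. rewrite codegenE; exact/tl_zm/cw_respects. Qed.

Lemma codegen_pw i a s : codegen i (pw (a :: s)) = cw i (a :: s).
Proof. rewrite codegenE; exact/tl_pw/cw_respects. Qed.

Lemma codegenS_pre i a x : codegen i.+1 (pre a x) = pre a (codegen i x).
Proof.
move: x; apply: tens_ext.
- exact: (zm_comp (@codegen_zm _) (@pre_zm a)).
- exact: (zm_comp (@pre_zm a) (@codegen_zm _)).
by move=> b s; rewrite pre_pw !codegen_pw cwS.
Qed.

Lemma codegen0_pre a x : codegen 0 (pre a x) = L 0 a x.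
Proof.
move: x; apply: tens_ext.
- exact: (zm_comp (@codegen_zm _) (@pre_zm a)).
- exact: L_zm.
by move=> b s; rewrite pre_pw !codegen_pw L0_pw.
Qed.

Lemma codegen_L0 i h x : codegen i (L 0 h x) = L 0 h (codegen i x).
Proof.
move: x; apply: tens_ext.
- exact: (zm_comp (@codegen_zm _) (@L_zm _ h)).
- exact: (zm_comp (@L_zm _ h) (@codegen_zm _)).
by move=> b s; rewrite L0_pw !codegen_pw cw_L0.
Qed.

(** Slots i and i + 1 are merged into slot i, and the later slots move down by one. *)
Lemma codegen_L n i j h x : tens_n n x -> (i < n)%N -> (j <= n)%N ->
  codegen i (L j h x) = L (if (j <= i)%N then j else j.-1) h (codegen i x).
Proof.
move=> xn lt_in le_jn; move: x xn; apply: tens_n_ext.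
- exact: (zm_comp (@codegen_zm _) (@L_zm _ h)).
- exact: (zm_comp (@L_zm _ h) (@codegen_zm _)).
move=> a s; elim: s a i j n lt_in le_jn => [|b s IHs] a i j n lt_in le_jn sn.
  by move: lt_in; rewrite -sn.
rewrite -pre_pw; case: j le_jn => [|j] le_jn; first by rewrite codegen_L0.
rewrite LS_pre (zm_ksgn (@codegen_zm i)).
case: i lt_in => [|i] lt_in.
  by rewrite !codegen0_pre LL_comm ksgn_add ksgn_even //; sgn_parity.
rewrite !codegenS_pre (IHs _ _ _ n.-1) -?LS_pre; [|move: sn => /=; lia..].
by congr (L _ _ _); case: ifP; case: ifP; lia.
Qed.

Lemma codegen_id n i x : tens_n n x -> (n <= i)%N -> codegen i x = x.
Proof.
move=> xn le_ni; move: x xn; apply: tens_n_ext; [exact: codegen_zm|by []|].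
move=> a s; elim: s a i n le_ni => [|b s IHs] a i n le_ni sn.
  by rewrite codegen_pw; case: i {le_ni}.
rewrite -pre_pw; case: i le_ni => [|i] le_ni; first by move: le_ni; rewrite -sn.
by rewrite codegenS_pre (IHs _ _ n.-1) //; move: sn => /=; lia.
Qed.

Lemma codegen_n n i x : tens_n n x -> (i < n)%N -> tens_n n.-1 (codegen i x).
Proof.
move=> xn lt_in; move: x xn; apply: tens_n_map; first exact: codegen_zm.
move=> a s; elim: s a i n lt_in => [|b s IHs] a i n lt_in sn.
  by move: lt_in; rewrite -sn.
rewrite -pre_pw; case: i lt_in => [|i] lt_in.
  by rewrite codegen0_pre -sn; apply: tens_n_L; exact: pw_tens_n.
rewrite codegenS_pre -sn; have := IHs b i n.-1.
rewrite -sn /=; case: s {IHs} sn => [|c s] sn; first by move: lt_in; rewrite -sn.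
move=> IHs; apply: tens_n_pre; apply: IHs => //.
by move: lt_in; rewrite -sn.
Qed.

(** The coface that inserts a 1 after slot [i]; multiplying slots i and i + 1 together undoes it. *)
Fixpoint iw i s : tens :=
  if s is a :: s' then
    if i is i'.+1 then
      if s' is _ :: _ then pre a (iw i' s') else pw [:: a; h1 A]
    else pw (a :: h1 A :: s')
  else 0.

Lemma iw_L0 i h b s : iw i (hmul h b :: s) = L 0 h (iw i (b :: s)).
Proof.
case: s => [|c s]; first by case: i => [|i]; rewrite /= L0_pw.
by case: i => [|i] /=; rewrite ?L0_pre ?L0_pw.
Qed.

Lemma iw_respects i : respects (iw i).
Proof.
elim: i => [|i IHi].
  apply: (@respects_rec _ _ _ _ _ pw (fun a _ _ x => pre a (pre (h1 A) x))).
  - by left; exact: pw_respects.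
  - by move=> a _ _; exact: (zm_comp (@pre_zm _) (@pre_zm _)).
  - by move=> a b s; rewrite !pre_pw.
  - by move=> v a b c ac bc cab; exact: pw_add.
  move=> v a b e r er.
  (* The scalar crosses the inserted 1 in two balancing steps. *)
  transitivity (pw [:: a, hmul (rho e r) (h1 A), b & v]).
    exact (resp_bal (pw_respects iota) [::] (b :: v) a (h1 A) er).
  rewrite hmulh1 -{1}[rho e r]hmul1h.
  exact (resp_bal (pw_respects iota) [:: a] v (h1 A) b er).
apply: (@respects_rec _ _ _ _ _ (iw i) (fun a _ _ => pre a)).
- by left.
- by move=> a _ _; exact: pre_zm.
- by [].
- move=> [|d v] a b c ac bc cab; first exact: pw_add.
  exact: pre_add.
move=> v a b e r er; rewrite [LHS]/= [RHS]/= iw_L0 pre_balL //.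
Qed.

Definition ins i : tens -> tens := tl (iw i).

Lemma ins_zm i : zmod_morphism (ins i).
Proof. exact/tl_zm/iw_respects. Qed.

Lemma ins_pw i a s : ins i (pw (a :: s)) = iw i (a :: s).
Proof. exact/tl_pw/iw_respects. Qed.

Lemma insS_pre i a x : ins i.+1 (pre a x) = pre a (ins i x).
Proof.
move: x; apply: tens_ext.
- exact: (zm_comp (@ins_zm _) (@pre_zm a)).
- exact: (zm_comp (@pre_zm a) (@ins_zm _)).
by move=> b s; rewrite pre_pw !ins_pw.
Qed.

Lemma ins0_pre a x : ins 0 (pre a x) = pre a (pre (h1 A) x).
Proof.
move: x; apply: tens_ext.
- exact: (zm_comp (@ins_zm _) (@pre_zm a)).
- exact: (zm_comp (@pre_zm a) (@pre_zm _)).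
by move=> b s; rewrite pre_pw !ins_pw /= !pre_pw.
Qed.

Lemma ins_single i a : ins i (pw [:: a]) = pre a (pw [:: h1 A]).
Proof. by rewrite ins_pw pre_pw; case: i. Qed.

Lemma ins_L0 i h x : ins i (L 0 h x) = L 0 h (ins i x).
Proof.
move: x; apply: tens_ext.
- exact: (zm_comp (@ins_zm _) (@L_zm _ h)).
- exact: (zm_comp (@L_zm _ h) (@ins_zm _)).
by move=> b s; rewrite L0_pw !ins_pw iw_L0.
Qed.

Lemma ins_L n i j h x : tens_n n x -> (j <= n)%N ->
  ins i (L j h x) = L (if (j <= i)%N then j else j.+1) h (ins i x).
Proof.
move=> xn le_jn; move: x xn; apply: tens_n_ext.
- exact: (zm_comp (@ins_zm _) (@L_zm _ h)).
- exact: (zm_comp (@L_zm _ h) (@ins_zm _)).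
move=> a s; elim: s a i j n le_jn => [|b s IHs] a i j n le_jn sn.
  by move: le_jn; rewrite -sn leqn0 => /eqP ->; rewrite ins_L0.
rewrite -pre_pw; case: j le_jn => [|j] le_jn; first by rewrite ins_L0.
rewrite LS_pre (zm_ksgn (@ins_zm i)).
case: i => [|i].
  by rewrite !ins0_pre !LS_pre hd_h1 mulr0 [ksgn 0 _]ksgn_even.
rewrite !insS_pre (IHs _ _ _ n.-1) -?LS_pre; [|move: sn => /=; lia..].
by congr (L _ _ _); case: ifP; case: ifP; lia.
Qed.

Lemma ins_n n i x : tens_n n x -> tens_n n.+1 (ins i x).
Proof.
move: x; apply: tens_n_map; first exact: ins_zm.
move=> a s <-; elim: s a i => [|b s IHs] a i.
  by rewrite ins_single pre_pw; exact (pw_tens_n iota a [:: h1 A]).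
rewrite -pre_pw; case: i => [|i].
  by rewrite ins0_pre !pre_pw; exact (pw_tens_n iota a [:: h1 A, b & s]).
by rewrite insS_pre; apply: tens_n_pre; exact: IHs.
Qed.

End TensorOps.

Arguments Lw : simpl never.
Arguments iw : simpl never.
Arguments cw : simpl never.
Arguments cupw : simpl never.
Arguments pw : simpl never.

(** * Powers of the diagonal ideal *)

(** The map [g] is additive only between slots of equal degree, so the relation in [A] is first
    split into homogeneous components; each of them vanishes by independence of the grading. *)
Lemma sum_by_degree (A : cdga) (V : zmodType) (I : eqType) (r : seq I) (P : pred I)
    (c : I -> int) (h : I -> helt A) (g : helt A -> V) :
  (forall a b d : helt A, hd a = hd d -> hd b = hd d -> hv d = hv a + hv b ->
     g d = g a + g b) ->
  \sum_(i <- r | P i) hv (h i) *~ c i = 0 -> \sum_(i <- r | P i) g (h i) *~ c i = 0.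
Proof.
move=> gD sum0; have [V0 VB _ Vind] := gdeg_grading A.
have VD e (a b : A) : gdeg e a -> gdeg e b -> gdeg e (a + b).
  by move=> ea eb; have := VB e a (0 - b) ea (VB e 0 b (V0 e) eb); rewrite sub0r opprK.
have Vsum e (J : Type) (s : seq J) (Q : pred J) (F : J -> A) :
    (forall j, Q j -> gdeg e (F j)) -> gdeg e (\sum_(j <- s | Q j) F j).
  by move=> QF; apply: (big_ind (fun a : A => gdeg e a)) => // a b; exact: VD.
have Vmulz e (a : A) (n : int) : gdeg e a -> gdeg e (a *~ n).
  have VMn m : gdeg e a -> gdeg e (a *+ m).
    by move=> ea; elim: m => [|m IHm]; [exact: V0 | rewrite mulrS; exact: VD].
  move=> ea; case: n => n; rewrite -?pmulrn; first exact: VMn.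
  rewrite NegzE mulrNz -pmulrn -sub0r.
  exact (VB e 0 _ (V0 e) (VMn _ ea)).
pose d i := hd (h i); pose s := undup [seq d i | i <- r].
have split_deg (W : zmodType) (F : I -> W) : \sum_(i <- r | P i) F i =
    \sum_(e <- s) \sum_(i <- r | P i && (d i == e)) F i.
  rewrite (exchange_big_dep P) /=; last by move=> ? ? _ /andP[].
  rewrite big_seq_cond [RHS]big_seq_cond; apply: eq_bigr => i /andP[ri Pi].
  rewrite big_mkcond (bigD1_seq (d i)) ?undup_uniq ?mem_undup ?map_f //=.
  rewrite Pi eqxx big1 ?addr0 // => e; rewrite eq_sym => /negPf ->.
  by [].
pose f e := \sum_(i <- r | P i && (d i == e)) hv (h i) *~ c i.
have fdeg e : gdeg e (f e).
  by apply: Vsum => i /andP[_ /eqP <-]; apply: Vmulz; exact: hP.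
have f0 e : e \in s -> f e = 0.
  by move=> es; apply: (Vind s f) => //; [exact: undup_uniq | rewrite -split_deg].
rewrite split_deg big_seq; apply: big1 => e es.
pose G (a : A) := g (mkh e a).
have GD (a b : A) : gdeg e a -> gdeg e b -> G (a + b) = G a + G b.
  by move=> ea eb; apply: gD; rewrite ?hd_mkh ?hv_mkh //; exact: VD.
have G0 : G 0 = 0.
  have /eqP := GD _ _ (V0 e) (V0 e).
  by rewrite addr0 -{1}[G 0]addr0 (can_eq (addKr _)) eq_sym => /eqP.
have GN (a : A) : gdeg e a -> G (- a) = - G a.
  move=> ea; apply/eqP; rewrite -addr_eq0 -GD ?addNr ?G0 //.
  by rewrite -sub0r; exact (VB e 0 a (V0 e) ea).
have Gz (a : A) (n : int) : gdeg e a -> G (a *~ n) = G a *~ n.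
  move=> ea.
  have GMn m : G (a *+ m) = G a *+ m.
    elim: m => [|m IHm]; first exact: G0.
    by rewrite !mulrS GD ?IHm //; have := Vmulz e a m%:Z ea; rewrite -pmulrn.
  case: n => n; rewrite -?pmulrn ?GMn // NegzE !mulrNz -!pmulrn GN ?GMn //.
  by have := Vmulz e a n.+1%:Z ea; rewrite -pmulrn.
transitivity (G (f e)); last by rewrite f0.
rewrite /f; elim: (r) => [|i r' IHr]; first by rewrite !big_nil.
rewrite !big_cons; case: ifP => // /andP[_ /eqP di].
have hi : gdeg e (hv (h i)) by rewrite -di; exact: hP.
rewrite GD ?Gz ?IHr.
- by rewrite /G -di mkh_hdv.
- exact: hi.
- exact: Vmulz.
by apply: Vsum => j /andP[_ /eqP <-]; apply: Vmulz; exact: hP.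
Qed.

Section Kfiltration.
Variables (R A : cdga) (iota : cdga_hom R A).
Local Notation helt := (helt A).
Local Notation tens := (tens iota).
Local Notation pw := (@pw _ _ iota).
Implicit Types (a b c h g : helt) (s t u v : seq helt) (x y z : tens).
Local Notation respects := (respects iota).
Local Notation L i h := (@tl _ _ iota _ (Lw iota i h)).

(** Generators of powers of the diagonal ideal in cosimplicial degree n: the element acting by
    [L i h - L j h] is h in slot i minus h in slot j. Unlike [diag_pow], this form is visibly stable
    under every map that only relabels slots. *)
Fixpoint Kd (n q : nat) : set tens :=
  if q is q'.+1 then
    span [set z | exists i j h x,
      [/\ (i <= n)%N, (j <= n)%N, Kd n q' x & z = L i h x - L j h x]]
  else tens_n n.

Lemma Kd0 n q : Kd n q 0. Proof. by case: q => [|q]; exact: span0. Qed.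

Lemma KdB n q x y : Kd n q x -> Kd n q y -> Kd n q (x - y).
Proof. by case: q => [|q]; exact: spanB. Qed.

Lemma KdD n q x y : Kd n q x -> Kd n q y -> Kd n q (x + y).
Proof. by case: q => [|q]; exact: spanD. Qed.

Lemma Kd_mulz n q x (m : int) : Kd n q x -> Kd n q (x *~ m).
Proof. by case: q => [|q]; exact: span_mulz. Qed.

Lemma Kd_tens n q x : Kd n q x -> tens_n n x.
Proof.
elim: q x => [//|q IHq] x.
apply: span_ind => [|y z|_ [i [j [h [y [_ _ /IHq yn ->]]]]]].
- exact: span0.
- exact: spanB.
by apply: spanB; apply: tens_n_L.
Qed.

(** A map that turns multiplication in slot j into multiplication in slot [tau j], up to a sign
    depending on [h] alone, sends generators to generators. Codegeneracies, cofaces and cup products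
    are all of this kind. *)
Lemma Kd_map n n' (f : tens -> tens) (sigma : helt -> int) (tau : nat -> nat) :
  zmod_morphism f -> (forall x, tens_n n x -> tens_n n' (f x)) ->
  (forall j, (j <= n)%N -> (tau j <= n')%N) ->
  (forall j h x, (j <= n)%N -> tens_n n x ->
     f (L j h x) = ksgn (sigma h) (L (tau j) h (f x))) ->
  forall q x, Kd n q x -> Kd n' q (f x).
Proof.
move=> fB fn tau_n fL; elim=> [|q IHq]; first exact: fn.
apply: span_map => // _ [i [j [h [x [le_in le_jn xq ->]]]]].
rewrite fB !fL //; try exact: (Kd_tens xq).
rewrite -ksgnB; apply: span_ksgn; apply: span_in.
by exists (tau i), (tau j), h, (f x); split => //; [exact: tau_n|exact: tau_n|exact: IHq].
Qed.

Lemma Kd_L n q i h x : (i <= n)%N -> Kd n q x -> Kd n q (L i h x).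
Proof.
move=> le_in; elim: q x => [|q IHq]; first exact: tens_n_L.
apply: span_map; first exact: L_zm.
move=> _ [j [l [g [x [le_jn le_ln xq ->]]]]].
rewrite (L_zm i h) !(LL_comm i) -ksgnB; apply/span_ksgn/span_in.
by exists j, l, g, (L i h x); split => //; exact: IHq.
Qed.

Lemma Kd_S n q x : Kd n q.+1 x -> Kd n q x.
Proof.
apply: span_ind; [exact: Kd0|exact: KdB|move=> _ [i [j [h [y [? ? yq ->]]]]]].
by apply: KdB; exact: Kd_L.
Qed.

Lemma Kd_mono n p q x : (p <= q)%N -> Kd n q x -> Kd n p x.
Proof.
elim: q => [|q IHq]; first by rewrite leqn0 => /eqP ->.
by rewrite leq_eqVlt => /predU1P[-> //|]; rewrite ltnS => pq /Kd_S; exact: IHq.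
Qed.

(** The cosimplicial degree is forgotten because representatives in [hat] may differ in several
    cosimplicial degrees at once. *)
Definition KK (p : nat) : set tens := span [set x | exists n, Kd n p x].

Lemma Kd_KK n p x : Kd n p x -> KK p x.
Proof. by move=> xK; apply: span_in; exists n. Qed.

Lemma KK_mono p q x : (p <= q)%N -> KK q x -> KK p x.
Proof.
move=> pq; apply: span_map; first exact: zm_id.
by move=> y [n yn]; apply: Kd_KK; exact: Kd_mono yn.
Qed.

Lemma KK_codegen i p x : KK p x -> KK p (codegen i x).
Proof.
move: x; apply: span_map; first exact: codegen_zm.
move=> x [n xn]; case: (ltnP i n) => [lt_in|le_ni]; last first.
  by rewrite (codegen_id (Kd_tens xn)) //; exact: Kd_KK xn.
apply: (@Kd_KK n.-1); move: xn.
apply: (@Kd_map n n.-1 _ (fun _ => 0)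
  (fun j => if (j <= i)%N then j else j.-1)).
- exact: codegen_zm.
- by move=> y yn; exact: codegen_n.
- by move=> j; case: ifP; lia.
by move=> j h y le_jn yn; rewrite (codegen_L _ yn).
Qed.

Lemma KK_ins i p x : KK p x -> KK p (ins i x).
Proof.
move: x; apply: span_map; first exact: ins_zm.
move=> x [n xn]; apply: (@Kd_KK n.+1); move: xn.
apply: (@Kd_map n n.+1 _ (fun _ => 0) (fun j => if (j <= i)%N then j else j.+1)).
- exact: ins_zm.
- by move=> y; exact: ins_n.
- by move=> j; case: ifP; lia.
by move=> j h y le_jn yn; rewrite (ins_L _ _ yn).
Qed.

Lemma cup_n m n x y : tens_n m x -> tens_n n y -> tens_n (m + n) (cup x y).
Proof.
move=> xm yn; move: x xm; apply: tens_n_map; first exact: cup_zml.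
move=> a s sm; move: y yn; apply: tens_n_map; first exact: cup_zmr.
move=> b t tn; have := cup_ne (pw_tens_ne iota a s) (pw_tens_ne iota b t).
by rewrite sm tn; exact: tens_ne_n.
Qed.

Lemma KK_cupl p x y : KK p x -> KK p (cup x y).
Proof.
(* The other factor is reduced to a pure tensor, so that the product has a definite cosimplicial
   degree. *)
move=> xK; apply: (span_map (@cup_zmr _ _ _ x)) (tens_span y) => _ [[b t] _ <-].
move: x xK; apply: span_map; first exact: cup_zml.
move=> x [n xn]; apply: (@Kd_KK (n + size t)); move: xn.
have tn := pw_tens_n iota b t.
apply: (@Kd_map _ _ (fun x => cup x (pw (b :: t))) (fun _ => 0) id).
- exact: cup_zml.
- by move=> z zn; exact: cup_n.
- by move=> j; lia.
by move=> j h z le_jn zn; rewrite (L_cupl _ _ zn).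
Qed.

Lemma KK_cupr p x y : KK p y -> KK p (cup x y).
Proof.
move=> yK; apply: (span_map (@cup_zml _ _ _ y)) (tens_span x) => _ [[b t] _ <-].
move: y yK; apply: span_map; first exact: cup_zmr.
move=> y [n yn]; apply: (@Kd_KK (size t + n)); move: yn.
have tn := pw_tens_ne iota b t.
apply: (@Kd_map _ _ (fun x => cup (pw (b :: t)) x)
  (fun h => hd h * (swd (b :: t) + (size t)%:Z)) (addn (size t))).
- exact: cup_zmr.
- by move=> z zn; apply: cup_n => //; exact: pw_tens_n.
- by move=> j; lia.
by move=> j h z le_jn zn; rewrite (L_cupr _ _ _ tn).
Qed.

Fixpoint LLi i s x : tens := if s is a :: s' then L i a (LLi i.+1 s' x) else x.

Lemma LLi_zm i s : zmod_morphism (LLi i s).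
Proof.
elim: s i => [|a s IHs] i //=.
exact: (zm_comp (@L_zm _ _ _ i a) (IHs i.+1)).
Qed.

Lemma LLi_pre i s b x :
  LLi i.+1 s (pre b x) = ksgn (swd s * hd b) (pre b (LLi i s x)).
Proof.
elim: s i => [|a s IHs] i /=; first by rewrite swd_nil mul0r ksgn_even.
rewrite IHs ksgn_L LS_pre ksgn_add; apply: ksgn_eq.
by rewrite swd_cons; sgn_parity.
Qed.

Lemma LLi_pw a s b t : size s = size t ->
  LLi 0 (a :: s) (pw (b :: t)) = ksgn (koszul (a :: s) (b :: t))
    (pw (hmul a b :: [seq hmul p.1 p.2 | p <- zip s t])).
Proof.
elim: s a b t => [|c s IHs] a b [|d t] //= => [_|[st]].
  by rewrite big_nil mul0r ksgn_even //= L0_pw.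
rewrite -pre_pw -/(LLi 1 (c :: s) _) LLi_pre ksgn_L L0_pre IHs // ksgn_pre pre_pw.
by rewrite ksgn_add.
Qed.

(** Multiplying by a pure tensor amounts to multiplying successively in all slots; the Koszul sign
    of the levelwise product is the one accumulated by the slot multiplications. *)
Lemma level_mulE n x y : tens_n n y ->
  level_mul x y = lift1 (fun w => if size w.2 == n then LLi 0 (sq w) y else 0) (rep x).
Proof.
move=> yn; rewrite /level_mul /tlift2; apply: eq_lift1 => -[a s] /=.
pose F t := if size t == (size s).+1 then LLi 0 (a :: s) (pw t) else 0.
have rF : respects F.
  exact: (respects_size _ (respects_zm (@LLi_zm 0 (a :: s)) (pw_respects iota))).
transitivity (tl F y).
  apply: eq_lift1 => -[b t] /=; rewrite /F /= eqSS (eq_sym (size t)).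
  by case: ifP => // /eqP st; rewrite -[RHS]/(LLi 0 (a :: s) _) LLi_pw.
move: y yn; apply: tens_n_ext; first exact: tl_zm.
  by case: (size s == n); [exact: (@LLi_zm 0 (a :: s)) | move=> ? ?; rewrite subr0].
move=> b t tn; rewrite tl_pw // /F /= eqSS tn eq_sym.
by case: ifP.
Qed.

Lemma diagE x : diag x = tl (fun s => \prod_(a <- s) hv a) x.
Proof. by []. Qed.

Lemma diag_respects : respects (fun s => \prod_(a <- s) hv a).
Proof.
split=> [u v a b c _ _ cab|u v a b e r er].
  by rewrite !big_cat /= !big_cons cab mulrDl mulrDr.
by rewrite !big_cat /= !big_cons !hv_mul !mulrA.
Qed.

(** A representative of [x] may contain words of other lengths; their total contribution is zero,
    because the relations preserve length. *)
Lemma diag_level n x : tens_n n x ->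
  diag x = \sum_(w <- dom (rep x) | size w.2 == n)
             (\prod_(a <- sq w) hv a) *~ coeff w (rep x).
Proof.
move=> xn; have rF := respects_size n.+1 diag_respects.
transitivity (tl (fun s => if size s == n.+1 then \prod_(a <- s) hv a else 0) x).
  move: x xn; apply: tens_n_ext; try exact: tl_zm diag_respects.
    exact: tl_zm.
  by move=> a s sn; rewrite diagE !tl_pw //= ?sn ?eqxx //; exact: diag_respects.
rewrite /tl /tlift1 /lift1 [RHS]big_mkcond /=; apply: eq_bigr => w _.
by rewrite eqSS; case: ifP => // _; rewrite mul0rz.
Qed.

Fixpoint hprod a s : helt := if s is b :: s' then hmul a (hprod b s') else a.

Lemma hv_hprod a s : hv (hprod a s) = \prod_(b <- a :: s) hv b.
Proof.
elim: s a => [|b s IHs] a /=; first by rewrite big_seq1.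
by rewrite hv_mul IHs [RHS]big_cons.
Qed.

(** Moving the slots to slot 0 one at a time exhibits a0 @ ... @ an - (a0 ... an) @ 1 @ ... @ 1 as a
    sum of generators of the ideal. *)
Lemma LLi_hprod n q i a s x : (i + size s <= n)%N -> Kd n q x ->
  Kd n q.+1 (LLi i (a :: s) x - L 0 (hprod a s) x).
Proof.
elim: s a i => [|b s IHs] a i /= le_n xq.
  by apply: span_in; exists i, 0%N, a, x; split => //; lia.
set y := L i.+1 b _; rewrite -L0_mul.
have -> : L i a y - L 0 a (L 0 (hprod b s) x) =
    (L i a y - L 0 a y) + L 0 a (y - L 0 (hprod b s) x).
  by rewrite (L_zm 0 a) addrA subrK.
apply: (@KdD n q.+1); last first.
  by apply: Kd_L => //; apply: IHs => //; lia.
apply: span_in; exists i, 0%N, a, y; split; try lia.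
  have : Kd n q (LLi i.+1 (b :: s) x - L 0 (hprod b s) x).
    by apply: Kd_S; apply: IHs => //; lia.
  move=> /KdD - /(_ (L 0 (hprod b s) x)); rewrite subrK; apply.
  exact: Kd_L.
by [].
Qed.

Lemma diag_pow_Kd n q x : diag_pow n q x -> Kd n q x.
Proof.
elim: q x => [//|q IHq] x.
apply: span_ind => [||_ [y [z [[yn y0] /IHq zq ->]]]]; [exact: Kd0|exact: KdB|].
have zn := Kd_tens zq; rewrite (level_mulE _ zn).
have -> : lift1 (fun w => if size w.2 == n then LLi 0 (sq w) z else 0) (rep y) =
  \sum_(w <- dom (rep y) | size w.2 == n)
    (LLi 0 (sq w) z - L 0 (hprod w.1 w.2) z) *~ coeff w (rep y).
  (* As y is in the kernel of the diagonal, its slots multiplied together and placed in slot 0 act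
     by zero, so this sum may be subtracted for free. *)
  have sum0 : \sum_(w <- dom (rep y) | size w.2 == n)
      L 0 (hprod w.1 w.2) z *~ coeff w (rep y) = 0.
    apply: (@sum_by_degree A _ _ _ _ _ _ (fun a => L 0 a z)).
      by move=> a b c; exact: L0_add.
    by rewrite -[RHS]y0 (diag_level yn); apply: eq_bigr => w _; rewrite hv_hprod.
  rewrite -[RHS]addr0 -[X in _ = _ + X]sum0 -big_split /= /lift1 [RHS]big_mkcond; apply: eq_bigr => w _.
  by case: ifP => _; rewrite ?mul0rz // -mulrzDl subrK.
apply: span_sum => w /eqP wn; apply: (@Kd_mulz n q.+1).
by apply: LLi_hprod => //; rewrite wn.
Qed.

End Kfiltration.

(** * Commutator form and normalisation *)

Section Generators.
Variables (R A : cdga) (iota : cdga_hom R A).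
Local Notation helt := (helt A).
Local Notation tens := (tens iota).
Local Notation pw := (@pw _ _ iota).
Implicit Types (a b c h g : helt) (s t u v : seq helt) (x y z : tens).
Local Notation L i h := (@tl _ _ iota _ (Lw iota i h)).
Local Notation h1 := (h1 A).
Local Notation unit := (pw [:: h1]).
Local Notation delta := (pw [:: h1; h1]).

Lemma one_oneE : one_one iota = delta. Proof. by []. Qed.
Lemma tens_ofE e (a : A) : tens_of iota e a = pw [:: mkh e a]. Proof. by []. Qed.

Lemma L0_h1 x : L 0 h1 x = x.
Proof.
move: x; apply: tens_ext; [exact: L_zm|by []|].
by move=> a s; rewrite L0_pw hmul1h.
Qed.

Lemma sg_unit : sg unit = unit.
Proof. by rewrite sg_pw swd_cons swd_nil hd_h1 ksgn_even. Qed.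

Lemma cup_unitr x : cup x unit = x.
Proof.
move: x; apply: tens_ext; [exact: cup_zml|by []|].
move=> a s; elim: s a => [|b s IHs] a.
  by rewrite cup_single L0_pw hmulh1.
by rewrite -pre_pw cup_pre sg_unit IHs.
Qed.

Lemma delta_ne : tens_ne 1 0 delta.
Proof. by have := pw_tens_ne iota h1 [:: h1]; rewrite !swd_cons swd_nil !hd_h1. Qed.

Lemma pw1_ne a : tens_ne 0 (hd a) (pw [:: a]).
Proof. by have := pw_tens_ne iota a [::]; rewrite swd_cons swd_nil addr0. Qed.

Lemma cup_pw1 x n e h : tens_ne n e x ->
  cup x (pw [:: h]) = ksgn (hd h * (e + n%:Z)) (L n h x).
Proof.
move=> xn; have <- : L 0 h unit = pw [:: h] by rewrite L0_pw hmulh1.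
by rewrite (L_cupr _ _ _ xn) addn0 cup_unitr.
Qed.

(* [L 0 h c - L 1 h c] is the graded commutator of [h] and [c] for the cup product. *)
Inductive Cgen : nat -> int -> set tens :=
| Cgen0 : Cgen 0 0 delta
| CgenS (t : nat) e h (c : tens) of Cgen t e c : Cgen t.+1 (hd h + e) (L 0 h c - L 1 h c).

Lemma Cgen_ne (t : nat) e x : Cgen t e x -> tens_ne 1 e x.
Proof.
elim=> [|{}t {}e h y _ y1]; first exact: delta_ne.
by apply: spanB; exact: tens_ne_L.
Qed.

Lemma commutatorE e h x : tens_ne 1 e x ->
  L 0 h x - L 1 h x =
  cup (pw [:: h]) x - ksgn (hd h * (1 + e)) (cup x (pw [:: h])).
Proof.
move=> x1; rewrite cup_single (cup_pw1 _ x1) ksgn_add ksgn_even //.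
by sgn_parity.
Qed.

Inductive Kc : nat -> nat -> int -> set tens :=
| Kc0 a : Kc 0 0 (hd a) (pw [:: a])
| KcS n q e a (t : nat) d (c : tens) y of Cgen t d c & Kc n q e y :
    Kc n.+1 (t + q) (hd a + d + e) (cup (cup (pw [:: a]) c) y).

Lemma Kc_diff n q e h x i : Kc n q e x -> (i < n)%N ->
  exists (m : int) (z : tens), Kc n q.+1 (hd h + e) z /\
    L i h x - L i.+1 h x = ksgn m z.
Proof.
move=> xK; elim: xK i => // {}n {}q {}e a t d c y cC yK IHy i lt_in.
have c1 := Cgen_ne cC; have ac1 := cup_ne (pw1_ne a) c1.
have acn : tens_n 1 (cup (pw [:: a]) c) by exact: tens_ne_n ac1.
case: i lt_in => [|i] lt_in.
  exists (hd h * hd a), (cup (cup (pw [:: a]) (L 0 h c - L 1 h c)) y); split.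
    by have := KcS a (CgenS h cC) yK; rewrite addSn !addrA [hd a + hd h]addrC.
  rewrite !(L_cupl _ _ acn) // -(@cup_zml _ _ _ y) !cup_single.
  by rewrite (LL_comm 0) (LL_comm 1) -ksgnB -(L_zm 0 a) (zm_ksgn (@cup_zml _ _ _ y)).
have [m [z [zK Ez]]] := IHy i lt_in.
exists (hd h * (hd a + d + 1) + m), (cup (cup (pw [:: a]) c) z); split.
  have := KcS a cC zK; rewrite addnS.
  by rewrite (addrCA (hd h)).
have Lcup j : L j.+1 h (cup (cup (pw [:: a]) c) y) =
    ksgn (hd h * (hd a + d + 1)) (cup (cup (pw [:: a]) c) (L j h y)).
  by rewrite (L_cupr _ _ _ ac1) ksgnK.
rewrite !Lcup -ksgnB -(@cup_zmr _ _ _ (cup _ _)) Ez -ksgn_add.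
by rewrite (zm_ksgn (@cup_zmr _ _ _ (cup _ _))).
Qed.

Definition Kspan n q : set tens := span [set x | exists e, Kc n q e x].

(** Telescoping over adjacent slots reduces a difference with slot 0 to the previous lemma. *)
Lemma Kspan_diff0 n q i h x : (i <= n)%N -> Kspan n q x ->
  Kspan n q.+1 (L i h x - L 0 h x).
Proof.
move=> le_in; move: x; apply: span_map.
  by apply: zm_sub; exact: L_zm.
move=> x [e xK]; elim: i le_in => [|i IHi] lt_in; first by rewrite subrr; exact: span0.
have [m [z [zK Ez]]] := Kc_diff h xK lt_in.
have -> : L i.+1 h x - L 0 h x = (L i h x - L 0 h x) - (L i h x - L i.+1 h x).
  by rewrite opprB [RHS]addrC addrA subrK.
apply: spanB; first by apply: IHi; exact: ltnW.
by rewrite Ez; apply/span_ksgn/span_in; exists (hd h + e).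
Qed.

Lemma cup_delta_pw a b s : cup (cup (pw [:: a]) delta) (pw (b :: s)) =
  ksgn (swd (b :: s)) (pw (a :: b :: s)).
Proof.
rewrite cup_single L0_pw hmulh1 -(pre_pw iota a h1 [::]) cup_pre cup_single L0_h1.
by rewrite sg_pw ksgn_pre pre_pw.
Qed.

Lemma Kd_Kspan n q x : Kd n q x -> Kspan n q x.
Proof.
elim: q x => [|q IHq] x.
  apply: (tens_n_map (@zm_id tens)) => a s.
  elim: s a n => [|b s IHs] a n <-.
    by apply: span_in; exists (hd a); exact: Kc0.
  (* With no commutations, every boundary between two slots is a factor delta, so the word is peeled
     off one slot at a time. *)
  rewrite -(ksgnK (swd (b :: s)) (pw [:: a, b & s])) -cup_delta_pw; apply: span_ksgn.
  have := IHs b _ erefl; move: (pw (b :: s)).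
  apply: span_map; first exact: cup_zmr.
  move=> y [e yK]; apply: span_in; exists (hd a + 0 + e).
  by rewrite -[0%N](addn0 0); exact: KcS Cgen0 yK.
apply: span_ind => [||_ [i [j [h [y [le_in le_jn /IHq yq ->]]]]]].
- exact: span0.
- by move=> *; apply: spanB.
have -> : L i h y - L j h y = (L i h y - L 0 h y) - (L j h y - L 0 h y).
  by rewrite opprB addrA subrK.
by apply: spanB; exact: Kspan_diff0.
Qed.

(** * Normalised cochains *)

Definition dt b : tens := L 0 b delta - L 1 b delta.

Inductive NQ : nat -> int -> set tens :=
| NQ0 : NQ 0 0 unit
| NQS n e b y of NQ n e y : NQ n.+1 (hd b + e) (cup (dt b) y).

(* Spanned by the [a0 da1 ... dan]. *)
Definition NG n e : set tens := span [set x | exists a d y,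
  [/\ NQ n d y, hd a + d = e & x = cup (pw [:: a]) y]].

Lemma NQ_ne n e x : NQ n e x -> tens_ne n e x.
Proof.
elim=> [|{}n {}e b y _ yn].
  by have := pw1_ne h1; rewrite hd_h1.
apply: (@cup_ne _ _ _ 1) => //; rewrite -[hd b]addr0.
by apply: spanB; apply: tens_ne_L; exact: delta_ne.
Qed.

Lemma NG_ne n e x : NG n e x -> tens_ne n e x.
Proof.
apply: span_ind => [||_ [a [d [y [yQ <- ->]]]]].
- exact: span0.
- exact: spanB.
by apply: (@cup_ne _ _ _ 0); [exact: pw1_ne | exact: NQ_ne].
Qed.

(** Since [ins i] is a section of [codegen i], this operator projects onto the kernel of [codegen i]
    in cosimplicial degrees above i. *)
Definition En i x : tens := x - ins i (codegen i x).

Lemma En_zm i : zmod_morphism (En i).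
Proof.
by apply: zm_sub => //; exact: (zm_comp (@ins_zm _ _ _ i) (@codegen_zm _ _ _ i)).
Qed.

Lemma codegen_sg i x : codegen i (sg x) = sg (codegen i x).
Proof.
move: x; apply: tens_ext.
- exact: (zm_comp (@codegen_zm _ _ _ i) (@sg_zm _ _ _)).
- exact: (zm_comp (@sg_zm _ _ _) (@codegen_zm _ _ _ i)).
move=> a s; elim: s a i => [|b s IHs] a i.
  by rewrite sg_pw (zm_ksgn (@codegen_zm _ _ _ i))
    (codegen_id (pw_tens_n iota a [::])) // sg_pw.
rewrite -pre_pw sg_pre (zm_ksgn (@codegen_zm _ _ _ i)).
case: i => [|i]; first by rewrite !codegen0_pre sg_L.
by rewrite !codegenS_pre IHs sg_pre.
Qed.

Lemma ins_sg i x : ins i (sg x) = sg (ins i x).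
Proof.
move: x; apply: tens_ext.
- exact: (zm_comp (@ins_zm _ _ _ i) (@sg_zm _ _ _)).
- exact: (zm_comp (@sg_zm _ _ _) (@ins_zm _ _ _ i)).
move=> a s; elim: s a i => [|b s IHs] a i.
  rewrite sg_pw (zm_ksgn (@ins_zm _ _ _ i)) ins_single sg_pre sg_unit.
  by rewrite swd_cons swd_nil addr0.
rewrite -pre_pw sg_pre (zm_ksgn (@ins_zm _ _ _ i)).
case: i => [|i]; last by rewrite !insS_pre IHs sg_pre.
by rewrite !ins0_pre !sg_pre hd_h1 [ksgn 0 _]ksgn_even.
Qed.

Lemma En_sg i x : En i (sg x) = sg (En i x).
Proof. by rewrite /En codegen_sg ins_sg (@sg_zm _ _ _). Qed.

Lemma En_L0 i a x : En i (L 0 a x) = L 0 a (En i x).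
Proof. by rewrite /En codegen_L0 ins_L0 (L_zm 0 a). Qed.

Lemma EnS_pre i a x : En i.+1 (pre a x) = pre a (En i x).
Proof. by rewrite /En codegenS_pre insS_pre (@pre_zm _ _ _ a). Qed.

Lemma En_cup i x y : tens_n 1 x -> En i.+1 (cup x y) = cup x (En i y).
Proof.
move: x; apply: tens_n_ext.
- exact: (zm_comp (@En_zm _) (@cup_zml _ _ _ y)).
- exact: cup_zml.
move=> a [//|b [|//]] _.
by rewrite -pre_pw !cup_pre !cup_single EnS_pre En_L0 En_sg.
Qed.

Fixpoint PE i m x : tens := if m is m'.+1 then PE i.+1 m' (En i x) else x.

Lemma PE_zm i m : zmod_morphism (PE i m).
Proof.
elim: m i => [|m IHm] i; first exact: zm_id.
exact: (zm_comp (IHm i.+1) (@En_zm i)).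
Qed.

Lemma PE_L0 i m a x : PE i m (L 0 a x) = L 0 a (PE i m x).
Proof. by elim: m i x => [//|m IHm] i x /=; rewrite En_L0 IHm. Qed.

Lemma PE_cup i m x y : tens_n 1 x -> PE i.+1 m (cup x y) = cup x (PE i m y).
Proof. by move=> x1; elim: m i y => [//|m IHm] i y /=; rewrite En_cup // IHm. Qed.

Lemma dt_n b : tens_n 1 (dt b).
Proof.
by apply: spanB; apply: tens_n_L; apply: tens_ne_n delta_ne.
Qed.

(** The projection produces 1 @ b @ s - b @ 1 @ s, which is up to sign [b, delta] followed by 1 @ s;
    the remaining projections then act on this shorter word of the same shape. *)
Lemma En0_pw b s :
  En 0 (pw [:: h1, b & s]) = - ksgn (swd s) (cup (dt b) (pw (h1 :: s))).
Proof.
rewrite /dt (@cup_zml _ _ _ _) L0_pw hmulh1 -!(pre_pw iota h1 h1 [::]) LS_pre hd_h1.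
rewrite mulr0 [ksgn 0 _]ksgn_even // L0_pw hmulh1 -(pre_pw iota b h1 [::]) !cup_pre !cup_single.
rewrite L0_h1 sg_pw swd_cons hd_h1 add0r ksgn_L !ksgn_pre -ksgnB ksgnK L0_pw hmulh1.
rewrite opprB !pre_pw /En -pre_pw codegen0_pre L0_h1 -!pre_pw.
case: s => [|c s]; first by rewrite ins_single !pre_pw.
by rewrite -!pre_pw ins0_pre.
Qed.

Lemma PE_h1 s : exists (m : int) (y : tens), NQ (size s) (swd s) y /\
  PE 0 (size s) (pw (h1 :: s)) = ksgn m y.
Proof.
elim: s => [|b s [m [y [yQ Ey]]]].
  by exists 0, unit; rewrite swd_nil ksgn_even //; split => //; exact: NQ0.
exists (1 + swd s + m), (cup (dt b) y); rewrite swd_cons; split; first exact: NQS.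
rewrite /= En0_pw (zmN (@PE_zm _ _)) (zm_ksgn (@PE_zm _ _)).
rewrite PE_cup; last exact: dt_n.
by rewrite Ey (zm_ksgn (@cup_zmr _ _ _ _)) -!ksgn_add.
Qed.

Lemma PE_NG n e x : tens_ne n e x -> NG n e (PE 0 n x).
Proof.
move: x; apply: tens_ne_map; first exact: PE_zm.
move=> a s <- <-; have [m [y [yQ Ey]]] := PE_h1 s.
have -> : pw (a :: s) = L 0 a (pw (h1 :: s)) by rewrite L0_pw hmulh1.
rewrite PE_L0 Ey ksgn_L -cup_single; apply/span_ksgn/span_in.
by exists a, (swd s), y; rewrite swd_cons.
Qed.

(** Each factor changes [x] only by a coface of one of its codegeneracies. Taking S = 0 treats
    normalised tensors, and S = [KK p] treats the levels of the completion. *)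
Lemma PE_mod (S : set tens) n : S 0 -> (forall x y, S x -> S y -> S (x - y)) ->
  (forall i x, S x -> S (codegen i x)) -> (forall i x, S x -> S (ins i x)) ->
  forall x, (forall i, (i < n)%N -> S (codegen i x)) -> S (x - PE 0 n x).
Proof.
move=> S0 SB Sc Si x Sx; suff: forall i m, (i + m <= n)%N -> S (x - PE i m x).
  by apply; rewrite add0n.
move=> i m; elim: m i x Sx => [|m IHm] i x Sx le_n /=.
  by rewrite subrr.
have SN y : S y -> S (- y) by move=> Sy; rewrite -sub0r; exact: SB.
have SE : S (x - En i x).
  by rewrite /En opprB addrC subrK; apply/Si/Sx; lia.
(* The hypothesis survives the projection: the term subtracted from [x] is already in S, and S is
   stable under codegeneracies. *)
have SEx j : (j < n)%N -> S (codegen j (En i x)).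
  move=> lt_jn; rewrite /En (@codegen_zm _ _ _ j).
  by apply: SB; [exact: Sx | apply/Sc/Si/Sx; lia].
have le_n' : (i.+1 + m <= n)%N by lia.
have := SB _ _ SE (SN _ (IHm i.+1 (En i x) SEx le_n')).
by rewrite opprK addrA subrK.
Qed.

Lemma norm_tens_NG n e x : norm_tens n e x -> NG n e x.
Proof.
case=> xn x0; suff /eqP : x - PE 0 n x = 0.
  by rewrite subr_eq0 => /eqP ->; exact: PE_NG.
apply: (@PE_mod [set 0] n) => //.
- by move=> y z /= -> ->; rewrite subr0.
- by move=> i y /= ->; rewrite (zm0 (@codegen_zm _ _ _ i)).
- by move=> i y /= ->; rewrite (zm0 (@ins_zm _ _ _ i)).
Qed.

Lemma norm_mod_NG n e p x : tens_ne n e x ->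
  (forall i, (i < n)%N -> KK p (codegen i x)) ->
  exists2 z, NG n e z & KK p (x - z).
Proof.
move=> xn xK; exists (PE 0 n x); first exact: PE_NG.
apply: PE_mod => //; [exact: span0|exact: spanB| |].
- by move=> i y; exact: KK_codegen.
- by move=> i y; exact: KK_ins.
Qed.

End Generators.

(** * Differential operators *)

Lemma neg_or_pos (k : int) : (k < 0)%R \/ (0 <= k)%R.
Proof. by lia. Qed.

Lemma fsE (V : zmodType) (f : int -> V) (r : seq int) : uniq r ->
  (forall i, i \notin r -> f i = 0) -> \sum_(i \in [set: int]) f i = \sum_(i <- r) f i.
Proof.
move=> Ur f0; rewrite (@fsbigE _ _ _ _ _ r) //; last by move=> i _; exact: f0.
by apply: eq_bigl => i; rewrite in_setT.
Qed.

Lemma grading_disjoint (V : zmodType) (V_ : int -> set V) (j : int) (z : V) :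
  grading V_ -> V_ j z -> span [set x | exists2 i, i != j & V_ i x] z -> z = 0.
Proof.
move=> [V0 VB _ Vind] zj zspan.
have VN i x : V_ i x -> V_ i (- x).
  by move=> xi; rewrite -sub0r; exact: VB.
have [s [f [Us fV fj f0 Ez]]] : exists (s : seq int) (f : int -> V),
    [/\ uniq s, forall i, V_ i (f i), f j = 0, (forall i, i \notin s -> f i = 0)
      & z = \sum_(i <- s) f i].
  move: z zspan {zj}; apply: span_ind => [|x y|x].
  - by exists [::], (fun _ => 0); split=> //; rewrite big_nil.
  - move=> [s [f [Us fV fj f0 ->]]] [t [g [Ut gV gj g0 ->]]].
    exists (undup (s ++ t)), (fun i => f i - g i).
    have st0 i : i \notin undup (s ++ t) -> f i = 0 /\ g i = 0.
      by rewrite mem_undup mem_cat negb_or => /andP[/f0 ? /g0].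
    split; [exact: undup_uniq|by move=> i; exact: VB|by rewrite fj gj subr0| |].
      by move=> i /st0[-> ->]; rewrite subr0.
    rewrite -(fsE Us f0) -(fsE Ut g0) sumrB; congr (_ - _).
      by apply: fsE => [|i /st0[]]; rewrite ?undup_uniq.
    by apply: fsE => [|i /st0[]]; rewrite ?undup_uniq.
  move=> [i ij xi]; exists [:: i], (fun l => if l == i then x else 0).
  split=> //; first by move=> l; case: eqP => [->|_] //; exact: V0.
  - by rewrite eq_sym (negPf ij).
  - by move=> l; rewrite mem_seq1 => /negPf ->.
  by rewrite big_seq1 eqxx.
(* The slot j, left empty by f, receives - z; the resulting components of distinct degrees sum to
   zero. *)
pose g i := if i == j then - z else f i.
have gV i : V_ i (g i) by rewrite /g; case: eqP => [->|_]; [exact: VN | exact: fV].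
have Uj : uniq (j :: rem j s) by rewrite /= rem_uniq // mem_rem_uniqF.
suff /(Vind _ g Uj gV) /(_ j (mem_head _ _)) : \sum_(i <- j :: rem j s) g i = 0.
  by rewrite /g eqxx => /eqP; rewrite oppr_eq0 => /eqP.
have -> : \sum_(i <- j :: rem j s) g i = - z + \sum_(i <- rem j s) f i.
  rewrite big_cons {1}/g eqxx; congr (_ + _); apply: eq_big_seq => i.
  by rewrite mem_rem_uniq // inE => /andP[/negPf ij _]; rewrite /g ij.
rewrite {1}Ez -(fsE Us f0) (@fsE _ _ (rem j s)) ?addNr ?rem_uniq // => i.
by rewrite mem_rem_uniq // inE negb_and negbK => /orP[/eqP -> //|/f0].
Qed.

Section Operators.
Variables (R A : cdga) (iota : cdga_hom R A) (M : dgmod A).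
Local Notation Dop := (@Dop R A iota M).
Local Notation homR := (@homR R A iota M).
Local Notation homA := (@homA A M).
Implicit Types (u v w : M -> M) (k l : int) (d e f : int) (a : A).

Lemma mdeg_sub (i : int) (x y : M) : mdeg i x -> mdeg i y -> mdeg i (x - y).
Proof. by case: (mdeg_grading M) => _ + _ _; exact. Qed.

Lemma mdeg0 (i : int) : @mdeg A M i 0.
Proof. by case: (mdeg_grading M). Qed.

Lemma scale_comm e f a (b : A) (x : M) : gdeg e a -> gdeg f b ->
  a *: (b *: x) = ksgn (e * f) (b *: (a *: x)).
Proof.
move=> ea fb; rewrite !scalerA (gcr_comm ea fb) /ksgn.
by case: ifP => // _; rewrite scaleNr.
Qed.

Lemma homR_zm d u : homR d u -> zmod_morphism u.
Proof. by case=> uD _ _; exact: zm_of_add. Qed.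

Lemma homR0 d : homR d 0.
Proof.
split=> [x y|i x _|e r x _]; first by rewrite addr0.
  exact: mdeg0.
by rewrite scaler0 ksgn0.
Qed.

Lemma homRB d u v : homR d u -> homR d v -> homR d (u - v).
Proof.
move=> [uD ud uR] [vD vd vR]; split=> [x y|i x xi|e r x er]; rewrite !fctE.
- by rewrite uD vD opprD addrACA.
- by apply: mdeg_sub; [exact: ud | exact: vd].
by rewrite (uR e) // (vR e) // -ksgnB scalerBr.
Qed.

Lemma homR_comp d e u v : homR d u -> homR e v -> homR (d + e) (u \o v).
Proof.
move=> [uD ud uR] [vD vd vR]; split=> [x y|i x xi|f r x fr] /=.
- by rewrite vD uD.
- by rewrite -addrA; apply: ud; exact: vd.
rewrite (vR f) // (zm_ksgn (homR_zm (And3 uD ud uR))) (uR f) // ksgn_add.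
by apply: ksgn_eq; sgn_parity.
Qed.

Lemma homAE d u :
  homA d u <-> homR d u /\ forall e a, gdeg e a -> op_comm e d a u = 0.
Proof.
split=> [[uD ud uA]|[[uD ud uR] u0]]; last first.
  split=> // e a x ea; have /(congr1 (fun g => g x)) /eqP := u0 e a ea.
  by rewrite /op_comm subr_eq0 => /eqP ->; rewrite ksgnK.
split; first by split=> // e r x /(hom_deg iota); exact: uA.
move=> e a ea; apply/funext => x.
by rewrite /op_comm (uA e) // ksgnK subrr.
Qed.

Lemma Dop_neg k d u : (k < 0)%R -> Dop k d u -> u = 0.
Proof. by case: k. Qed.

Lemma Dop_homR k d u : Dop k d u -> homR d u.
Proof.
case: k => [[|k]|k] /=; first by case/homAE.
  by case.
by move=> ->; exact: homR0.
Qed.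

(** A-linearity and the recursion become one statement: order 0 means that all commutators have
    order -1, hence vanish. *)
Lemma DopE k d u : (0 <= k)%R -> Dop k d u <->
  homR d u /\ forall e a, gdeg e a -> Dop (k - 1) (e + d) (op_comm e d a u).
Proof.
case: k => // k _; case: k => [|k]; first by rewrite sub0r; exact: homAE.
by have -> : k.+1%:Z - 1 = k%:Z by lia.
Qed.

Lemma Dop_zm k d u : Dop k d u -> zmod_morphism u.
Proof. by move/Dop_homR/homR_zm. Qed.

(** Induction on the order, started at the negative orders where the filtration is zero. *)
Lemma int_lower_ind (P : int -> Prop) :
  (forall k, (k < 0)%R -> P k) -> (forall k, (0 <= k)%R -> P (k - 1) -> P k) ->
  forall k, P k.
Proof.
move=> Pneg Pstep [k|k]; last exact: Pneg.
by elim: k => [|k IHk]; apply: Pstep => //; [exact: Pneg | rewrite intS addrC addKr].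
Qed.

Lemma op_commB e d a u v : op_comm e d a (u - v) = op_comm e d a u - op_comm e d a v.
Proof.
apply/funext => x; rewrite /op_comm !fctE scalerBr ksgnB !opprD !opprK.
by rewrite addrACA.
Qed.

Lemma op_comm0 e d a : op_comm e d a (0 : M -> M) = 0.
Proof. by apply/funext => x; rewrite /op_comm scaler0 ksgn0 subr0. Qed.

Lemma Dop0 k d : Dop k d 0.
Proof.
elim/int_lower_ind: k d => [[//|k] _ d //|k k0 IHk d]; apply/DopE => //.
by split=> [|e a _]; [exact: homR0 | rewrite op_comm0].
Qed.

Lemma DopB k d u v : Dop k d u -> Dop k d v -> Dop k d (u - v).
Proof.
elim/int_lower_ind: k d u v => [k k0|k k0 IHk] d u v.
  by move=> /(Dop_neg k0) -> /(Dop_neg k0) ->; rewrite subr0; exact: Dop0.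
move=> /(DopE _ _ k0) [uR uk] /(DopE _ _ k0) [vR vk]; apply/DopE => //.
split=> [|e a ea]; first exact: homRB.
by rewrite op_commB; apply: IHk; [exact: uk | exact: vk].
Qed.

Lemma DopN k d u : Dop k d u -> Dop k d (- u).
Proof. by move=> uk; rewrite -sub0r; apply: DopB => //; exact: Dop0. Qed.

Lemma DopD k d u v : Dop k d u -> Dop k d v -> Dop k d (u + v).
Proof. by move=> uk vk; rewrite -[v]opprK; apply: DopB => //; exact: DopN. Qed.

Lemma Dop_ksgn k d n u : Dop k d u -> Dop k d (ksgn n u).
Proof. by rewrite /ksgn; case: ifP => // _; exact: DopN. Qed.

Lemma Dop_sum k d I (r : seq I) (P : pred I) (F : I -> M -> M) :
  (forall i, P i -> Dop k d (F i)) -> Dop k d (\sum_(i <- r | P i) F i).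
Proof.
by move=> FP; apply: (big_ind (fun u => Dop k d u)) => //; [exact: Dop0 | exact: DopD].
Qed.

Lemma Dop_pred k d u : Dop (k - 1) d u -> Dop k d u.
Proof.
elim/int_lower_ind: k d u => [k k0|k k0 IHk] d u uk.
  by rewrite (@Dop_neg (k - 1) d u) //; [exact: Dop0 | lia].
have uR := Dop_homR uk; apply/DopE => //; split=> // e a ea.
case: (neg_or_pos (k - 1)) => k1.
  by rewrite (Dop_neg k1 uk) op_comm0; exact: Dop0.
by apply: IHk; have /(DopE _ _ k1) [_] := uk; apply.
Qed.

Lemma Dop_mono k l d u : (k <= l)%R -> Dop k d u -> Dop l d u.
Proof.
move=> kl; have -> : l = k + `|l - k|%N%:Z by lia.
elim: `|l - k|%N => [|n IHn] uk; first by rewrite addr0.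
apply: Dop_pred; have -> : k + n.+1%:Z - 1 = k + n%:Z by lia.
exact: IHn.
Qed.

Lemma Dop_comm k d e a u : gdeg e a -> Dop k d u ->
  Dop (k - 1) (e + d) (op_comm e d a u).
Proof.
move=> ea uk; case: (neg_or_pos k) => k0; last by have /(DopE _ _ k0) [_] := uk; apply.
by rewrite (Dop_neg k0 uk) op_comm0; exact: Dop0.
Qed.

Lemma op_comm_comp e d f a u v : zmod_morphism u ->
  op_comm e (d + f) a (u \o v) =
  (op_comm e d a u \o v) + ksgn (e * d) (u \o op_comm e f a v).
Proof.
move=> uB; apply/funext => x; rewrite !fctE ksgn_fct /op_comm /= uB.
rewrite ksgnB addrA subrK (zm_ksgn uB) ksgn_add; congr (_ - _).
by apply: ksgn_eq; sgn_parity.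
Qed.

(** Commutation with [a] is a graded derivation for composition, so it lowers the order of one
    factor at a time; the induction is on k + l. *)
Lemma Dop_comp k l d e u v : Dop k d u -> Dop l e v -> Dop (k + l) (d + e) (u \o v).
Proof.
have [n] := ubnP (absz (k + l)); elim: n => // n IHn in k l d e u v *.
move=> le_n uk vl.
(* Negative orders are removed before each use of the induction, because the measure is an absolute
   value and decreases only while both orders stay nonnegative. *)
case: (neg_or_pos k) => k0.
  by rewrite (Dop_neg k0 uk); exact: Dop0.
have uB := Dop_zm uk.
case: (neg_or_pos l) => l0.
  rewrite (Dop_neg l0 vl) (_ : _ \o _ = 0); first exact: Dop0.
  by apply/funext => x; rewrite /= zm0.
apply/DopE; first lia.
split=> [|f a fa]; first exact: homR_comp (Dop_homR uk) (Dop_homR vl).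
rewrite op_comm_comp //; apply: DopD.
  case: (neg_or_pos (k - 1)) => k1.
    by rewrite (Dop_neg k1 (Dop_comm fa uk)); exact: Dop0.
  rewrite addrA (_ : k + l - 1 = (k - 1) + l); last by lia.
  by apply: IHn => //; [lia | exact: Dop_comm].
apply: Dop_ksgn; rewrite (addrCA f d).
case: (neg_or_pos (l - 1)) => l1.
  rewrite (Dop_neg l1 (Dop_comm fa vl)) (_ : _ \o _ = 0); first exact: Dop0.
  by apply/funext => x; rewrite /= zm0.
by rewrite -(addrA k); apply: IHn => //; [lia | exact: Dop_comm].
Qed.

Lemma Dop_scal e a : gdeg e a -> Dop 0 e (fun x => a *: x).
Proof.
move=> ea; split=> [x y|i x xi|f b x fb]; first exact: scalerDr.
  exact: mdegZ.
by rewrite (scale_comm _ ea fb) mulrC.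
Qed.

(** After subtraction of the summands of degree d, what is left has degree d and is a sum of
    operators of other degrees. On a homogeneous element of M its value is then zero, by directness
    of the grading. *)
Lemma Dop_homogeneous k d u : homR d u ->
  span [set v | exists e, Dop k e v] u -> Dop k d u.
Proof.
move=> uR uspan.
(* The operator g collects the summands of degree d. *)
have [g gk gspan] : exists2 g, Dop k d g &
    span [set v | exists2 e, e != d & Dop k e v] (u - g).
  move: u uspan {uR}; apply: span_ind => [|u v|u].
  - by exists 0; [exact: Dop0 | rewrite subr0; exact: span0].
  - move=> [g gk gs] [h hk hs]; exists (g - h); first exact: DopB.
    have -> : u - v - (g - h) = (u - g) - (v - h).
      by rewrite !opprD !opprK addrACA.
    exact: spanB.
  move=> [e ue]; have [ed|ed] := eqVneq e d.
    by exists u; rewrite ?subrr -?ed //; exact: span0.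
  by exists 0; [exact: Dop0 | rewrite subr0; apply: span_in; exists e].
suff /eqP : u - g = 0 by rewrite subr_eq0 => /eqP ->.
have wR : homR d (u - g) by apply: homRB => //; exact: Dop_homR gk.
set w := u - g in gspan wR *; apply/funext => x.
have [_ _ Mgen _] := mdeg_grading M.
have [s [f [fi ->]]] := Mgen x; have wB := homR_zm wR.
rewrite (zm_sum wB) big1 // => i _.
apply: (@grading_disjoint _ (@mdeg A M) (d + i)); first exact: mdeg_grading.
  by case: wR => _ + _; apply.
apply: (span_map (f := fun v : M -> M => v (f i))) gspan => // v [e ed vk].
apply: span_in; exists (e + i); first by rewrite (inj_eq (addIr i)).
by have [_ + _] := Dop_homR vk; apply.
Qed.

End Operators.

(** * Laurent series of operators *)

Section Series.
Variables (R A : cdga) (iota : cdga_hom R A) (M : dgmod A).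
Local Notation ser := (ser M).
Local Notation Dop := (@Dop R A iota M).
Implicit Types (u v w : ser) (m n i j d e p : int) (N K : nat) (a : A).

Definition lowb N u : Prop := forall m, (m + N%:Z < 0)%R -> u m = 0.
(** On these series the product is a finite sum, bilinear and associative. [ser_mul] is defined on
    all families, but its sum is meaningful only for finite support. *)
Definition good u : Prop := (forall m, zmod_morphism (u m)) /\ exists N, lowb N u.

Lemma lowb_mono N N' u : (N <= N')%N -> lowb N u -> lowb N' u.
Proof. by move=> NN uN m mN; apply: uN; lia. Qed.

Lemma ser_mulE u v n x (r : seq int) : uniq r ->
  (forall i, i \notin r -> u i (v (n - i) x) = 0) ->
  ser_mul u v n x = \sum_(i <- r) u i (v (n - i) x).
Proof. by move=> Ur r0; exact: fsE. Qed.

Definition win N K : seq int := [seq i%:Z - N%:Z | i : nat <- seq.iota 0 K].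

Lemma win_uniq N K : uniq (win N K).
Proof. by rewrite map_inj_uniq ?iota_uniq // => i j /addIr []. Qed.

Lemma mem_win N K i : (i \in win N K) = (0 <= i + N%:Z < K%:Z)%R.
Proof.
apply/mapP/idP => [[j]|/andP[i0 iK]].
  by rewrite mem_iota add0n => /andP[_ jK] ->; rewrite subrK; lia.
by exists (absz (i + N%:Z)); [rewrite mem_iota; lia | lia].
Qed.

Lemma ser_mul_win N N' K u v n x : lowb N u -> lowb N' v ->
  (forall m, zmod_morphism (u m)) -> (n + N%:Z + N'%:Z < K%:Z)%R ->
  ser_mul u v n x = \sum_(i <- win N K) u i (v (n - i) x).
Proof.
move=> uN vN uB nK; apply: ser_mulE; first exact: win_uniq.
move=> i; rewrite mem_win => iw; case: (neg_or_pos (i + N%:Z)) => iN.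
  by rewrite uN.
by rewrite vN; [exact: zm0 | lia].
Qed.

(** A crude window length: it exceeds n + N + N', which is all that [ser_mul_win] asks. *)
Definition bigK (n : int) N N' : nat := (absz n + N + N').+1.

Lemma subE u v m : (u - v) m = u m - v m. Proof. by []. Qed.
Lemma addE u v m : (u + v) m = u m + v m. Proof. by []. Qed.

Lemma good_sub u v : good u -> good v -> good (u - v).
Proof.
move=> [uB [N uN]] [vB [N' vN]]; split=> [m|]; first exact: zm_sub (uB m) (vB m).
by exists (N + N')%N => m mN; rewrite subE uN ?vN ?subr0 //; lia.
Qed.

Lemma good0 : good 0.
Proof. by split=> [m x y|]; [rewrite subr0 | exists 0%N]. Qed.

Lemma good_ksgn n u : good u -> good (ksgn n u).
Proof.
rewrite /ksgn; case: ifP => // _ ug; rewrite -sub0r; exact: good_sub good0 ug.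
Qed.

Lemma good_mul u v : good u -> good v -> good (ser_mul u v).
Proof.
move=> [uB [N uN]] [vB [N' vN]]; split=> [m x y|].
  rewrite !(ser_mul_win (K := bigK m N N') _ uN vN) //; try by rewrite /bigK; lia.
  by rewrite -sumrB; apply: eq_bigr => i _; rewrite vB uB.
exists (N + N')%N => m mN; apply/funext => x.
rewrite (ser_mulE (r := [::])) ?big_nil // => i _.
case: (neg_or_pos (i + N%:Z)) => iN; first by rewrite uN.
by rewrite vN; [exact: zm0 | lia].
Qed.

Lemma ser_mul_zml v : good v -> forall u u', good u -> good u' ->
  ser_mul (u - u') v = ser_mul u v - ser_mul u' v.
Proof.
move=> [vB [N' vN]] u u' [uB [N1 uN]] [u'B [N2 u'N]].
have {}uN := lowb_mono (leq_addr N2 N1) uN.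
have {}u'N := lowb_mono (leq_addl N1 N2) u'N.
have duB m : zmod_morphism ((u - u') m) by exact: zm_sub (uB m) (u'B m).
have duN : lowb (N1 + N2) (u - u') by move=> m mN; rewrite subE uN ?u'N ?subr0.
apply/funext => n; apply/funext => x.
have nK : (n + (N1 + N2)%N%:Z + N'%:Z < (bigK n (N1 + N2) N')%:Z)%R.
  by rewrite /bigK; lia.
rewrite !fctE (ser_mul_win _ uN vN uB nK) (ser_mul_win _ u'N vN u'B nK).
rewrite (ser_mul_win _ duN vN duB nK) -sumrB; exact: eq_bigr.
Qed.

Lemma ser_mul_zmr u : good u -> forall v v', good v -> good v' ->
  ser_mul u (v - v') = ser_mul u v - ser_mul u v'.
Proof.
move=> [uB [N' uN]] v v' [vB [N1 vN]] [v'B [N2 v'N]].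
have {}vN := lowb_mono (leq_addr N2 N1) vN.
have {}v'N := lowb_mono (leq_addl N1 N2) v'N.
have dvN : lowb (N1 + N2) (v - v') by move=> m mN; rewrite subE vN ?v'N ?subr0.
apply/funext => n; apply/funext => x.
have nK : (n + N'%:Z + (N1 + N2)%N%:Z < (bigK n N' (N1 + N2))%:Z)%R.
  by rewrite /bigK; lia.
rewrite !fctE (ser_mul_win _ uN vN uB nK) (ser_mul_win _ uN v'N uB nK).
rewrite (ser_mul_win _ uN dvN uB nK) -sumrB; apply: eq_bigr => i _.
exact: uB.
Qed.

Lemma ser_mul0l v : good v -> ser_mul 0 v = 0.
Proof. by move=> vg; rewrite -(subr0 0) ser_mul_zml ?subrr //; exact: good0. Qed.

Lemma ser_mul0r u : good u -> ser_mul u 0 = 0.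
Proof. by move=> ug; rewrite -(subr0 0) ser_mul_zmr ?subrr //; exact: good0. Qed.

Lemma ser_mul_Nl u v : good u -> good v -> ser_mul (- u) v = - ser_mul u v.
Proof.
by move=> ug vg; rewrite -sub0r ser_mul_zml ?ser_mul0l ?sub0r //; exact: good0.
Qed.

Lemma ser_mul_Nr u v : good u -> good v -> ser_mul u (- v) = - ser_mul u v.
Proof.
by move=> ug vg; rewrite -sub0r ser_mul_zmr ?ser_mul0r ?sub0r //; exact: good0.
Qed.

Lemma goodN u : good u -> good (- u).
Proof. by move=> ug; rewrite -sub0r; exact: good_sub good0 ug. Qed.

Lemma goodD u v : good u -> good v -> good (u + v).
Proof. by move=> ug vg; rewrite -[v]opprK; apply: good_sub => //; exact: goodN. Qed.

Lemma ser_mulDl u u' v : good u -> good u' -> good v ->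
  ser_mul (u + u') v = ser_mul u v + ser_mul u' v.
Proof.
move=> ug u'g vg; rewrite -{1}[u']opprK ser_mul_zml ?ser_mul_Nl ?opprK //.
exact: goodN.
Qed.

Lemma ser_mulDr u v v' : good u -> good v -> good v' ->
  ser_mul u (v + v') = ser_mul u v + ser_mul u v'.
Proof.
move=> ug vg v'g; rewrite -{1}[v']opprK ser_mul_zmr ?ser_mul_Nr ?opprK //.
exact: goodN.
Qed.

Lemma ser_mul_sgnl n u v : good u -> good v ->
  ser_mul (ksgn n u) v = ksgn n (ser_mul u v).
Proof. by move=> ug vg; rewrite /ksgn; case: ifP => // _; exact: ser_mul_Nl. Qed.

Lemma ser_mul_sgnr n u v : good u -> good v ->
  ser_mul u (ksgn n v) = ksgn n (ser_mul u v).
Proof. by move=> ug vg; rewrite /ksgn; case: ifP => // _; exact: ser_mul_Nr. Qed.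

Lemma good_sum I (r : seq I) (P : pred I) (F : I -> ser) :
  (forall t, P t -> good (F t)) -> good (\sum_(t <- r | P t) F t).
Proof. by move=> FP; apply: (big_ind good) => //; [exact: good0 | exact: goodD]. Qed.

Lemma ser_mul_suml I (r : seq I) (F : I -> ser) v : (forall t, good (F t)) ->
  good v -> ser_mul (\sum_(t <- r) F t) v = \sum_(t <- r) ser_mul (F t) v.
Proof.
move=> Fg vg; elim: r => [|i r IHr]; first by rewrite !big_nil ser_mul0l.
by rewrite !big_cons ser_mulDl ?IHr //; exact: good_sum.
Qed.

Lemma ser_mul_sumr I (r : seq I) u (F : I -> ser) : (forall t, good (F t)) ->
  good u -> ser_mul u (\sum_(t <- r) F t) = \sum_(t <- r) ser_mul u (F t).
Proof.
move=> Fg ug; elim: r => [|i r IHr]; first by rewrite !big_nil ser_mul0r.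
by rewrite !big_cons ser_mulDr ?IHr //; exact: good_sum.
Qed.

Lemma fs_shift (V : zmodType) (f : int -> V) (j : int) :
  \sum_(i \in [set: int]) f i = \sum_(i \in [set: int]) f (i + j).
Proof. by apply: reindex_fsbigT; exists (fun i => i - j) => i; rewrite ?addrK ?subrK. Qed.

Lemma ser_mulA u v w : good u -> good v -> good w ->
  ser_mul u (ser_mul v w) = ser_mul (ser_mul u v) w.
Proof.
move=> ug vg wg; have [uvB _] := good_mul ug vg.
have [uB [Nu uN]] := ug; have [vB [Nv vN]] := vg; have [wB [Nw wN]] := wg.
have mul_lowb N N' f g : lowb N f -> lowb N' g -> (forall m, zmod_morphism (f m)) ->
    lowb (N + N') (ser_mul f g).
  move=> fN gN fB m mN; apply/funext => x.
  rewrite (ser_mulE (r := [::])) ?big_nil // => i _.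
  case: (neg_or_pos (i + N%:Z)) => iN; first by rewrite fN.
  by rewrite gN; [exact: zm0 | lia].
have uvN := mul_lowb _ _ _ _ uN vN uB; have vwN := mul_lowb _ _ _ _ vN wN vB.
apply/funext => n; apply/funext => x.
(* One length large enough for both bracketings and for the inner sums. *)
pose K := (bigK n (Nu + Nv) Nw + Nu + Nv + Nw)%N.
rewrite (@ser_mul_win Nu (Nv + Nw) K) //; last by rewrite /K /bigK; lia.
rewrite (@ser_mul_win (Nu + Nv) Nw K) //; last by rewrite /K /bigK; lia.
have E1 i : i \in win (Nu + Nv) K -> ser_mul u v i (w (n - i) x) =
    \sum_(j <- win Nu K) u j (v (i - j) (w (n - i) x)).
  rewrite mem_win => iK; apply: ser_mulE; first exact: win_uniq.
  move=> j; rewrite mem_win => jw; case: (neg_or_pos (j + Nu%:Z)) => jN.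
    by rewrite uN.
  by rewrite vN; [exact: zm0 | lia].
rewrite [RHS](eq_big_seq _ E1) exchange_big /=; apply: eq_big_seq => j jw.
rewrite -(@fsE _ (fun i => u j (v (i - j) (w (n - i) x)))); first last.
- move=> i; rewrite mem_win => iw.
  case: (neg_or_pos (i - j + Nv%:Z)) => iN; first by rewrite vN //; exact: zm0.
  rewrite wN ?(zm0 (vB _)) ?(zm0 (uB _)) //.
  by move: iw jw; rewrite mem_win /K /bigK; lia.
- exact: win_uniq.
(* Shifting i by j turns the inner sum into the coefficient of v w at n - j. *)
rewrite (fs_shift _ j) /ser_mul.
have vw_win : ser_mul v w (n - j) x =
    \sum_(i <- win Nv (bigK (n - j) Nv Nw)) v i (w (n - j - i) x).
  by apply: ser_mul_win vN wN vB _; rewrite /bigK; lia.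
rewrite -/(ser_mul v w (n - j) x) vw_win (zm_sum (uB j)).
rewrite (@fsE _ _ (win Nv (bigK (n - j) Nv Nw))) ?win_uniq //.
  by apply: eq_bigr => i _; rewrite addrK opprD [- i - j]addrC addrA.
move=> i; rewrite mem_win addrK => iw.
case: (neg_or_pos (i + Nv%:Z)) => iN; first by rewrite vN //; exact: zm0.
rewrite wN ?(zm0 (vB _)) ?(zm0 (uB _)) //.
by move: iw; rewrite /bigK; lia.
Qed.

Lemma good_const a : good (ser_const a).
Proof.
split=> [m x y|].
  by rewrite /ser_const; case: eqP => _; rewrite ?subr0 // scalerBr.
by exists 0%N => m m0; apply/funext => x; rewrite /ser_const; case: eqP m0 => // ->.
Qed.

Lemma ser_mul_constl a u n x : ser_mul (ser_const a) u n x = a *: u n x.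
Proof.
rewrite (ser_mulE (r := [:: 0])) // ?big_seq1 /ser_const ?subr0 // => i.
by rewrite mem_seq1 => /negPf ->.
Qed.

Lemma ser_mul_constr u a n x : good u -> ser_mul u (ser_const a) n x = u n (a *: x).
Proof.
case=> uB _; rewrite (ser_mulE (r := [:: n])) // ?big_seq1 /ser_const ?subrr // => i.
rewrite mem_seq1 => ni; rewrite ifF; first exact: zm0.
by rewrite subr_eq0 eq_sym; exact: negPf.
Qed.

Lemma ser_const_mul a (b : A) :
  ser_mul (ser_const a) (ser_const b) = ser_const (a * b) :> ser.
Proof.
apply/funext => n; apply/funext => x; rewrite ser_mul_constl /ser_const.
by case: eqP => _; rewrite ?scaler0 // scalerA.
Qed.

Lemma ser_const1l u : ser_mul (ser_const 1) u = u.
Proof. by apply/funext => n; apply/funext => x; rewrite ser_mul_constl scale1r. Qed.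

Lemma hshift_mul i j u v :
  ser_mul (hshift i u) (hshift j v) = hshift (i + j) (ser_mul u v).
Proof.
apply/funext => n; apply/funext => x; rewrite /ser_mul /hshift (fs_shift _ i).
apply: eq_fsbigr => l _; rewrite addrK; congr (u l (v _ x)).
by rewrite !opprD addrA addrC; lia.
Qed.

(** All filtrations used here are order bounds of this shape: m + s for [Pol s], m - k + s for G^k,
    and the conjunction of m + s and 2 m + 2 s - p for (G * F~)^p. *)
Definition FS (G : int -> int) (d : int) : set ser :=
  [set u | forall m, Dop (G m) d (u m)].

Lemma FS_good G d N u : (forall m, (m + N%:Z < 0)%R -> (G m < 0)%R) ->
  FS G d u -> good u.
Proof.
move=> GN uG; split=> [m|]; first exact: Dop_zm (uG m).
by exists N => m /GN Gm; exact: Dop_neg Gm (uG m).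
Qed.

Lemma FS_sub G d u v : FS G d u -> FS G d v -> FS G d (u - v).
Proof. by move=> uG vG m; rewrite subE; exact: DopB. Qed.

Lemma FS0 G d : FS G d 0. Proof. by move=> m; exact: Dop0. Qed.

Lemma FSN G d u : FS G d u -> FS G d (- u).
Proof. by move=> uG; rewrite -sub0r; exact: FS_sub (FS0 _ _) uG. Qed.

Lemma FSD G d u v : FS G d u -> FS G d v -> FS G d (u + v).
Proof. by move=> uG vG m; exact: DopD. Qed.

Lemma FS_ksgn G d n u : FS G d u -> FS G d (ksgn n u).
Proof. by rewrite /ksgn; case: ifP => // _; exact: FSN. Qed.

Lemma FS_mono G H d u : (forall m, (G m <= H m)%R) -> FS G d u -> FS H d u.
Proof. by move=> GH uG m; exact: Dop_mono (GH m) (uG m). Qed.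

Lemma FS_mul G1 G2 H d e u v : good u -> good v ->
  (forall i j, (G1 i + G2 j <= H (i + j))%R) ->
  FS G1 d u -> FS G2 e v -> FS H (d + e) (ser_mul u v).
Proof.
move=> [uB [N uN]] [_ [N' vN]] GH uG vG n.
rewrite (_ : ser_mul u v n = \sum_(i <- win N (bigK n N N')) (u i \o v (n - i))).
  apply: Dop_sum => i _; apply: (@Dop_mono _ _ _ _ (G1 i + G2 (n - i))).
    by apply: (Order.POrderTheory.le_trans (GH _ _)); rewrite addrC subrK.
  exact: Dop_comp.
apply/funext => x; rewrite fct_sumE; apply: ser_mul_win uN vN uB _.
by rewrite /bigK; lia.
Qed.

Lemma FS_const G e a : (0 <= G 0)%R -> gdeg e a -> FS G e (ser_const a).
Proof.
move=> G0 ea m; rewrite /ser_const; case: eqP => [->|_]; last exact: Dop0.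
exact: Dop_mono G0 (Dop_scal _ _ ea).
Qed.

Definition ser_comm (e d : int) a u : ser := fun m => op_comm e d a (u m).

Lemma ser_commE e d a u : good u -> ser_comm e d a u =
  ser_mul (ser_const a) u - ksgn (e * d) (ser_mul u (ser_const a)).
Proof.
move=> ug; apply/funext => m; apply/funext => x.
by rewrite !fctE !ksgn_fct ser_mul_constl ser_mul_constr.
Qed.

Lemma FS_comm G e d a u : gdeg e a -> FS G d u ->
  FS (fun m => G m - 1) (e + d) (ser_comm e d a u).
Proof. by move=> ea uG m; exact: Dop_comm. Qed.

Lemma FS_homogeneous G d u : (forall m, homR iota d (u m)) ->
  span [set v | exists e, FS G e v] u -> FS G d u.
Proof.
move=> uR us m; apply: Dop_homogeneous => //.
apply: (span_map (f := fun v : ser => v m)) us => // v [e vG].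
by apply: span_in; exists e.
Qed.

(** * Filtrations and truncation by powers of hbar *)

Lemma Pol_good s d u : Pol iota s d u -> good u.
Proof. by move=> uP; apply: (@FS_good (fun m => m + s) d (absz s) u _ uP) => m; lia. Qed.

Lemma GfilE s (i : nat) d u : Gfil iota s i d u <-> FS (fun m => m - i%:Z + s) d u.
Proof.
split=> [[v vP <-] m|uG]; first exact: vP.
exists (fun m => u (m + i%:Z)); last by apply/funext => m; rewrite /hshift subrK.
by move=> m; have := uG (m + i%:Z); rewrite addrK.
Qed.

(** A nonzero coefficient of an element of G^i and F~^j has m + s >= j, so its order is at most m -
    i + s <= 2 m + 2 s - (i + j). *)
Lemma GFfil_FS s p d u : GFfil iota s p d u ->
  FS (fun m => m + s) d u /\ FS (fun m => 2 * m + 2 * s - p) d u.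
Proof.
apply: (@span_ind _ (fun u => FS (fun m => m + s) d u /\
  FS (fun m => 2 * m + 2 * s - p) d u))
  => [|{}u v [u1 u2] [v1 v2]|{}u [i [j [ijp /GfilE uG [uP uF]]]]].
- by split; exact: FS0.
- by split; exact: FS_sub.
split=> // m; case: (neg_or_pos (m + s - j)) => mj.
  by rewrite uF; [exact: Dop0 | lia].
by apply: Dop_mono (uG m); lia.
Qed.

Lemma GFfil_of_FS p d u : FS id d u -> FS (fun m => 2 * m - p) d u ->
  GFfil iota 0 p d u.
Proof.
move=> u1 u2; case: (neg_or_pos p) => p0.
  apply: span_in; exists 0%N, p; split; first by rewrite add0r.
    by apply/GfilE => m; have := u1 m; rewrite subr0 addr0.
  split=> [m|m]; first by have := u1 m; rewrite addr0.
  by rewrite addr0 => mp; apply: Dop_neg (u1 m); lia.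
(* At exponent m = p - i the bound 2 m - p equals m - i, so that single coefficient lies in G^i and
   F~^(p - i); the exponents m >= p together form an element of F~^p. *)
pose cut (i : nat) : ser := fun m => if m == p - i%:Z then u m else 0.
pose top : ser := fun m => if (p <= m)%R then u m else 0.
have -> : u = top + \sum_(0 <= i < absz p) cut i.+1.
  apply/funext => m; rewrite addE fct_sumE /top.
  case: (neg_or_pos (m - p)) => mp.
    rewrite ifF; last by lia.
    rewrite add0r; case: (neg_or_pos m) => m0.
      rewrite (Dop_neg m0 (u1 m)) big1 // => i _; rewrite /cut; case: ifP => // _.
      exact: Dop_neg (u1 m).
    have lt_p : (absz (p - m - 1)%R < absz p)%N by lia.
    rewrite big_mkord (bigD1 (Ordinal lt_p)) //= {1}/cut ifT; last by lia.
    by rewrite big1 ?addr0 // => i ni; rewrite /cut ifF //; move: ni; rewrite -val_eqE /=; lia.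
  rewrite ifT; last by lia.
  rewrite big1_seq ?addr0 // => i; rewrite mem_index_iota => ip.
  by rewrite /cut ifF //; lia.
apply: spanD.
  apply: span_in; exists 0%N, p; split; first by rewrite add0r.
    apply/GfilE => m; rewrite /top subr0 addr0; case: ifP => _; [exact: u1|exact: Dop0].
  split=> m; rewrite /top addr0; first by case: ifP => _; [exact: u1|exact: Dop0].
  by move=> mp; rewrite ifF //; lia.
rewrite big_seq; apply: span_sum => i; rewrite mem_index_iota => ip.
apply: span_in; exists i.+1, (p - i.+1%:Z); split; first by lia.
  apply/GfilE => m; rewrite /cut; case: eqP => [mE|_]; last exact: Dop0.
  by have := u2 m; rewrite addr0 (_ : 2 * m - p = m - i.+1%:Z) //; lia.
split=> m; rewrite /cut addr0; first by case: ifP => _; [exact: u1|exact: Dop0].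
by move=> mp; rewrite ifF //; lia.
Qed.

Lemma Polk_cls_eq s k u v : Polk_cls iota s k u = Polk_cls iota s k v <->
  span [set w | exists d, Gfil iota s k d w] (u - v).
Proof. exact: cls_eqP. Qed.

(** Equality of classes gives the bound on a sum of elements of G^k of various degrees; homogeneity
    of u - v puts it in the right degree. *)
Lemma Polk_lift s k d u v : Pol iota s d u -> Pol iota s d v ->
  Polk_cls iota s k u = Polk_cls iota s k v -> FS (fun m => m - k%:Z + s) d (u - v).
Proof.
move=> uP vP /Polk_cls_eq uv; apply: FS_homogeneous.
  by move=> m; rewrite subE; apply: Dop_homR; apply: DopB; [exact: uP|exact: vP].
apply: (span_map (@zm_id ser)) uv => w [e /GfilE wG].
by apply: span_in; exists e.
Qed.

Lemma Polk_eq k d u v : FS (fun m => m - k%:Z) d (u - v) ->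
  Polk_cls iota 0 k u = Polk_cls iota 0 k v.
Proof.
move=> uv; apply/Polk_cls_eq/span_in; exists d; apply/GfilE => m.
by have := uv m; rewrite addr0.
Qed.

Lemma Gspan_good k u : span [set w | exists d, Gfil iota 0 k d w] u -> good u.
Proof.
apply: span_ind; [exact: good0 | exact: good_sub |].
move=> v [d /GfilE vG].
by apply: (@FS_good (fun m => m - k%:Z + 0) d 0 v _ vG) => m; lia.
Qed.

(** The representatives chosen by [rep] need not be homogeneous, but they differ from u and v by
    sums of elements of G^k, and G^k absorbs products on both sides. *)
Lemma Tk_mulE k d e u v : Pol iota 0 d u -> Pol iota 0 e v ->
  Tk_mul (Polk_cls iota 0 k u) (Polk_cls iota 0 k v) = Polk_cls iota 0 k (ser_mul u v).
Proof.
move=> uP vP; pose G := [set w : ser | exists d, Gfil iota 0 k d w].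
have ug := Pol_good uP; have vg := Pol_good vP.
set x := Polk_cls _ _ _ u; set y := Polk_cls _ _ _ v.
have xu : span G (rep x - u) by exact: rep_cls.
have yv : span G (rep y - v) by exact: rep_cls.
apply/Polk_cls_eq; rewrite -/G.
set u' := rep x in xu *; set v' := rep y in yv *.
have dug := Gspan_good xu; have dvg := Gspan_good yv.
have u'g : good u' by rewrite -[u'](subrK u); exact: goodD.
(* Only u and v are known to be homogeneous, so the difference is expanded around them, leaving a
   term with two errors. *)
have -> : ser_mul u' v' - ser_mul u v =
    ser_mul u (v' - v) + ser_mul (u' - u) v + ser_mul (u' - u) (v' - v).
  have E du dv : good du -> good dv -> ser_mul (du + u) (dv + v) =
      ser_mul u dv + ser_mul du v + ser_mul du dv + ser_mul u v.
    move=> dug' dvg'; rewrite ser_mulDl ?ser_mulDr //; last exact: goodD.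
    rewrite addrA; congr (_ + _).
    by rewrite addrC [ser_mul du dv + _]addrC addrA.
  by rewrite -[u' in LHS](subrK u) -[v' in LHS](subrK v) E // addrK.
have GP w : G w -> exists2 d, FS (fun m => m - k%:Z) d w & good w.
  move=> [f wG]; exists f; last by apply: (@Gspan_good k); apply: span_in; exists f.
  by move/GfilE: wG => wG m; have := wG m; rewrite addr0.
have Gmul_r w z f : Pol iota 0 f z -> span G w -> span G (ser_mul w z).
  move=> zP; have zg := Pol_good zP.
  suff ws : span G w -> good w /\ span G (ser_mul w z) by case/ws.
  apply: (@span_ind _ (fun w => good w /\ span G (ser_mul w z))) => [|w1 w2 [g1 s1] [g2 s2]|w1 /GP [f1 w1G g1]].
  - by split; [exact: good0 | rewrite ser_mul0l //; exact: span0].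
  - by split; [exact: good_sub | rewrite ser_mul_zml //; exact: spanB].
  split=> //; apply: span_in; exists (f1 + f); apply/GfilE.
  by apply: FS_mul w1G zP => // i j; lia.
have Gmul_l w z f : Pol iota 0 f z -> span G w -> span G (ser_mul z w).
  move=> zP; have zg := Pol_good zP.
  suff ws : span G w -> good w /\ span G (ser_mul z w) by case/ws.
  apply: (@span_ind _ (fun w => good w /\ span G (ser_mul z w))) => [|w1 w2 [g1 s1] [g2 s2]|w1 /GP [f1 w1G g1]].
  - by split; [exact: good0 | rewrite ser_mul0r //; exact: span0].
  - by split; [exact: good_sub | rewrite ser_mul_zmr //; exact: spanB].
  split=> //; apply: span_in; exists (f + f1); apply/GfilE.
  by apply: FS_mul zP w1G => // i j; lia.
apply: spanD; first by apply: spanD; [exact: Gmul_l uP yv | exact: Gmul_r vP xu].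
suff zs : good (v' - v) /\ span G (ser_mul (u' - u) (v' - v)) by case: zs.
move: (v' - v) yv {dvg};
  apply: (@span_ind _ (fun w => good w /\ span G (ser_mul (u' - u) w))) => [|w1 w2 [g1 s1] [g2 s2]|w1 /GP [f1 w1G g1]].
- by split; [exact: good0 | rewrite ser_mul0r //; exact: span0].
- by split; [exact: good_sub | rewrite ser_mul_zmr //; exact: spanB].
(* An element of G^k has in particular order at most m, so it can play the part of the homogeneous
   factor. *)
split=> //; apply: (Gmul_r _ _ f1) xu => m.
by apply: Dop_mono (w1G m); lia.
Qed.

End Series.

(** * The map and the derivation on the nerve *)

Lemma ksgnC (V : zmodType) (m n : int) (x : V) : ksgn m (ksgn n x) = ksgn n (ksgn m x).
Proof. by rewrite !ksgn_add addrC. Qed.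

Ltac good_tac := by repeat first [assumption | apply: goodD | apply: good_ksgn | apply: good_mul].

Section NerveMaps.
Variables (R A : cdga) (iota : cdga_hom R A) (M : dgmod A).
Local Notation helt := (helt A).
Local Notation tens := (tens iota).
Local Notation pw := (@pw _ _ iota).
Local Notation ser := (ser M).
Local Notation L i h := (@tl _ _ iota _ (Lw iota i h)).
Local Notation h1 := (h1 A).
Local Notation delta := (pw [:: h1; h1]).
Local Notation cst a := (@ser_const A M (hv a)).
Local Notation rho_ e r := (mkh e (iota r)).
Implicit Types (a b c h g : helt) (s t : seq helt) (x y z : tens).

Lemma sgK x : sg (sg x) = x.
Proof.
move: x; apply: tens_ext; [exact: (zm_comp (@sg_zm _ _ _) (@sg_zm _ _ _))|by []|].
by move=> a s; rewrite sg_pw (zm_ksgn (@sg_zm _ _ _)) sg_pw ksgnK.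
Qed.

Lemma sg_cup x y : sg (cup x y) = cup (sg x) (sg y).
Proof.
move: x; apply: tens_ext.
- exact: (zm_comp (@sg_zm _ _ _) (@cup_zml _ _ _ y)).
- exact: (zm_comp (@cup_zml _ _ _ _) (@sg_zm _ _ _)).
move=> a s; elim: s a y => [|b s IHs] a y.
  rewrite sg_pw (zm_ksgn (@cup_zml _ _ _ _)) !cup_single sg_L.
  by rewrite swd_cons swd_nil addr0.
rewrite -pre_pw cup_pre !sg_pre IHs (zm_ksgn (@cup_zml _ _ _ _)).
by rewrite cup_pre.
Qed.

Lemma good_cst a : good (cst a). Proof. exact: good_const. Qed.

Lemma ser_const_add (a b : A) : ser_const (a + b) = ser_const a + ser_const b :> ser.
Proof.
apply/funext => n; apply/funext => x; rewrite /ser_const addE !fctE.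
by case: eqP => _; rewrite ?addr0 // scalerDl.
Qed.

Lemma ser_const1r (u : ser) : good u -> ser_mul u (ser_const 1) = u.
Proof.
by move=> ug; apply/funext => n; apply/funext => x; rewrite ser_mul_constr // scale1r.
Qed.

(** Scalars from R are graded-central among R-linear operators, even those that are not A-linear. *)
Lemma ser_mul_rho (d e : int) (r : R) (u : ser) : good u ->
  (forall m, homR iota d (u m)) -> gdeg e r ->
  ser_mul u (cst (rho_ e r)) = ksgn (e * d) (ser_mul (cst (rho_ e r)) u).
Proof.
move=> ug uR er; apply/funext => n; apply/funext => x.
rewrite ser_mul_constr // !ksgn_fct ser_mul_constl hv_mkh; last exact: gdeg_rho.
by have [_ _] := uR n; apply.
Qed.

Lemma FS_homR G d (u : ser) m : FS iota G d u -> homR iota d (u m).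
Proof. by move=> uG; exact: Dop_homR (uG m). Qed.

(** * The algebra map on the nerve *)

Section Phi.
Variables (D : ser) (hD : QPol iota 1 D).

Lemma D_good : good D. Proof. exact: Pol_good hD. Qed.

(** Up to (-1)^|s|, the word a :: s is the cup product of a, delta and s; this sign, repeated along
    the recursion, gives the exponent |a1| + 2 |a2| + ... + n |an|. *)
Fixpoint phw s : ser :=
  if s is a :: s' then
    if s' is _ :: _ then ksgn (swd s') (ser_mul (cst a) (ser_mul D (phw s')))
    else cst a
  else 0.

Lemma phw_cons a b s : phw (a :: b :: s) =
  ksgn (swd (b :: s)) (ser_mul (cst a) (ser_mul D (phw (b :: s)))).
Proof. by []. Qed.

Lemma phw_good s : good (phw s).
Proof.
elim: s => [|a [|b s] IHs]; [exact: good0|exact: good_cst|].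
rewrite phw_cons; apply/good_ksgn/good_mul; first exact: good_cst.
exact: good_mul D_good IHs.
Qed.

Lemma phw_L0 h a s : phw (hmul h a :: s) = ser_mul (cst h) (phw (a :: s)).
Proof.
case: s => [|b s]; first by rewrite /= ser_const_mul.
have Dg := good_mul D_good (phw_good (b :: s)).
have hg := good_cst h; have ag := good_cst a.
rewrite !phw_cons hv_mul -ser_const_mul ser_mul_sgnr //; last exact: good_mul.
by rewrite -ser_mulA.
Qed.

(** A scalar of degree e passes D, of degree 1, with the sign (-1)^e. Moving it into the tail also
    changes the degree of the tail by e, and the two signs cancel. *)
Lemma phw_respects : respects iota phw.
Proof.
apply: (@respects_recP R A iota ser phw phw (fun u => good u)
  (fun a d _ u => ksgn d (ser_mul (cst a) (ser_mul D u)))).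
- by right.
- exact: phw_good.
- move=> a d _ x y xg yg; have ag := good_cst a.
  by rewrite !ser_mulDr ?ksgnD //; try exact: D_good; exact: good_mul D_good _.
- by [].
- move=> [|d v] a b c ac bc cab; first by rewrite /= cab ser_const_add.
  have Dg := good_mul D_good (phw_good (d :: v)).
  by rewrite !phw_cons cab ser_const_add ser_mulDl ?ksgnD //; exact: good_const.
move=> v a b e r er; have pg := phw_good (b :: v); have rg := good_cst (rho_ e r).
have ag := good_cst a; have Dg := D_good.
rewrite !phw_cons phw_L0 hv_mul -ser_const_mul -ser_mulA //; last exact: good_mul.
rewrite (ser_mulA Dg) // (@ser_mul_rho 1) //; last by move=> m; exact: FS_homR hD.
rewrite ser_mul_sgnl //; last exact: good_mul.
rewrite -ser_mulA // ser_mul_sgnr //; last by apply: good_mul => //; exact: good_mul.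
rewrite ksgn_add; apply: ksgn_eq; rewrite !swd_cons hd_mul (hd_mkh (gdeg_rho iota er)).
by sgn_parity.
Qed.

Definition phi : tens -> ser := tl phw.

Lemma phi_zm : zmod_morphism phi. Proof. exact/tl_zm/phw_respects. Qed.

Lemma phi_pw a s : phi (pw (a :: s)) = phw (a :: s).
Proof. exact/tl_pw/phw_respects. Qed.

Lemma phi_good x : good (phi x).
Proof.
apply: (span_ind (P := fun x => good (phi x))) (tens_span x).
- by rewrite (zm0 phi_zm); exact: good0.
- by move=> y z; rewrite phi_zm; exact: good_sub.
by move=> _ [[a s] _ <-]; rewrite pureE phi_pw; exact: phw_good.
Qed.

Lemma phi_L0 h x : phi (L 0 h x) = ser_mul (cst h) (phi x).
Proof.
move: x; apply: tens_ext.
- exact: (zm_comp phi_zm (@L_zm _ _ _ 0 h)).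
- move=> x y; rewrite phi_zm; apply: ser_mul_zmr; first exact: good_cst.
    exact: phi_good.
  exact: phi_good.
by move=> a s; rewrite L0_pw !phi_pw phw_L0.
Qed.

Lemma phi_pre a x : phi (pre a x) = ser_mul (cst a) (ser_mul D (phi (sg x))).
Proof.
have Dg := D_good; have ag := good_cst a.
move: x; apply: tens_ext.
- exact: (zm_comp phi_zm (@pre_zm _ _ _ a)).
- move=> x y; have xg := phi_good (sg x); have yg := phi_good (sg y).
  by rewrite (@sg_zm _ _ _) phi_zm !ser_mul_zmr //; exact: good_mul.
move=> b s; rewrite pre_pw sg_pw (zm_ksgn phi_zm) !phi_pw phw_cons.
have pg := phw_good (b :: s).
by rewrite !ser_mul_sgnr //; exact: good_mul.
Qed.

Lemma phi_cup x y : phi (cup x y) = ser_mul (phi x) (phi y).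
Proof.
have Dg := D_good; move: x; apply: tens_ext.
- exact: (zm_comp phi_zm (@cup_zml _ _ _ y)).
- by move=> x x'; rewrite phi_zm; apply: ser_mul_zml; exact: phi_good.
move=> a s; elim: s a y => [|b s IHs] a y.
  by rewrite cup_single phi_L0 phi_pw.
rewrite -pre_pw cup_pre !phi_pre sg_cup sgK sg_pw (zm_ksgn (@cup_zml _ _ _ _)).
rewrite !(zm_ksgn phi_zm) IHs.
have ag := good_cst a; have pg := phi_good (pw (b :: s)); have yg := phi_good y.
have Dpg := good_mul Dg pg.
by rewrite !ser_mul_sgnr ?ser_mul_sgnl ?ser_mulA //; repeat apply: good_mul.
Qed.

Lemma cst_FS G a : (0 <= G 0)%R -> FS iota G (hd a) (cst a).
Proof. by move=> G0; apply: FS_const => //; exact: hP. Qed.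

(** Each of the n factors D has order at most m + 1 in hbar^m. The excess n is why the algebra map
    lives in the localised algebra. *)
Lemma phw_FS a s :
  FS iota (fun m => m + (size s)%:Z) ((size s)%:Z + swd (a :: s)) (phw (a :: s)).
Proof.
elim: s a => [|b s IHs] a.
  by rewrite swd_cons swd_nil addr0 add0r; exact: cst_FS.
rewrite phw_cons; apply: FS_ksgn; have pg := phw_good (b :: s).
have -> : (size (b :: s))%:Z + swd (a :: b :: s) =
    hd a + (1 + ((size s)%:Z + swd (b :: s))).
  by rewrite [swd (a :: _)]swd_cons /=; lia.
have Dp : FS iota (fun m => m + (size s).+1%:Z) (1 + ((size s)%:Z + swd (b :: s)))
    (ser_mul D (phw (b :: s))).
  by apply: FS_mul hD (IHs b) => // [|i j]; [exact: D_good | lia].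
apply: FS_mul (cst_FS (G := id) a _) Dp => //; first exact: good_cst.
  exact: good_mul D_good pg.
by move=> i j /=; lia.
Qed.

Lemma phi_FS n e x : tens_ne n e x -> FS iota (fun m => m + n%:Z) (n%:Z + e) (phi x).
Proof.
apply: (span_ind (P := fun x => FS iota (fun m => m + n%:Z) (n%:Z + e) (phi x))).
- by rewrite (zm0 phi_zm); exact: FS0.
- by move=> y z; rewrite phi_zm; exact: FS_sub.
by move=> _ [[a s] /= [<- <-] <-]; rewrite pureE phi_pw; exact: phw_FS.
Qed.

Lemma TLaurent_FS n d (u : ser) : FS iota (fun m => m + n%:Z) d u -> TLaurent iota d u.
Proof.
move=> uF; exists n => m; rewrite /hshift addr0.
by have := uF (m - n%:Z); rewrite subrK.
Qed.

Lemma phi_nerve : nerve_map D phi.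
Proof.
split.
- exact: zmD phi_zm.
- by move=> n e x /phi_FS; exact: TLaurent_FS.
- exact: phi_cup.
- by move=> e a ea; rewrite tens_ofE phi_pw /= hv_mkh.
rewrite one_oneE phi_pw phw_cons swd_cons swd_nil hd_h1 ksgn_even //= hv_h1.
by rewrite ser_const1l ser_const1r //; exact: D_good.
Qed.

End Phi.

Lemma nm_pw1 (D : ser) (f : tens -> ser) a : nerve_map D f -> f (pw [:: a]) = cst a.
Proof.
by case=> _ _ _ + _ => /(_ _ _ (hP a)); rewrite tens_ofE mkh_hdv.
Qed.

Lemma nm_zm (D : ser) (f : tens -> ser) : nerve_map D f -> zmod_morphism f.
Proof. by case=> fD _ _ _ _; exact: zm_of_add. Qed.

Lemma nm_delta (D : ser) (f : tens -> ser) : nerve_map D f -> f delta = D.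
Proof. by case. Qed.

Lemma pw_consE a b s : pw (a :: b :: s) =
  ksgn (swd (b :: s)) (cup (cup (pw [:: a]) delta) (pw (b :: s))).
Proof. by rewrite cup_delta_pw ksgnK. Qed.

(** Every word is, up to sign, a cup product of single slots and copies of delta. *)
Lemma nerve_map_unique (D : ser) (f g : tens -> ser) : nerve_map D f -> nerve_map D g -> f = g.
Proof.
move=> fN gN; apply/funext; apply: tens_ext; [exact: nm_zm fN|exact: nm_zm gN|].
move=> a s; elim: s a => [|b s IHs] a; first by rewrite (nm_pw1 _ fN) (nm_pw1 _ gN).
rewrite pw_consE (zm_ksgn (nm_zm fN)) (zm_ksgn (nm_zm gN)).
rewrite !(nm_cup fN) !(nm_cup gN) (nm_pw1 _ fN) (nm_pw1 _ gN).
by rewrite (nm_delta fN) (nm_delta gN) IHs.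
Qed.

(** * The derivation on the nerve *)

Section Psi.
Variables (D : ser) (hD : QPol iota 1 D) (r : int) (rho : ser) (hrho : TPol iota r rho).
Let ph := phw D.

Lemma rho_good : good rho. Proof. exact: Pol_good hrho. Qed.

(** The Leibniz rule for a delta s, with a derivation of degree r - 1 killing [a]: it passes [a]
    with the sign (r - 1)|a| and delta with the sign r - 1. The remaining sign is that of [phw]. *)
Fixpoint psw s : ser :=
  if s is a :: s' then
    if s' is _ :: _ then ksgn (swd s' + (r - 1) * hd a)
      (ser_mul (cst a) (ser_mul rho (ph s') + ksgn (r - 1) (ser_mul D (psw s'))))
    else 0
  else 0.

Lemma psw_cons a b s : psw (a :: b :: s) = ksgn (swd (b :: s) + (r - 1) * hd a)
  (ser_mul (cst a) (ser_mul rho (ph (b :: s)) + ksgn (r - 1) (ser_mul D (psw (b :: s))))).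
Proof. by []. Qed.

Lemma psw_good s : good (psw s).
Proof.
have Dg := D_good hD; have rg := rho_good.
elim: s => [|a [|b s] IHs]; [exact: good0|exact: good0|].
rewrite psw_cons; apply/good_ksgn/good_mul; first exact: good_cst.
apply: goodD; first by apply: good_mul => //; exact: phw_good.
by apply/good_ksgn/good_mul.
Qed.

Lemma psw_tail_good b s :
  good (ser_mul rho (ph (b :: s)) + ksgn (r - 1) (ser_mul D (psw (b :: s)))).
Proof.
apply: goodD; first exact: good_mul rho_good (phw_good hD _).
exact/good_ksgn/(good_mul (D_good hD))/psw_good.
Qed.

Lemma psw_L0 h a s : psw (hmul h a :: s) =
  ksgn ((r - 1) * hd h) (ser_mul (cst h) (psw (a :: s))).
Proof.
have hg := good_cst h; have ag := good_cst a.
case: s => [|b s]; first by rewrite /= ser_mul0r ?ksgn0.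
have tg := psw_tail_good b s.
rewrite !psw_cons hv_mul -ser_const_mul ser_mul_sgnr //; last exact: good_mul.
rewrite ser_mulA // ksgn_add; apply: ksgn_eq; rewrite hd_mul.
by sgn_parity.
Qed.

(** The recursion for the derivation refers to the algebra map on the tail, so the relations are
    checked for the pair of both at once. *)
Lemma psw_respects : respects iota psw.
Proof.
have Dg := D_good hD; have rg := rho_good.
(* The scalar leaves both summands with the same sign: e r past rho, and e past D together with (r -
   1) e past the derivation. *)
have tail_rho e (q : R) b v : gdeg e q ->
  ser_mul rho (ph (hmul (rho_ e q) b :: v)) +
    ksgn (r - 1) (ser_mul D (psw (hmul (rho_ e q) b :: v))) =
  ksgn (e * r) (ser_mul (cst (rho_ e q)) (ser_mul rho (ph (b :: v)) +
    ksgn (r - 1) (ser_mul D (psw (b :: v))))).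
  move=> eq; have qg := good_cst (rho_ e q); have pg := phw_good hD (b :: v).
  have sg := psw_good (b :: v).
  have Dsg := good_mul Dg sg; have rpg := good_mul rg pg.
  rewrite psw_L0 /ph phw_L0 // ser_mul_sgnr //; last exact: good_mul.
  rewrite (ser_mulA rg) // (ser_mulA Dg) //.
  rewrite (@ser_mul_rho r) //; last by move=> m; exact: FS_homR hrho.
  rewrite (@ser_mul_rho 1) //; last by move=> m; exact: FS_homR hD.
  rewrite !ser_mul_sgnl //; try exact: good_mul.
  rewrite -!ser_mulA // ser_mulDr // ?ser_mul_sgnr //; last exact: good_ksgn.
  rewrite ksgnD !ksgn_add; congr (_ + _); apply: ksgn_eq.
  by rewrite (hd_mkh (gdeg_rho iota eq)); sgn_parity.
pose F s : (ser * ser)%type := (ph s, psw s).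
have rF : respects iota F.
  apply: (@respects_recP R A iota (ser * ser)%type F F (fun p => good p.1 /\ good p.2)
    (fun a d _ p => (ksgn d (ser_mul (cst a) (ser_mul D p.1)),
       ksgn (d + (r - 1) * hd a) (ser_mul (cst a)
         (ser_mul rho p.1 + ksgn (r - 1) (ser_mul D p.2)))))).
  - by right.
  - by move=> s; split; [exact: phw_good | exact: psw_good].
  - move=> a d _ [x1 x2] [y1 y2] [/= x1g x2g] [/= y1g y2g]; have ag := good_cst a.
    congr (_, _); rewrite /=.
      by rewrite !ser_mulDr ?ksgnD //; exact: good_mul.
    rewrite -ksgnD -ser_mulDr //.
    + congr (ksgn _ (ser_mul _ _)); rewrite (ser_mulDr rg) // (ser_mulDr Dg) //.
      by rewrite ksgnD addrACA.
    + by apply: goodD; [exact: good_mul | apply/good_ksgn/good_mul].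
    by apply: goodD; [exact: good_mul | apply/good_ksgn/good_mul].
  - by [].
  - move=> v a b c ac bc cab; congr (_, _).
      exact: (resp_add (phw_respects hD) [::]) ac bc cab.
    case: v => [|d v] /=; first by rewrite addr0.
    rewrite -!psw_cons !psw_cons ac bc cab ser_const_add ser_mulDl ?ksgnD //;
      try exact: good_const; exact: psw_tail_good.
  move=> v a b e q eq; congr (_, _).
    exact: (resp_bal (phw_respects hD) [::]) eq.
  have ag := good_cst a; have qg := good_cst (rho_ e q).
  rewrite !psw_cons (tail_rho _ _ _ _ eq) hv_mul -ser_const_mul.
  have tg := psw_tail_good b v.
  rewrite -ser_mulA // ser_mul_sgnr //; last exact: good_mul.
  rewrite ksgn_add; apply: ksgn_eq; rewrite !swd_cons !hd_mul.
  by rewrite (hd_mkh (gdeg_rho iota eq)); sgn_parity.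
split=> [u v a b c ac bc cab|u v a b e q eq].
  by have [] : F (u ++ c :: v) = F (u ++ a :: v) + F (u ++ b :: v)
    by exact (resp_add rF u v ac bc cab).
by have [] := resp_bal rF u v a b eq.
Qed.

Definition psi : tens -> ser := tl psw.

Lemma psi_zm : zmod_morphism psi. Proof. exact/tl_zm/psw_respects. Qed.

Lemma psi_pw a s : psi (pw (a :: s)) = psw (a :: s).
Proof. exact/tl_pw/psw_respects. Qed.

Lemma psi_good x : good (psi x).
Proof.
apply: (span_ind (P := fun x => good (psi x))) (tens_span x).
- by rewrite (zm0 psi_zm); exact: good0.
- by move=> y z; rewrite psi_zm; exact: good_sub.
by move=> _ [[a s] _ <-]; rewrite pureE psi_pw; exact: psw_good.
Qed.

Lemma psi_L0 h x :
  psi (L 0 h x) = ksgn ((r - 1) * hd h) (ser_mul (cst h) (psi x)).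
Proof.
move: x; apply: tens_ext.
- exact: (zm_comp psi_zm (@L_zm _ _ _ 0 h)).
- apply: zm_ksgn_fun => x y; rewrite psi_zm; apply: ser_mul_zmr; first exact: good_cst.
    exact: psi_good.
  exact: psi_good.
by move=> a s; rewrite L0_pw !psi_pw psw_L0.
Qed.

Lemma psi_pre a x : psi (pre a x) = ksgn ((r - 1) * hd a) (ser_mul (cst a)
  (ser_mul rho (phi D (sg x)) + ksgn (r - 1) (ser_mul D (psi (sg x))))).
Proof.
have Dg := D_good hD; have rg := rho_good; have ag := good_cst a.
move: x; apply: tens_ext.
- exact: (zm_comp psi_zm (@pre_zm _ _ _ a)).
- apply: zm_ksgn_fun => x y; have xg := phi_good hD (sg x); have yg := phi_good hD (sg y).
  have xg' := psi_good (sg x); have yg' := psi_good (sg y).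
  rewrite (@sg_zm _ _ _) (phi_zm hD) psi_zm !ser_mul_zmr // ksgnB.
  rewrite -(ser_mul_zmr ag); [|good_tac|good_tac].
  by congr (ser_mul _ _); rewrite opprD addrACA.
move=> b s; rewrite pre_pw sg_pw (zm_ksgn (phi_zm hD)) (zm_ksgn psi_zm).
rewrite !psi_pw (phi_pw hD) psw_cons.
have pg := phw_good hD (b :: s); have sg := psw_good (b :: s).
rewrite !ser_mul_sgnr //.
rewrite [ksgn (r - 1) (ksgn _ _)]ksgnC -ksgnD.
rewrite ser_mul_sgnr // ?ksgn_add; last exact: psw_tail_good.
by rewrite addrC.
Qed.

Lemma psi_cup n e x y : tens_ne n e x -> psi (cup x y) =
  ser_mul (psi x) (phi D y) + ksgn ((r - 1) * (n%:Z + e)) (ser_mul (phi D x) (psi y)).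
Proof.
have Dg := D_good hD; have rg := rho_good.
have yg := phi_good hD y; have yg' := psi_good y.
move: x; apply: tens_ne_ext.
- exact: (zm_comp psi_zm (@cup_zml _ _ _ y)).
- apply: zm_add; last apply: zm_ksgn_fun.
    by move=> x x'; rewrite psi_zm; exact (ser_mul_zml yg (psi_good x) (psi_good x')).
  move=> x x'; rewrite (phi_zm hD).
  exact (ser_mul_zml yg' (phi_good hD x) (phi_good hD x')).
move=> a s; elim: s a n e y yg yg' => [|b s IHs] a n e y yg yg' <- <-.
  rewrite cup_single psi_L0 psi_pw ser_mul0l // add0r (phi_pw hD) /=.
  by apply: ksgn_eq; rewrite swd_cons swd_nil; sgn_parity.
rewrite -pre_pw cup_pre !psi_pre (phi_pre hD) sg_cup sgK sg_pw.
rewrite (zm_ksgn (@cup_zml _ _ _ _)) !(zm_ksgn (phi_zm hD)) !(zm_ksgn psi_zm).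
rewrite (phi_cup hD) (IHs b (size s) (swd (b :: s))) //.
have ag := good_cst a; have pg := phi_good hD (pw (b :: s)).
have sg := psi_good (pw (b :: s)).
set P := phi D (pw (b :: s)) in pg *; set S := psi (pw (b :: s)) in sg *.
set Y := phi D y in yg *; set Z := psi y in yg' *.
set e' := swd (b :: s); set k2 := (r - 1) * ((size s)%:Z + e').
have H1 : ser_mul rho (ksgn e' (ser_mul P Y)) = ksgn e' (ser_mul (ser_mul rho P) Y).
  by rewrite ser_mul_sgnr ?ser_mulA //; good_tac.
have H2 : ser_mul D (ksgn e' (ser_mul S Y + ksgn k2 (ser_mul P Z))) =
    ksgn e' (ser_mul (ser_mul D S) Y) + ksgn (e' + k2) (ser_mul (ser_mul D P) Z).
  by rewrite ser_mul_sgnr ?ser_mulDr ?ser_mul_sgnr ?ser_mulA ?ksgnD ?ksgn_add //;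
    good_tac.
rewrite H1 H2 !(ser_mul_sgnr _ _ pg) ?(ser_mul_sgnr _ _ sg) //.
have X1g := good_mul rg pg; have X2g := good_mul Dg sg; have X3g := good_mul Dg pg.
move: (ser_mul rho P) (ser_mul D S) (ser_mul D P) X1g X2g X3g => X1 X2 X3 X1g X2g X3g.
rewrite !(ser_mul_sgnl, ser_mulDr, ser_mul_sgnr, ser_mulDl, ksgnD, ksgn_add); try good_tac.
rewrite !ser_mulA //; try good_tac.
rewrite addrA; congr (_ + _ + _); apply: ksgn_eq;
  rewrite /k2 /e' ?(swd_cons a) /=; sgn_parity.
Qed.

Lemma psw_FS a s : FS iota (fun m => m + (size s)%:Z)
  ((size s)%:Z + swd (a :: s) + (r - 1)) (psw (a :: s)).
Proof.
have Dg := D_good hD; have rg := rho_good.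
elim: s a => [|b s IHs] a; first exact: FS0.
have pg := phw_good hD (b :: s); have sg := psw_good (b :: s).
rewrite psw_cons; apply: FS_ksgn.
have -> : (size (b :: s))%:Z + swd (a :: b :: s) + (r - 1) =
    hd a + (r + ((size s)%:Z + swd (b :: s))).
  by rewrite (swd_cons a) /=; lia.
have tF : FS iota (fun m => m + (size s).+1%:Z) (r + ((size s)%:Z + swd (b :: s)))
    (ser_mul rho (ph (b :: s)) + ksgn (r - 1) (ser_mul D (psw (b :: s)))).
  apply: FSD; first by apply: FS_mul hrho (phw_FS hD b s) => // i j; lia.
  apply: FS_ksgn.
  have -> : r + ((size s)%:Z + swd (b :: s)) =
    1 + ((size s)%:Z + swd (b :: s) + (r - 1)) by lia.
  by apply: FS_mul hD (IHs b) => // i j; lia.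
apply: FS_mul (cst_FS (G := id) a _) tF => //; first exact: good_cst.
  exact: psw_tail_good.
by move=> i j /=; lia.
Qed.

Lemma psi_FS n e x : tens_ne n e x ->
  FS iota (fun m => m + n%:Z) (n%:Z + e + (r - 1)) (psi x).
Proof.
apply: (span_ind (P := fun x =>
  FS iota (fun m => m + n%:Z) (n%:Z + e + (r - 1)) (psi x))).
- by rewrite (zm0 psi_zm); exact: FS0.
- by move=> y z; rewrite psi_zm; exact: FS_sub.
by move=> _ [[a s] /= [<- <-] <-]; rewrite pureE psi_pw; exact: psw_FS.
Qed.

Lemma psi_nerve : nerve_der (phi D) r rho psi.
Proof.
split.
- exact: zmD psi_zm.
- by move=> n e x /psi_FS; exact: TLaurent_FS.
- by move=> n e x y; exact: psi_cup.
- by move=> e a ea; rewrite tens_ofE psi_pw.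
rewrite one_oneE psi_pw psw_cons /= ser_mul0r; last exact: D_good.
rewrite ksgn0 addr0 swd_cons swd_nil hd_h1 mulr0 !addr0 [ksgn 0 _]ksgn_even // hv_h1.
by rewrite ser_const1l ser_const1r //; exact: rho_good.
Qed.

End Psi.

Lemma nd_zm (p : tens -> ser) r (rho : ser) f : nerve_der p r rho f -> zmod_morphism f.
Proof. by case=> fD _ _ _ _; exact: zm_of_add. Qed.

Lemma nd_pw1 (p : tens -> ser) r (rho : ser) f a :
  nerve_der p r rho f -> f (pw [:: a]) = 0.
Proof. by case=> _ _ _ + _ => /(_ _ _ (hP a)); rewrite tens_ofE mkh_hdv. Qed.

Lemma nd_delta (p : tens -> ser) r (rho : ser) f : nerve_der p r rho f -> f delta = rho.
Proof. by case. Qed.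

Lemma nerve_der_unique (p : tens -> ser) r (rho : ser) (f g : tens -> ser) :
  nerve_der p r rho f -> nerve_der p r rho g -> f = g.
Proof.
move=> fN gN; apply/funext; apply: tens_ext; [exact: nd_zm fN|exact: nd_zm gN|].
move=> a s; elim: s a => [|b s IHs] a; first by rewrite (nd_pw1 _ fN) (nd_pw1 _ gN).
rewrite pw_consE (zm_ksgn (nd_zm fN)) (zm_ksgn (nd_zm gN)).
have a1 := pw1_ne iota a; have ad1 := cup_ne a1 (delta_ne iota).
rewrite !(nd_cup fN _ ad1) !(nd_cup gN _ ad1) !(nd_cup fN _ a1) !(nd_cup gN _ a1).
by rewrite (nd_pw1 _ fN) (nd_pw1 _ gN) (nd_delta fN) (nd_delta gN) IHs.
Qed.

End NerveMaps.

(** * Orders of the values *)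

Section FilteredValues.
Variables (R A : cdga) (iota : cdga_hom R A) (M : dgmod A).
Local Notation helt := (helt A).
Local Notation tens := (tens iota).
Local Notation pw := (@pw _ _ iota).
Local Notation ser := (ser M).
Local Notation L i h := (@tl _ _ iota _ (Lw iota i h)).
Local Notation h1 := (h1 A).
Local Notation delta := (pw [:: h1; h1]).
Local Notation cst a := (@ser_const A M (hv a)).
Local Notation FS := (@FS R A iota M).
Implicit Types (a b h : helt) (s : seq helt) (x y z c : tens).

(** * Values of the algebra map *)

Section Morphism.
Variables (D : ser) (f : tens -> ser).
Hypotheses (hQ : QPol iota 1 D) (fN : nerve_map D f).

Lemma nm_good x : good (f x).
Proof. by rewrite (nerve_map_unique fN (phi_nerve hQ)); exact: phi_good. Qed.

(** Multiplicativity carries a commutator for the cup product to a commutator of operators; 1 + e is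
    the total degree of [c]. *)
Lemma nm_comm e h c : tens_ne 1 e c ->
  f (L 0 h c - L 1 h c) = ser_comm (hd h) (1 + e) (hv h) (f c).
Proof.
move=> c1; rewrite (commutatorE _ c1) (nm_zm fN) (zm_ksgn (nm_zm fN)) !(nm_cup fN).
by rewrite (nm_pw1 _ fN) ser_commE //; exact: nm_good.
Qed.

Lemma nm_dt b : f (dt iota b) = ser_comm (hd b) 1 (hv b) D.
Proof. by rewrite /dt (nm_comm _ (delta_ne iota)) addr0 (nm_delta fN). Qed.

Lemma nm_dt_FS b : FS id (1 + hd b) (f (dt iota b)).
Proof.
rewrite nm_dt addrC; apply: FS_mono (FS_comm (hP b) hQ) => m /=.
by rewrite addrK.
Qed.

Lemma nm_NQ_FS n e y : NQ n e y -> FS id (n%:Z + e) (f y).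
Proof.
elim=> [|{}n {}e b z _ zF].
  by rewrite (nm_pw1 _ fN) -(hd_h1 A) add0r; exact: cst_FS.
rewrite (nm_cup fN).
have -> : n.+1%:Z + (hd b + e) = (1 + hd b) + (n%:Z + e) by lia.
by apply: FS_mul (nm_dt_FS b) zF; try exact: nm_good.
Qed.

Lemma nm_NG_FS n e x : NG n e x -> FS id (n%:Z + e) (f x).
Proof.
apply: (span_ind (P := fun x => FS id (n%:Z + e) (f x))).
- by rewrite (zm0 (nm_zm fN)); exact: FS0.
- by move=> y z; rewrite (nm_zm fN); exact: FS_sub.
move=> _ [a [d [y [yQ <- ->]]]]; rewrite (nm_cup fN) (nm_pw1 _ fN) addrCA.
apply: FS_mul (@cst_FS _ _ iota M (id) a _) (nm_NQ_FS yQ) => //; first exact: good_cst.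
exact: nm_good.
Qed.

Hypothesis hF : FS (fun m => 2 * m) 1 D.

Lemma nm_Cgen_FS t e c : Cgen t e c -> FS (fun m => 2 * m - t%:Z) (1 + e) (f c).
Proof.
elim=> [|{}t {}e h {}c cC cF].
  by rewrite (nm_delta fN) addr0; apply: FS_mono hF => m; lia.
rewrite (nm_comm _ (Cgen_ne cC)) addrCA; apply: FS_mono (FS_comm (hP h) cF) => m.
by lia.
Qed.

Lemma nm_Kc_FS n q e x : Kc n q e x -> FS (fun m => 2 * m - q%:Z) (n%:Z + e) (f x).
Proof.
elim=> [a|{}n {}q {}e a t d c y cC _ yF].
  by rewrite (nm_pw1 _ fN) add0r; exact: cst_FS.
rewrite !(nm_cup fN) (nm_pw1 _ fN).
have -> : n.+1%:Z + (hd a + d + e) = (hd a + (1 + d)) + (n%:Z + e) by lia.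
have ag := good_cst M a; have cg := nm_good c; have yg := nm_good y.
have acF : FS (fun m => 2 * m - t%:Z) (hd a + (1 + d)) (ser_mul (cst a) (f c)).
  apply: FS_mul (@cst_FS _ _ iota M (fun m => 2 * m) a _) (nm_Cgen_FS cC) => // i j.
  by lia.
by apply: FS_mul acF yF => // [|i j]; [exact: good_mul | lia].
Qed.

(** Source of the I-adic continuity: for q > 2 m the coefficient of hbar^m has negative order, hence
    is zero. Elements of I^q are not homogeneous, so only a span over all degrees is obtained. *)
Lemma nm_KK q x : KK q x -> span [set u | exists d, FS (fun m => 2 * m - q%:Z) d u] (f x).
Proof.
move: x; apply: span_map; first exact: nm_zm fN.
move=> x [n /Kd_Kspan]; move: x; apply: span_map; first exact: nm_zm fN.
by move=> x [e xK]; apply: span_in; exists (n%:Z + e); exact: nm_Kc_FS.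
Qed.

(** Each factor [b, delta] carries one commutation. The bound is negative for n > 2 m, which makes
    the product over n in DR' harmless. *)
Lemma nm_NQ_FS2 n e y : NQ n e y -> FS (fun m => 2 * m - n%:Z) (n%:Z + e) (f y).
Proof.
elim=> [|{}n {}e b z _ zF].
  by rewrite (nm_pw1 _ fN) -(hd_h1 A) add0r; exact: cst_FS.
rewrite (nm_cup fN).
have -> : n.+1%:Z + (hd b + e) = (1 + (hd b + 0)) + (n%:Z + e) by lia.
have dtF := nm_Cgen_FS (CgenS b (Cgen0 iota)).
by apply: FS_mul dtF zF => [||i j]; [exact: nm_good|exact: nm_good|lia].
Qed.

Lemma nm_NG_FS2 n e x : NG n e x -> FS (fun m => 2 * m - n%:Z) (n%:Z + e) (f x).
Proof.
apply: (span_ind (P := fun x => FS (fun m => 2 * m - n%:Z) (n%:Z + e) (f x))).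
- by rewrite (zm0 (nm_zm fN)); exact: FS0.
- by move=> y z; rewrite (nm_zm fN); exact: FS_sub.
move=> _ [a [d [y [yQ <- ->]]]]; rewrite (nm_cup fN) (nm_pw1 _ fN) addrCA.
have ag := good_cst M a; have yg := nm_good y.
apply: FS_mul (@cst_FS _ _ iota M (fun m => 2 * m) a _) (nm_NQ_FS2 yQ) => // i j.
by lia.
Qed.

(** * Values of the derivation *)

Section Derivation.
Variables (r p : int) (rho : ser) (g : tens -> ser).
Hypotheses (hT : TPol iota r rho) (gN : nerve_der f r rho g).

Lemma nd_good x : good (g x).
Proof.
move: gN; rewrite (nerve_map_unique fN (phi_nerve hQ)) => gN'.
by rewrite (nerve_der_unique gN' (psi_nerve hQ hT)); exact: psi_good.
Qed.

Lemma nd_cst a y : g (cup (pw [:: a]) y) = ksgn ((r - 1) * hd a) (ser_mul (cst a) (g y)).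
Proof.
rewrite (nd_cup gN _ (pw1_ne iota a)) (nd_pw1 _ gN) (nm_pw1 _ fN) add0r.
by rewrite ser_mul0l ?add0r //; exact: nm_good.
Qed.

(** A derivation vanishing on A commutes with commutation by [h], up to the sign for passing [h].
    Thus rho loses order under commutation just as Delta does. *)
Lemma nd_comm e h c : tens_ne 1 e c -> g (L 0 h c - L 1 h c) =
  ksgn ((r - 1) * hd h) (ser_comm (hd h) (1 + e + (r - 1)) (hv h) (g c)).
Proof.
move=> c1; rewrite (commutatorE _ c1) (nd_zm gN) (zm_ksgn (nd_zm gN)) nd_cst.
rewrite (nd_cup gN _ c1) (nm_pw1 _ fN) (nd_pw1 _ gN) ser_mul0r; last exact: nm_good.
rewrite ksgn0 addr0 ser_commE; last exact: nd_good.
rewrite ksgnB ksgn_add; congr (_ - _); apply: ksgn_eq.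
by sgn_parity.
Qed.

Lemma nd_dt b : g (dt iota b) =
  ksgn ((r - 1) * hd b) (ser_comm (hd b) (1 + (r - 1)) (hv b) rho).
Proof. by rewrite /dt (nd_comm _ (delta_ne iota)) addr0 (nd_delta gN). Qed.

Lemma rho_FS : FS id r rho.
Proof. by move=> m; have := hT m; rewrite addr0. Qed.

Lemma nd_dt_FS b : FS id (1 + hd b + (r - 1)) (g (dt iota b)).
Proof.
rewrite nd_dt; apply: FS_ksgn.
have -> : 1 + hd b + (r - 1) = hd b + r by lia.
rewrite (_ : 1 + (r - 1) = r); last by lia.
by apply: FS_mono (FS_comm (hP b) rho_FS) => m /=; lia.
Qed.

Lemma nd_NQ_FS n e y : NQ n e y -> FS id (n%:Z + e + (r - 1)) (g y).
Proof.
elim=> [|{}n {}e b z zQ zF]; first by rewrite (nd_pw1 _ gN); exact: FS0.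
have dt1 := Cgen_ne (CgenS b (Cgen0 iota)).
rewrite (nd_cup gN _ dt1); apply: FSD; last apply: FS_ksgn.
  have -> : n.+1%:Z + (hd b + e) + (r - 1) = (1 + hd b + (r - 1)) + (n%:Z + e).
    by lia.
  by apply: FS_mul (nd_dt_FS b) (nm_NQ_FS zQ); [exact: nd_good | exact: nm_good|].
have -> : n.+1%:Z + (hd b + e) + (r - 1) = (1 + hd b) + (n%:Z + e + (r - 1)) by lia.
by apply: FS_mul (nm_dt_FS b) zF; [exact: nm_good | exact: nd_good|].
Qed.

Lemma nd_NG_FS n e x : NG n e x -> FS id (n%:Z + e + (r - 1)) (g x).
Proof.
apply: (span_ind (P := fun x => FS id (n%:Z + e + (r - 1)) (g x))).
- by rewrite (zm0 (nd_zm gN)); exact: FS0.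
- by move=> y z; rewrite (nd_zm gN); exact: FS_sub.
move=> _ [a [d [y [yQ <- ->]]]]; rewrite nd_cst.
have -> : n%:Z + (hd a + d) + (r - 1) = hd a + (n%:Z + d + (r - 1)) by lia.
apply: FS_ksgn.
apply: FS_mul (@cst_FS _ _ iota M (id) a _) (nd_NQ_FS yQ) => //; first exact: good_cst.
exact: nd_good.
Qed.

Hypothesis hrF : FS (fun m => 2 * m - p) r rho.

Lemma nd_Cgen_FS t e c : Cgen t e c ->
  FS (fun m => 2 * m - t%:Z - p) (1 + e + (r - 1)) (g c).
Proof.
elim=> [|{}t {}e h {}c cC cF].
  rewrite (nd_delta gN) (_ : 1 + 0 + (r - 1) = r); last by lia.
  by apply: FS_mono hrF => m; lia.
rewrite (nd_comm _ (Cgen_ne cC)); apply: FS_ksgn.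
have -> : 1 + (hd h + e) + (r - 1) = hd h + (1 + e + (r - 1)) by lia.
by apply: FS_mono (FS_comm (hP h) cF) => m; lia.
Qed.

Lemma nd_Kc_FS n q e x : Kc n q e x ->
  FS (fun m => 2 * m - q%:Z - p) (n%:Z + e + (r - 1)) (g x).
Proof.
elim=> [a|{}n {}q {}e a t d c y cC yK yF]; first by rewrite (nd_pw1 _ gN); exact: FS0.
have ac1 := cup_ne (pw1_ne iota a) (Cgen_ne cC).
have ag := good_cst M a; have cg := nm_good c; have yg := nm_good y.
have cg' := nd_good c; have yg' := nd_good y.
rewrite (nd_cup gN _ ac1) nd_cst (nm_cup fN) (nm_pw1 _ fN).
apply: FSD; last apply: FS_ksgn.
  have -> : n.+1%:Z + (hd a + d + e) + (r - 1) = (hd a + (1 + d + (r - 1))) + (n%:Z + e).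
    by lia.
  have acF : FS (fun m => 2 * m - t%:Z - p) (hd a + (1 + d + (r - 1)))
      (ser_mul (cst a) (g c)).
    apply: FS_mul (@cst_FS _ _ iota M (fun m => 2 * m) a _) (nd_Cgen_FS cC) => // i j.
    by lia.
  apply: FS_mul (FS_ksgn _ acF) (nm_Kc_FS yK) => // [|i j]; last by lia.
  exact/good_ksgn/good_mul.
have -> : n.+1%:Z + (hd a + d + e) + (r - 1) = (hd a + (1 + d)) + (n%:Z + e + (r - 1)).
  by lia.
have acF : FS (fun m => 2 * m - t%:Z) (hd a + (1 + d)) (ser_mul (cst a) (f c)).
  apply: FS_mul (@cst_FS _ _ iota M (fun m => 2 * m) a _) (nm_Cgen_FS cC) => // i j.
  by lia.
by apply: FS_mul acF yF => // [|i j]; [exact: good_mul | lia].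
Qed.

Lemma nd_KK q x : KK q x ->
  span [set u | exists d, FS (fun m => 2 * m - q%:Z - p) d u] (g x).
Proof.
move: x; apply: span_map; first exact: nd_zm gN.
move=> x [n /Kd_Kspan]; move: x; apply: span_map; first exact: nd_zm gN.
by move=> x [e xK]; apply: span_in; exists (n%:Z + e + (r - 1)); exact: nd_Kc_FS.
Qed.

Lemma nd_NQ_FS2 n e y : NQ n e y ->
  FS (fun m => 2 * m - n%:Z - p) (n%:Z + e + (r - 1)) (g y).
Proof.
elim=> [|{}n {}e b z zQ zF]; first by rewrite (nd_pw1 _ gN); exact: FS0.
have dC := CgenS b (Cgen0 iota); have dt1 := Cgen_ne dC.
rewrite (nd_cup gN _ dt1); apply: FSD; last apply: FS_ksgn.
  have -> : n.+1%:Z + (hd b + e) + (r - 1) = (1 + (hd b + 0) + (r - 1)) + (n%:Z + e).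
    by lia.
  apply: FS_mul (nd_Cgen_FS dC) (nm_NQ_FS2 zQ) => [||i j]; last by lia.
    exact: nd_good.
  exact: nm_good.
have -> : n.+1%:Z + (hd b + e) + (r - 1) = (1 + (hd b + 0)) + (n%:Z + e + (r - 1)).
  by lia.
apply: FS_mul (nm_Cgen_FS dC) zF => [||i j]; last by lia.
  exact: nm_good.
exact: nd_good.
Qed.

Lemma nd_NG_FS2 n e x : NG n e x ->
  FS (fun m => 2 * m - n%:Z - p) (n%:Z + e + (r - 1)) (g x).
Proof.
apply: (span_ind (P := fun x =>
  FS (fun m => 2 * m - n%:Z - p) (n%:Z + e + (r - 1)) (g x))).
- by rewrite (zm0 (nd_zm gN)); exact: FS0.
- by move=> y z; rewrite (nd_zm gN); exact: FS_sub.
move=> _ [a [d [y [yQ <- ->]]]]; rewrite nd_cst.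
have -> : n%:Z + (hd a + d) + (r - 1) = hd a + (n%:Z + d + (r - 1)) by lia.
apply: FS_ksgn.
have ag := good_cst M a; have yg := nd_good y.
apply: FS_mul (@cst_FS _ _ iota M (fun m => 2 * m) a _) (nd_NQ_FS2 yQ) => // i j.
by lia.
Qed.

End Derivation.
End Morphism.

(** * Dependence on the lifts of Delta and rho *)

Section Lifts.
Variables (k : nat) (D D' : ser) (f f' : tens -> ser).
Hypotheses (hQ : QPol iota 1 D) (fN : nerve_map D f).
Hypotheses (hQ' : QPol iota 1 D') (fN' : nerve_map D' f').
Hypothesis hDD : FS (fun m => m - k%:Z + 1) 1 (D - D').

Lemma ser_commB e d (a : A) (u v : ser) :
  ser_comm e d a (u - v) = ser_comm e d a u - ser_comm e d a v.
Proof. by apply/funext => m; rewrite /ser_comm subE op_commB. Qed.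

(** Two lifts of Delta differ by order at most m - k + 1, one too many for G^k; the commutator with
    [b] removes the excess. *)
Lemma nm_dt_diff b : FS (fun m => m - k%:Z) (1 + hd b) (f (dt iota b) - f' (dt iota b)).
Proof.
rewrite (nm_dt hQ fN) (nm_dt hQ' fN') -ser_commB addrC.
by apply: FS_mono (FS_comm (hP b) hDD) => m; rewrite addrK.
Qed.

Lemma ser_mul_diff (u v u' v' : ser) : good u -> good v -> good u' -> good v' ->
  ser_mul u v - ser_mul u' v' = ser_mul (u - u') v + ser_mul u' (v - v').
Proof. by move=> *; rewrite ser_mul_zml // ser_mul_zmr // addrA subrK. Qed.

(** The factors are exchanged one at a time. The difference supplies the loss of k, and the other
    factors, of order at most m, preserve it. *)
Lemma nm_NQ_diff n e y : NQ n e y -> FS (fun m => m - k%:Z) (n%:Z + e) (f y - f' y).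
Proof.
elim=> [|{}n {}e b z zQ zF].
  by rewrite (nm_pw1 _ fN) (nm_pw1 _ fN') (subrr (cst h1)); exact: FS0.
have dg := nm_good hQ fN (dt iota b); have dg' := nm_good hQ' fN' (dt iota b).
have zg := nm_good hQ fN z; have zg' := nm_good hQ' fN' z.
rewrite (nm_cup fN) (nm_cup fN') ser_mul_diff //.
have -> : n.+1%:Z + (hd b + e) = (1 + hd b) + (n%:Z + e) by lia.
apply: FSD.
  apply: FS_mul (nm_dt_diff b) (nm_NQ_FS hQ fN zQ) => // [|i j /=]; last by lia.
  exact: good_sub.
apply: FS_mul (nm_dt_FS hQ' fN' b) zF => // [|i j /=]; last by lia.
exact: good_sub.
Qed.

Lemma nm_NG_diff n e x : NG n e x -> FS (fun m => m - k%:Z) (n%:Z + e) (f x - f' x).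
Proof.
apply: (span_ind (P := fun x => FS (fun m => m - k%:Z) (n%:Z + e) (f x - f' x))).
- by rewrite (zm0 (nm_zm fN)) (zm0 (nm_zm fN')) (subrr (0 : ser)); exact: FS0.
- move=> y z yF zF; rewrite (zm_sub (nm_zm fN) (nm_zm fN')); exact: FS_sub.
move=> _ [a [d [y [yQ <- ->]]]]; rewrite (nm_cup fN) (nm_cup fN').
have ag := good_cst M a; have yg := nm_good hQ fN y; have yg' := nm_good hQ' fN' y.
rewrite (nm_pw1 _ fN) (nm_pw1 _ fN') -ser_mul_zmr // addrCA.
apply: FS_mul (@cst_FS _ _ iota M (id) a _) (nm_NQ_diff yQ) => // [|i j /=]; last by lia.
exact: good_sub.
Qed.

Variables (r : int) (rho rho' : ser) (g g' : tens -> ser).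
Hypotheses (hT : TPol iota r rho) (gN : nerve_der f r rho g).
Hypotheses (hT' : TPol iota r rho') (gN' : nerve_der f' r rho' g').
Hypothesis hrr : FS (fun m => m - k%:Z) r (rho - rho').

Lemma nd_dt_diff b :
  FS (fun m => m - k%:Z) (1 + hd b + (r - 1)) (g (dt iota b) - g' (dt iota b)).
Proof.
rewrite (nd_dt hQ fN hT gN) (nd_dt hQ' fN' hT' gN') -ksgnB -ser_commB.
apply: FS_ksgn; have -> : 1 + hd b + (r - 1) = hd b + r by lia.
rewrite (_ : 1 + (r - 1) = r); last by lia.
by apply: FS_mono (FS_comm (hP b) hrr) => m; lia.
Qed.

Lemma nd_NQ_diff n e y : NQ n e y ->
  FS (fun m => m - k%:Z) (n%:Z + e + (r - 1)) (g y - g' y).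
Proof.
elim=> [|{}n {}e b z zQ zF].
  by rewrite (nd_pw1 _ gN) (nd_pw1 _ gN') (subrr (0 : ser)); exact: FS0.
have dt1 := Cgen_ne (CgenS b (Cgen0 iota)).
have dg := nm_good hQ fN (dt iota b); have dg' := nm_good hQ' fN' (dt iota b).
have zg := nm_good hQ fN z; have zg' := nm_good hQ' fN' z.
have eg := nd_good hQ fN hT gN (dt iota b); have eg' := nd_good hQ' fN' hT' gN' (dt iota b).
have yg := nd_good hQ fN hT gN z; have yg' := nd_good hQ' fN' hT' gN' z.
have E m (X Y X' Y' : ser) :
    X + ksgn m Y - (X' + ksgn m Y') = (X - X') + ksgn m (Y - Y').
  by rewrite ksgnB opprD addrACA.
rewrite (nd_cup gN _ dt1) (nd_cup gN' _ dt1) E.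
rewrite !ser_mul_diff //.
apply: FSD; last (apply: FS_ksgn); apply: FSD.
- have -> : n.+1%:Z + (hd b + e) + (r - 1) = (1 + hd b + (r - 1)) + (n%:Z + e) by lia.
  apply: FS_mul (nd_dt_diff b) (nm_NQ_FS hQ fN zQ) => // [|i j /=]; last by lia.
  exact: good_sub.
- have -> : n.+1%:Z + (hd b + e) + (r - 1) = (1 + hd b + (r - 1)) + (n%:Z + e) by lia.
  apply: FS_mul (nd_dt_FS hQ' fN' hT' gN' b) (nm_NQ_diff zQ) => // [|i j /=]; last by lia.
  exact: good_sub.
- have -> : n.+1%:Z + (hd b + e) + (r - 1) = (1 + hd b) + (n%:Z + e + (r - 1)) by lia.
  apply: FS_mul (nm_dt_diff b) (nd_NQ_FS hQ fN hT gN zQ) => // [|i j /=]; last by lia.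
  exact: good_sub.
have -> : n.+1%:Z + (hd b + e) + (r - 1) = (1 + hd b) + (n%:Z + e + (r - 1)) by lia.
apply: FS_mul (nm_dt_FS hQ' fN' b) zF => // [|i j /=]; last by lia.
exact: good_sub.
Qed.

Lemma nd_NG_diff n e x : NG n e x ->
  FS (fun m => m - k%:Z) (n%:Z + e + (r - 1)) (g x - g' x).
Proof.
apply: (span_ind (P := fun x =>
  FS (fun m => m - k%:Z) (n%:Z + e + (r - 1)) (g x - g' x))).
- by rewrite (zm0 (nd_zm gN)) (zm0 (nd_zm gN')) (subrr (0 : ser)); exact: FS0.
- move=> y z yF zF; rewrite (zm_sub (nd_zm gN) (nd_zm gN')); exact: FS_sub.
move=> _ [a [d [y [yQ <- ->]]]]; rewrite (nd_cst hQ fN gN) (nd_cst hQ' fN' gN').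
have ag := good_cst M a; have yg := nd_good hQ fN hT gN y.
have yg' := nd_good hQ' fN' hT' gN' y.
rewrite -ksgnB -ser_mul_zmr //.
have -> : n%:Z + (hd a + d) + (r - 1) = hd a + (n%:Z + d + (r - 1)) by lia.
apply: FS_ksgn.
apply: FS_mul (@cst_FS _ _ iota M (id) a _) (nd_NQ_diff yQ) => // [|i j /=]; last by lia.
exact: good_sub.
Qed.

End Lifts.
End FilteredValues.

(** * Completion *)

Lemma sum_fctE (I T : Type) (V : zmodType) (r : seq I) (P : pred I) (F : I -> T -> V) t :
  (\sum_(i <- r | P i) F i) t = \sum_(i <- r | P i) F i t.
Proof. by rewrite fct_sumE. Qed.

(** * Approximating elements of the completion *)

Section Approximation.
Variables (R A : cdga) (iota : cdga_hom R A).
Local Notation tens := (tens iota).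
Local Notation hat := (hat iota).
Implicit Types (X Y : hat) (x y z : nat -> tens).

Lemma hat_zero_KK z : span (@hat_zero R A iota) z -> forall p, KK p (z p).
Proof.
move=> zs p; move: z zs; apply: (span_map (f := fun z : nat -> tens => z p)) => //.
by move=> z [n zn]; apply: (@Kd_KK _ _ _ n); exact: diag_pow_Kd.
Qed.

(** The representative [rep X] is known only modulo I^p at level p; this relation allows it to be
    replaced by a better chosen sequence. *)
Definition appr X x : Prop := forall p, KK p (rep X p - x p).
Definition coh x : Prop := forall p q, (p <= q)%N -> KK p (x q - x p).

Lemma appr_cls x : appr (hat_cls x) x.
Proof. exact: hat_zero_KK (rep_cls _ _). Qed.

Lemma appr_add X Y x y : appr X x -> appr Y y -> appr (X + Y) (fun p => x p + y p).
Proof.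
move=> Xx Yy p; have XY := hat_zero_KK (rep_add X Y) p.
have E (a b c u v : tens) : a - (u + v) = (a - (b + c)) + ((b - u) + (c - v)).
  by rewrite [X in _ = _ + X]addrACA -opprD subrKA.
rewrite (E _ (rep X p) (rep Y p)).
by apply: spanD => //; apply: spanD; [exact: Xx | exact: Yy].
Qed.

Lemma appr0 : appr 0 (fun _ => 0).
Proof. by move=> p; rewrite subr0; exact: hat_zero_KK (rep0 _) p. Qed.

Lemma appr_sum I (r : seq I) (P : pred I) (F : I -> hat) (f : I -> nat -> tens) :
  (forall i, P i -> appr (F i) (f i)) ->
  appr (\sum_(i <- r | P i) F i) (fun p => \sum_(i <- r | P i) f i p).
Proof.
move=> Ff; elim: r => [|i r IHr].
  by move=> p; rewrite !big_nil; exact (appr0 p).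
move=> p; rewrite !big_cons; case: ifP => [/Ff Ffi|_]; last exact: IHr.
exact (appr_add Ffi IHr p).
Qed.

Lemma appr_cup X Y x y : appr X x -> appr Y y ->
  appr (hat_cup X Y) (fun p => cup (x p) (y p)).
Proof.
move=> Xx Yy p; have XY := appr_cls (fun p => cup (rep X p) (rep Y p)) p.
rewrite -(subrKA (cup (rep X p) (rep Y p))); apply: spanD; first exact: XY.
rewrite -(subrKA (cup (rep X p) (y p))); apply: spanD.
  by rewrite -(@cup_zmr _ _ _ (rep X p)); apply: KK_cupr.
by rewrite -(@cup_zml _ _ _ (y p)); apply: KK_cupl.
Qed.

Lemma norm_fil_appr q n e X : norm_fil q n e X -> exists x, [/\ appr X x,
  forall p, NG n e (x p), coh x & forall p, (filidx q <= p)%N -> KK (filidx q) (x p)].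
Proof.
case=> [[y [yc yq] <-] X0]; set Y := hat_cls y in X0 *.
have Yy : appr Y y by exact: appr_cls.
(* Vanishing in the completion constrains the codegeneracies at level p only modulo I^p. *)
have yK p i : (i < n)%N -> KK p (codegen i (y p)).
  move=> /X0 /cls_eq0 /hat_zero_KK /(_ p) YK.
  have := spanB YK (KK_codegen i (Yy p)).
  by rewrite /= (@codegen_zm _ _ _ i) opprB addrC subrK.
have yS p : KK p (y p.+1 - y p).
  by have [_ yp] := yc p; apply: (@Kd_KK _ _ _ n); exact: diag_pow_Kd.
have ycoh : coh y.
  move=> p r; elim: r => [|r IHr].
    by rewrite leqn0 => /eqP ->; rewrite subrr; exact: span0.
  rewrite leq_eqVlt => /predU1P[-> |]; first by rewrite subrr; exact: span0.
  rewrite ltnS => pr; rewrite -(subrKA (y r)); apply: spanD; last exact: IHr.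
  exact: KK_mono (yS r).
have /choice[x xP] : forall p, exists z : tens, NG n e z /\ KK p (y p - z).
  move=> p; have [yp _] := yc p; have [z zN zK] := norm_mod_NG yp (yK p).
  by exists z.
have yx p r : (p <= r)%N -> KK p (y r - x r).
  by move=> pr; apply: KK_mono pr _; have [] := xP r.
exists x; split.
- move=> p; rewrite -(subrKA (y p)); apply: spanD; first exact: Yy.
  exact: yx.
- by move=> p; have [] := xP p.
- move=> p r pr.
  have -> : x r - x p = (y r - y p) - (y r - x r) + (y p - x p).
    by rewrite opprB [X in _ = X + _]addrC !subrKA.
  by apply: spanD; [apply: spanB; [exact: ycoh | exact: yx] | exact: yx].
(* For q <= p, the difference y_p - y_q lies in I^q by coherence, y_q does by hypothesis, and y_p -
   x_p lies in I^p. *)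
move=> p qp; have -> : x p = (y p - y (filidx q)) + y (filidx q) - (y p - x p).
  by rewrite subrK opprB addrC subrK.
apply: spanB; last exact: yx.
by apply: spanD; [exact: ycoh | apply: (@Kd_KK _ _ _ n); exact: diag_pow_Kd].
Qed.

Lemma NG_0 n e : @NG R A iota n e 0. Proof. exact: span0. Qed.

Lemma coh_const (x : tens) : coh (fun _ => x).
Proof. by move=> p q _; rewrite subrr; exact: span0. Qed.

End Approximation.

Section Completion.
Variables (R A : cdga) (iota : cdga_hom R A) (M : dgmod A) (k : nat).
Local Notation tens := (tens iota).
Local Notation hat := (hat iota).
Local Notation ser := (ser M).
Local Notation DRk := (DRk iota k).
Local Notation FS := (@FS R A iota M).
Implicit Types (x y : DRk) (X Y : 'I_k -> nat -> nat -> tens) (theta : tens -> ser).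

(* Beyond this precision the coefficient of [hbar^m] is stable. *)
Definition precision (m : int) : nat := (2 * absz m).+1.

(** The same precision serves as the level in the completion and as the cut-off for the cosimplicial
    degree n. *)
Definition completed theta x : ser := fun m =>
  \sum_(i < k) \sum_(0 <= n < precision m) theta (rep (x i n) (precision m)) (m - i%:Z).

(** What extending to the completion takes. It is instantiated with s = p = 0 for the algebra map,
    and with s = r - 1 and the filtration shift p for the derivation. *)
Record admissible theta (s p : int) : Prop := Admissible {
  adm_zm : zmod_morphism theta;
  adm_p : (0 <= p)%R;
  adm_KK : forall q z, KK q z ->
    span [set u | exists d, FS (fun m => 2 * m - q%:Z - p) d u] (theta z);
  adm_NG : forall n e z, NG n e z -> FS id (n%:Z + e + s) (theta z);
  adm_NG2 : forall n e z, NG n e z ->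
    FS (fun m => 2 * m - n%:Z - p) (n%:Z + e + s) (theta z) }.

Record nice (d : int) x X : Prop := Nice {
  nice_appr : forall i n, appr (x i n) (X i n);
  nice_NG : forall i n p, NG n (d - n%:Z) (X i n p);
  nice_coh : forall i n, coh (X i n) }.

Lemma DRk_GF_nice q d x : DRk_GF q d x -> exists2 X, nice d x X &
  forall (i : 'I_k) n p, let q' := filidx (q - (2 * i)%N%:Z) in
    (q' <= p)%N -> KK q' (X i n p).
Proof.
move=> xq.
have /choice[X XP] : forall u : 'I_k * nat, exists z, [/\ appr (x u.1 u.2) z,
    forall p, NG u.2 (d - u.2%:Z) (z p), coh z &
    forall p, (filidx (q - (2 * u.1)%N%:Z) <= p)%N ->
      KK (filidx (q - (2 * u.1)%N%:Z)) (z p)].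
  by move=> [i n] /=; apply: norm_fil_appr; exact: xq.
exists (fun i n => X (i, n)); last by move=> i n p q'; have [_ _ _] := XP (i, n); apply.
split.
- by move=> i n; have [] := XP (i, n).
- by move=> i n p; have [_ + _ _] := XP (i, n); apply.
- by move=> i n; have [] := XP (i, n).
Qed.

Lemma DRk_deg_GF d x : DRk_deg d x -> DRk_GF 0 d x.
Proof.
move=> xd i n; have := xd i n.
by rewrite /norm_fil /hat_fil sub0r; case: (2 * i)%N => [|j].
Qed.

Lemma DRk_deg_nice d x : DRk_deg d x -> exists X, nice d x X.
Proof. by move/DRk_deg_GF/DRk_GF_nice => [X]; exists X. Qed.

Lemma DRk_GF_deg q d x : DRk_GF q d x -> exists X, nice d x X.
Proof. by move/DRk_GF_nice => [X]; exists X. Qed.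

Lemma degE (n : nat) (d s : int) : n%:Z + (d - n%:Z) + s = d + s.
Proof. by rewrite [n%:Z + _]addrC subrK. Qed.

Section OneMap.
Variables (theta : tens -> ser) (s p : int).
Hypothesis ad : admissible theta s p.

Lemma adm_vanish q z m : KK q z -> (2 * m < q%:Z)%R -> theta z m = 0.
Proof.
move=> zq mq; have p0 := adm_p ad.
have := adm_KK ad zq; move: (theta z) => u.
apply: (span_ind (P := fun u : ser => u m = 0)) => // [v w vm wm|v [d vF]].
  by rewrite subE vm wm subr0.
by apply: Dop_neg (vF m); lia.
Qed.

Lemma adm_eq q z z' m : KK q (z - z') -> (2 * m < q%:Z)%R -> theta z m = theta z' m.
Proof.
move=> zq mq; apply/eqP; rewrite -subr_eq0 -subE -(adm_zm ad).
by apply/eqP; exact: adm_vanish mq.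
Qed.

Lemma adm_FS q n e z : NG n e z -> KK q z ->
  FS (fun m => 2 * m - q%:Z - p) (n%:Z + e + s) (theta z).
Proof.
move=> zN zq; apply: FS_homogeneous; last exact: adm_KK ad _ _ zq.
by move=> m; exact: FS_homR (adm_NG ad zN).
Qed.

(** A change of sequence or of level alters each term by an element of I^q with q = [precision m] >
    2 m, invisible in hbar^m. This makes [completed] computable from convenient representatives. *)
Lemma completed_nice d x X m B : nice d x X -> (precision m <= B)%N ->
  completed theta x m = \sum_(i < k) \sum_(0 <= n < B) theta (X i n B) (m - i%:Z).
Proof.
move=> xX mB; apply: eq_bigr => i _.
(* Cosimplicial degrees beyond the cut-off contribute operators of negative order. *)
have tail0 : \sum_(precision m <= n < B) theta (X i n B) (m - i%:Z) = 0.
  rewrite big_nat big1 // => n /andP[mn _]; have p0 := adm_p ad.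
  apply: Dop_neg (adm_NG2 ad (nice_NG xX i n B) _).
  by move: mn; rewrite /precision; lia.
rewrite (@big_cat_nat _ _ _ (precision m) 0 B) //= tail0 addr0.
apply: eq_bigr => n _; transitivity (theta (X i n (precision m)) (m - i%:Z)).
  by apply: (adm_eq (q := precision m)); [exact: nice_appr xX _ _ _ | rewrite /precision; lia].
symmetry; apply: (adm_eq (q := precision m)); last by rewrite /precision; lia.
exact: nice_coh xX _ _ _ _ mB.
Qed.

Lemma completed_FS d x X : nice d x X -> FS id (d + s) (completed theta x).
Proof.
move=> xX m; rewrite (completed_nice xX (leqnn _)).
apply: Dop_sum => i _; apply: Dop_sum => n _.
have := adm_NG ad (nice_NG xX i n (precision m)) (m - i%:Z).
by rewrite degE; apply: Dop_mono => /=; lia.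
Qed.

Lemma completed_Pol d x X : nice d x X -> Pol iota 0 (d + s) (completed theta x).
Proof. by move/completed_FS => xF m; rewrite addr0. Qed.

Lemma completed_GF q d x : DRk_GF q d x ->
  FS (fun m => 2 * m - (q + p)) (d + s) (completed theta x).
Proof.
move=> /DRk_GF_nice[X xX XK] m.
(* The extra |q| brings the level above every index q - 2 i, where membership in that power of I is
   known. The factor hbar^i then costs 2 i and the power gives back 2 i. *)
have mB : (precision m <= precision m + absz q)%N by lia.
rewrite (completed_nice xX mB); apply: Dop_sum => i _; apply: Dop_sum => n _.
have qB : (filidx (q - (2 * i)%N%:Z) <= precision m + absz q)%N.
  by case E: (q - (2 * i)%N%:Z) => [j|j] //=; lia.
have := adm_FS (nice_NG xX i n _) (XK i n _ qB) (m - i%:Z).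
rewrite degE; apply: Dop_mono => /=.
by case E: (q - (2 * i)%N%:Z) => [j|j] /=; lia.
Qed.

Lemma nice_add d x y X Y : nice d x X -> nice d y Y ->
  nice d (x + y) (fun i n p => X i n p + Y i n p).
Proof.
move=> [xa xN xc] [ya yN yc]; split=> [i n|i n r|i n a b ab].
- exact (appr_add (xa i n) (ya i n)).
- exact (spanD (xN i n r) (yN i n r)).
by rewrite opprD addrACA; apply: spanD; [exact: xc | exact: yc].
Qed.

Lemma completed_add d x y X Y : nice d x X -> nice d y Y ->
  completed theta (x + y) = completed theta x + completed theta y.
Proof.
move=> xX yY; apply/funext => m; rewrite addE.
rewrite (completed_nice (nice_add xX yY) (leqnn _)) (completed_nice xX (leqnn _)).
rewrite (completed_nice yY (leqnn _)) -big_split; apply: eq_bigr => i _.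
rewrite -big_split; apply: eq_bigr => n _ /=.
by rewrite (zmD (adm_zm ad)) addE.
Qed.

End OneMap.

Lemma nice_emb (hk : (0 < k)%N) n e z : NG n e z -> nice (n%:Z + e) (DRk_emb k n z)
  (fun i n' _ => if (val i == 0%N) && (n' == n) then z else 0).
Proof.
move=> zN; split=> [i n'|i n' q|i n'].
- rewrite /DRk_emb; case: ifP => _; first exact: appr_cls.
  exact: appr0.
- case: ifP => [/andP[_ /eqP ->]|_]; last exact: NG_0.
  by rewrite addrC addKr.
exact: coh_const.
Qed.

Lemma completed_emb theta s p (hk : (0 < k)%N) n e z : admissible theta s p ->
  NG n e z -> completed theta (DRk_emb k n z) = theta z.
Proof.
move=> ad zN; apply/funext => m.
(* The bound is raised so that the only nonzero cosimplicial degree n is inside the range of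
   summation. *)
have mB : (precision m <= (precision m + n).+1)%N by lia.
rewrite (completed_nice ad (nice_emb hk zN) mB) (bigD1 (Ordinal hk)) //= subr0.
rewrite [X in _ + X]big1 ?addr0 => [|i i0]; last first.
  rewrite big1 // => n' _; rewrite ifF ?(zm0 (adm_zm ad)) //.
  by move: i0; rewrite -val_eqE /= => /negPf ->.
rewrite (bigD1_seq n) ?iota_uniq ?mem_index_iota //=; last by lia.
rewrite eqxx big1 ?addr0 // => n' /negPf ->.
by rewrite (zm0 (adm_zm ad)).
Qed.

Lemma NG_pw1 (a : helt A) : NG 0 (hd a) (pw iota [:: a]).
Proof.
apply: span_in; exists a, 0, (pw iota [:: h1 A]); split.
- exact: NQ0.
- by rewrite addr0.
by rewrite cup_single L0_pw hmulh1.
Qed.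

Lemma nice_scal e (c : 'I_k -> R) : (forall i, gdeg e (c i)) ->
  nice e (DRk_scal iota e c)
    (fun i n _ => if n == 0%N then tens_of iota e (iota (c i)) else 0).
Proof.
move=> ce; split=> [i n|i n q|i n].
- rewrite /DRk_scal; case: ifP => _; first exact: appr_cls.
  exact: appr0.
- case: eqP => [->|_]; last exact: NG_0.
  have := NG_pw1 (mkh e (iota (c i))).
  by rewrite hd_mkh ?subr0 //; apply: gdeg_rho.
exact: coh_const.
Qed.

Lemma completed_scal theta s p e (c : 'I_k -> R) : admissible theta s p ->
  (forall i, gdeg e (c i)) -> completed theta (DRk_scal iota e c) =
  \sum_(i < k) hshift i%:Z (theta (tens_of iota e (iota (c i)))).
Proof.
move=> ad ce; apply/funext => m; rewrite (completed_nice ad (nice_scal ce) (leqnn _)).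
rewrite sum_fctE; apply: eq_bigr => i _.
rewrite (bigD1_seq 0%N) ?iota_uniq ?mem_index_iota //= big1 ?addr0 // => n.
by move=> /negPf ->; rewrite (zm0 (adm_zm ad)).
Qed.

Lemma sum_triangle (V : zmodType) (G : nat -> nat -> V) b :
  \sum_(0 <= n < b) \sum_(a < n.+1) G a (n - a)%N =
  \sum_(0 <= a < b) \sum_(0 <= c < b - a) G a c.
Proof.
elim: b => [|b IHb]; first by rewrite !big_geq.
rewrite big_nat_recr //= IHb [RHS]big_nat_recr //= subSnn big_nat1.
rewrite big_ord_recr /= subnn addrA; congr (_ + _).
rewrite -(big_mkord xpredT (fun a => G a (b - a)%N)) -big_split /=.
apply: eq_big_nat => a /andP[_ ab].
by rewrite subSn ?big_nat_recr // ltnW.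
Qed.

(** * Compatibility with products *)

Section Product.
Variables (d e : int) (x y : DRk) (X Y : 'I_k -> nat -> nat -> tens).
Hypotheses (xX : nice d x X) (yY : nice e y Y).

Lemma ser_mul_trunc (u u' v v' : ser) (m : int) :
  lowb 0 u -> lowb 0 u' -> lowb 0 v -> lowb 0 v' ->
  (forall j, zmod_morphism (u j)) -> (forall j, zmod_morphism (u' j)) ->
  (forall j, (0 <= j <= m)%R -> u j = u' j) ->
  (forall j, (0 <= j <= m)%R -> v j = v' j) ->
  ser_mul u v m = ser_mul u' v' m.
Proof.
move=> u0 u'0 v0 v'0 uB u'B uu vv; apply/funext => t.
have mK : (m + 0%N%:Z + 0%N%:Z < (absz m).+1%:Z)%R by lia.
rewrite (ser_mul_win t u0 v0 uB mK) (ser_mul_win t u'0 v'0 u'B mK).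
apply: eq_big_seq => j; rewrite mem_win => jm.
case: (neg_or_pos (m - j)) => mj.
  by rewrite v0 ?v'0 ?(zm0 (uB _)) ?(zm0 (u'B _)) //; lia.
by rewrite uu ?vv //; lia.
Qed.

Lemma completed_mul f g s1 p1 s2 p2 m : admissible f s1 p1 -> admissible g s2 p2 ->
  (0 <= m)%R -> let b := precision m in
  ser_mul (completed f x) (completed g y) m =
  \sum_(i < k) \sum_(j < k) \sum_(0 <= a < b) \sum_(0 <= c < b)
    ser_mul (f (X i a b)) (g (Y j c b)) (m - (i + j)%N%:Z).
Proof.
move=> adf adg m0 b.
(* Finite truncations at one common precision b, agreeing with the completed series up to hbar^m;
   products of these can be expanded by bilinearity. *)
pose U : ser := \sum_(i < k) \sum_(0 <= a < b) hshift i%:Z (f (X i a b)).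
pose W : ser := \sum_(j < k) \sum_(0 <= c < b) hshift j%:Z (g (Y j c b)).
have FS_lowb q (u : ser) : FS id q u -> lowb 0 u.
  by move=> uF j j0; apply: Dop_neg (uF j); move: j0; rewrite addr0.
have shiftF q (i : nat) (u : ser) : FS id q u -> FS id q (hshift i%:Z u).
  by move=> uF j; apply: Dop_mono (uF _) => /=; lia.
have FS_sum I (r : seq I) q (F : I -> ser) : (forall i, FS id q (F i)) ->
    FS id q (\sum_(i <- r) F i).
  by move=> FF j; rewrite sum_fctE; apply: Dop_sum => i _; exact: FF.
have fF (i : 'I_k) a : FS id (d + s1) (hshift (nat_of_ord i)%:Z (f (X i a b))).
  by apply: shiftF; have := adm_NG adf (nice_NG xX i a b); rewrite degE.
have gF (j : 'I_k) c : FS id (e + s2) (hshift (nat_of_ord j)%:Z (g (Y j c b))).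
  by apply: shiftF; have := adm_NG adg (nice_NG yY j c b); rewrite degE.
have FS0_good q (u : ser) : FS id q u -> good u.
  by move=> uF; apply: (@FS_good _ _ iota M id q 0 u _ uF) => j; rewrite addr0.
have UF : FS id (d + s1) U by apply: (FS_sum) => i; apply: (FS_sum).
have WF : FS id (e + s2) W by apply: (FS_sum) => i; apply: (FS_sum).
have [Ug Wg] := (FS0_good _ _ UF, FS0_good _ _ WF).
have xF := completed_FS adf xX; have yF := completed_FS adg yY.
transitivity (ser_mul U W m).
  apply: ser_mul_trunc; try by [exact: FS_lowb xF|exact: FS_lowb yF|
    exact: FS_lowb UF|exact: FS_lowb WF].
  - by have [] := FS0_good _ _ xF.
  - by have [] := Ug.
  - move=> j jm; have jb : (precision j <= b)%N by rewrite /b /precision; lia.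
    rewrite (completed_nice adf xX jb) /U sum_fctE; apply: eq_bigr => i _.
    by rewrite sum_fctE.
  move=> j jm; have jb : (precision j <= b)%N by rewrite /b /precision; lia.
  rewrite (completed_nice adg yY jb) /W sum_fctE; apply: eq_bigr => i _.
  by rewrite sum_fctE.
have fg i a := FS0_good _ _ (fF i a); have gg j c := FS0_good _ _ (gF j c).
have Wjg (j : 'I_k) : good (\sum_(0 <= c < b) hshift (nat_of_ord j)%:Z (g (Y j c b))).
  by apply: good_sum => c _; exact: gg.
rewrite ser_mul_suml //; last by move=> i; apply: good_sum => a _; exact: fg.
rewrite sum_fctE; apply: eq_bigr => i _.
rewrite ser_mul_sumr //; last by apply: good_sum => a _; exact: fg.
rewrite sum_fctE; apply: eq_bigr => j _.
rewrite ser_mul_suml // sum_fctE; apply: eq_bigr => a _.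
rewrite ser_mul_sumr // sum_fctE; apply: eq_bigr => c _.
by rewrite hshift_mul /hshift.
Qed.

Lemma DRk_mul_appr (l : 'I_k) n : appr (DRk_mul x y l n) (fun p =>
  \sum_(i < k) \sum_(j < k | (i + j == l)%N) \sum_(a < n.+1)
    cup (X i a p) (Y j (n - a)%N p)).
Proof.
rewrite /DRk_mul !sum_fctE; apply: appr_sum => i _.
rewrite !sum_fctE; apply: appr_sum => j _; apply: appr_sum => a _.
by apply: appr_cup; [exact: nice_appr xX _ _ | exact: nice_appr yY _ _].
Qed.

(** The product in DR' sums over i + j < k and over the triangle a + c < b, whereas V sums over all
    i, j and the full square. The surplus powers of hbar lie in G^k, and the surplus cosimplicial
    degrees vanish. V stands for a product or for a Leibniz expression. *)
Lemma completed_prod theta s p (V : ser) : admissible theta s p ->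
  (forall a c z z', NG a (d - a%:Z) z -> NG c (e - c%:Z) z' ->
    FS id (d + e + s) (theta (cup z z')) /\
    FS (fun m => 2 * m - (a + c)%N%:Z - p) (d + e + s) (theta (cup z z'))) ->
  FS id (d + e + s) V ->
  (forall m, (0 <= m)%R -> let b := precision m in V m =
    \sum_(i < k) \sum_(j < k) \sum_(0 <= a < b) \sum_(0 <= c < b)
      theta (cup (X i a b) (Y j c b)) (m - (i + j)%N%:Z)) ->
  FS (fun m => m - k%:Z) (d + e + s) (completed theta (DRk_mul x y) - V).
Proof.
move=> ad cupF VF VE m; rewrite subE; set b := precision m.
pose T i j a c : M -> M := theta (cup (X i a b) (Y j c b)) (m - (i + j)%N%:Z).
have TF i j a c := cupF a c _ _ (nice_NG xX i a b) (nice_NG yY j c b).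
have -> : completed theta (DRk_mul x y) m = \sum_(i < k) \sum_(j < k)
    (if (i + j < k)%N then \sum_(0 <= a < b) \sum_(0 <= c < b - a) T i j a c else 0).
  transitivity (\sum_(l < k) \sum_(i < k) \sum_(j < k | (i + j == l)%N)
      \sum_(0 <= n < b) \sum_(a < n.+1)
        theta (cup (X i a b) (Y j (n - a)%N b)) (m - l%:Z)).
    apply: eq_bigr => l _; rewrite -/b.
    transitivity (\sum_(0 <= n < b) \sum_(i < k) \sum_(j < k | (i + j == l)%N)
        \sum_(a < n.+1) theta (cup (X i a b) (Y j (n - a)%N b)) (m - l%:Z)).
      apply: eq_bigr => n _.
      have lb : (2 * (m - l%:Z) < b%:Z)%R by rewrite /b /precision; lia.
      rewrite (adm_eq ad (DRk_mul_appr l n b) lb) (zm_sum (adm_zm ad)) sum_fctE.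
      apply: eq_bigr => i _; rewrite (zm_sum (adm_zm ad)) sum_fctE.
      apply: eq_bigr => j _; rewrite (zm_sum (adm_zm ad)) sum_fctE.
      by [].
    rewrite exchange_big; apply: eq_bigr => i _ /=.
    by rewrite exchange_big.
  rewrite exchange_big; apply: eq_bigr => i _ /=.
  rewrite (exchange_big_dep xpredT) //=; apply: eq_bigr => j _.
  case: ifP => ijk; last first.
    by rewrite big_pred0 // => l; apply/negP => /eqP ijl; move: ijk; rewrite ijl ltn_ord.
  rewrite (big_pred1 (Ordinal ijk)) => [|l]; last first.
    by apply/eqP/eqP => [ijl|-> //]; apply/val_inj.
  by rewrite -sum_triangle.
case: (neg_or_pos m) => m0.
  rewrite (Dop_neg m0 (VF m)) subr0; apply: Dop_sum => i _; apply: Dop_sum => j _.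
  case: ifP => _; last exact: Dop0.
  apply: Dop_sum => a _; apply: Dop_sum => c _.
  rewrite /T (Dop_neg _ ((TF i j a c).1 _)); first exact: Dop0.
  by rewrite /=; lia.
rewrite (VE m m0) -/b -sumrB; apply: Dop_sum => i _.
rewrite -sumrB; apply: Dop_sum => j _; case: ifP => ijk; last first.
  (* Here i + j >= k, so the surplus terms have order at most m - (i + j) <= m - k. *)
  apply: DopB; first exact: Dop0.
  apply: Dop_sum => a _; apply: Dop_sum => c _.
  by apply: Dop_mono ((TF i j a c).1 _) => /=; lia.
rewrite -sumrB big_nat; apply: Dop_sum => a /andP[_ ab].
rewrite [X in Defs.Dop _ _ _ (_ - X)](@big_cat_nat _ _ _ (b - a)) //=;
  last by rewrite leq_subr.
rewrite opprD addrA subrr sub0r; apply: DopN.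
(* Outside the triangle a + c >= b > 2 m, and the order becomes negative. *)
rewrite big_nat big1 => [|c /andP[bac _]]; first exact: Dop0.
have p0 := adm_p ad; apply: Dop_neg ((TF i j a c).2 _).
by move: bac; rewrite /b /precision; lia.
Qed.

End Product.
End Completion.

(** * The morphism and the derivation *)

Section Assembly.
Variables (R A : cdga) (iota : cdga_hom R A) (M : dgmod A) (k : nat).
Local Notation tens := (tens iota).
Local Notation ser := (ser M).
Local Notation DRk := (DRk iota k).
Local Notation FS := (@FS R A iota M).
Local Notation cls := (Polk_cls iota 0 k).
Implicit Types (x y : DRk) (X Y : 'I_k -> nat -> nat -> tens).

Section Morphism.
Variables (D : ser) (f : tens -> ser).
Hypotheses (hD : GFfil iota 1 2 1 D) (fN : nerve_map D f).

Lemma GF_QPol : QPol iota 1 D.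
Proof. by have [DF _] := GFfil_FS hD. Qed.

(** For s = 1 and p = 2 the bound 2 m + 2 s - p equals 2 m. *)
Lemma GF_double : FS (fun m => 2 * m) 1 D.
Proof. by have [_ DF] := GFfil_FS hD; apply: FS_mono DF => m; lia. Qed.

Lemma admissible_nm : admissible f 0 0.
Proof.
have hQ := GF_QPol; have hF := GF_double; split=> //.
- exact: nm_zm fN.
- move=> q z zK; apply: (span_map (@zm_id ser)) (nm_KK hQ fN hF zK) => u [d uF].
  by apply: span_in; exists d; apply: FS_mono uF => m; rewrite subr0.
- by move=> n e z zN; rewrite addr0; exact (nm_NG_FS hQ fN zN).
move=> n e z zN; rewrite addr0.
by apply: FS_mono (nm_NG_FS2 hQ fN hF zN) => m; rewrite subr0.
Qed.

Lemma completed_nm_mul d e x y X Y : nice d x X -> nice e y Y ->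
  FS (fun m => m - k%:Z) (d + e)
    (completed f (DRk_mul x y) - ser_mul (completed f x) (completed f y)).
Proof.
have hQ := GF_QPol; have hF := GF_double; have ad := admissible_nm.
move=> xX yY; rewrite -[d + e]addr0; apply: (completed_prod xX yY ad).
- move=> a c z z' zN zN'; rewrite (nm_cup fN) addr0.
  have zg := nm_good hQ fN z; have zg' := nm_good hQ fN z'.
  have Ed : a%:Z + (d - a%:Z) = d by lia.
  have Ee : c%:Z + (e - c%:Z) = e by lia.
  have z1 := nm_NG_FS hQ fN zN; have z1' := nm_NG_FS hQ fN zN'.
  have z2 := nm_NG_FS2 hQ fN hF zN; have z2' := nm_NG_FS2 hQ fN hF zN'.
  rewrite Ed in z1 z2; rewrite Ee in z1' z2'.
  by split; [apply: FS_mul z1 z1' | apply: FS_mul z2 z2' => // i j; lia].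
- have xP := completed_Pol ad xX; have yP := completed_Pol ad yY.
  rewrite !addr0 in xP yP *.
  by apply: FS_mul (Pol_good xP) (Pol_good yP) _ xP yP => i j /=; lia.
move=> m m0 b; rewrite (completed_mul xX yY ad ad m0) -/b.
do 4!(apply: eq_bigr => ? _).
by rewrite (nm_cup fN).
Qed.

Lemma completed_nm_scal e (c : 'I_k -> R) : (forall i, gdeg e (c i)) ->
  completed f (DRk_scal iota e c) =
  (fun n (t : M) => \sum_(i < k | i%:Z == n) iota (c i) *: t).
Proof.
move=> ce; rewrite (completed_scal admissible_nm ce); apply/funext => m; apply/funext => t.
rewrite !sum_fctE [RHS]big_mkcond; apply: eq_bigr => i _.
rewrite (nm_A fN) ?/hshift; last exact: hom_deg.
by rewrite /ser_const subr_eq0 eq_sym; case: ifP.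
Qed.

Lemma completed_alg_morphism (hk : (0 < k)%N) : is_alg_morphism (fun x => cls (completed f x)).
Proof.
have ad := admissible_nm.
have mulE d e x y X Y : nice d x X -> nice e y Y ->
    cls (completed f (DRk_mul x y)) = Tk_mul (cls (completed f x)) (cls (completed f y)).
  move=> xX yY; rewrite (Tk_mulE _ (completed_Pol ad xX) (completed_Pol ad yY)).
  exact: Polk_eq (completed_nm_mul xX yY).
split.
- move=> d x /DRk_deg_nice[X xX]; exists (completed f x) => //.
  by have := completed_Pol ad xX; rewrite addr0.
- move=> d x y /DRk_deg_nice[X xX] /DRk_deg_nice[Y yY].
  by rewrite (completed_add ad xX yY) /Polk_cls (zmD (@cls_zm _ _)).
- rewrite /DRk_one (completed_emb (s := 0) (p := 0) (e := 0) hk ad).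
    by rewrite (nm_A fN) //; exact: gdeg1.
  by have := NG_pw1 iota (h1 A); rewrite hd_h1.
- by move=> d e x y /DRk_deg_nice[X xX] /DRk_deg_nice[Y yY]; exact: mulE xX yY.
move=> d e x c /DRk_deg_nice[X xX] ce.
by rewrite (mulE _ _ _ _ _ _ (nice_scal iota ce) xX) completed_nm_scal.
Qed.

Section Derivation.
Variables (r p : int) (rho : ser) (g : tens -> ser).
Hypotheses (p0 : (0 <= p)%R) (hrho : GFfil iota 0 p r rho) (gN : nerve_der f r rho g).

Lemma GF_TPol : TPol iota r rho.
Proof. by have [rF _] := GFfil_FS hrho. Qed.

Lemma GF_shift : FS (fun m => 2 * m - p) r rho.
Proof. by have [_ rF] := GFfil_FS hrho; apply: FS_mono rF => m; lia. Qed.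

Lemma admissible_nd : admissible g (r - 1) p.
Proof.
have hQ := GF_QPol; have hF := GF_double; have hT := GF_TPol; have hrF := GF_shift.
split=> //.
- exact: nd_zm gN.
- by move=> q z zK; exact (nd_KK hQ fN hF hT gN hrF zK).
- by move=> n e z zN; exact (nd_NG_FS hQ fN hT gN zN).
by move=> n e z zN; exact (nd_NG_FS2 hQ fN hF hT gN hrF zN).
Qed.

Lemma completed_nd_mul d e x y X Y : nice d x X -> nice e y Y ->
  FS (fun m => m - k%:Z) (d + e + (r - 1))
    (completed g (DRk_mul x y) - (ser_mul (completed g x) (completed f y) +
       ksgn ((r - 1) * d) (ser_mul (completed f x) (completed g y)))).
Proof.
have hQ := GF_QPol; have hF := GF_double; have hT := GF_TPol; have hrF := GF_shift.
have ad := admissible_nm; have ad' := admissible_nd.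
move=> xX yY.
(* The Leibniz sign depends on the total degree d alone, so it is common to all cosimplicial degrees
   a and can be taken out of the sums. *)
have cupE a z z' : NG a (d - a%:Z) z -> g (cup z z') =
    ser_mul (g z) (f z') + ksgn ((r - 1) * d) (ser_mul (f z) (g z')).
  move=> /NG_ne zN; rewrite (nd_cup gN _ zN).
  by rewrite (_ : a%:Z + (d - a%:Z) = d) //; lia.
apply: (completed_prod xX yY ad').
- move=> a c z z' zN zN'; rewrite (cupE a _ _ zN).
  have zg := nm_good hQ fN z; have zg' := nm_good hQ fN z'.
  have yg := nd_good hQ fN hT gN z; have yg' := nd_good hQ fN hT gN z'.
  have Ed : a%:Z + (d - a%:Z) = d by lia.
  have Ee : c%:Z + (e - c%:Z) = e by lia.
  have z1 := nm_NG_FS hQ fN zN; have z1' := nm_NG_FS hQ fN zN'.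
  have z2 := nm_NG_FS2 hQ fN hF zN; have z2' := nm_NG_FS2 hQ fN hF zN'.
  have y1 := nd_NG_FS hQ fN hT gN zN; have y1' := nd_NG_FS hQ fN hT gN zN'.
  have y2 := nd_NG_FS2 hQ fN hF hT gN hrF zN.
  have y2' := nd_NG_FS2 hQ fN hF hT gN hrF zN'.
  rewrite Ed in z1 z2 y1 y2; rewrite Ee in z1' z2' y1' y2'.
  have E1 : d + e + (r - 1) = (d + (r - 1)) + e by lia.
  have E2 : d + e + (r - 1) = d + (e + (r - 1)) by lia.
  split; apply: FSD; try apply: FS_ksgn.
  + by rewrite E1; apply: FS_mul y1 z1'.
  + by rewrite E2; apply: FS_mul z1 y1'.
  + by rewrite E1; apply: FS_mul y2 z2' => // i j; lia.
  by rewrite E2; apply: FS_mul z2 y2' => // i j; lia.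
- have xP := completed_FS ad xX; have yP := completed_FS ad yY.
  have xP' := completed_FS ad' xX; have yP' := completed_FS ad' yY.
  have fg u q : FS id q u -> good u.
    by move=> uF; apply: (@FS_good _ _ iota M id q 0 u _ uF) => j; rewrite addr0.
  rewrite !addr0 in xP yP.
  apply: FSD; last apply: FS_ksgn.
    rewrite (_ : d + e + (r - 1) = (d + (r - 1)) + e); last by lia.
    by apply: FS_mul (fg _ _ xP') (fg _ _ yP) _ xP' yP.
  rewrite (_ : d + e + (r - 1) = d + (e + (r - 1))); last by lia.
  by apply: FS_mul (fg _ _ xP) (fg _ _ yP') _ xP yP'.
move=> m m0 b; rewrite addE !ksgn_fct.
rewrite (completed_mul xX yY ad' ad m0) (completed_mul xX yY ad ad' m0) -/b.
rewrite (zm_sum (@ksgn_zm _ _)) -big_split; apply: eq_bigr => i _ /=.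
rewrite (zm_sum (@ksgn_zm _ _)) -big_split; apply: eq_bigr => j _ /=.
rewrite (zm_sum (@ksgn_zm _ _)) -big_split; apply: eq_bigr => a _ /=.
rewrite (zm_sum (@ksgn_zm _ _)) -big_split; apply: eq_bigr => c _ /=.
by rewrite (cupE a _ _ (nice_NG xX i a b)) addE !ksgn_fct.
Qed.

Lemma completed_derivation : is_derivation (fun x => cls (completed f x)) r
  (fun x => cls (completed g x)).
Proof.
have ad := admissible_nm; have ad' := admissible_nd.
have mulE d e x y X Y : nice d x X -> nice e y Y -> cls (completed g (DRk_mul x y)) =
    Tk_mul (cls (completed g x)) (cls (completed f y)) +
    ksgn ((r - 1) * d) (Tk_mul (cls (completed f x)) (cls (completed g y))).
  move=> xX yY; rewrite (Tk_mulE _ (completed_Pol ad' xX) (completed_Pol ad yY)).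
  rewrite (Tk_mulE _ (completed_Pol ad xX) (completed_Pol ad' yY)).
  rewrite -(zm_ksgn (@cls_zm _ _)) -(zmD (@cls_zm _ _)).
  exact: Polk_eq (completed_nd_mul xX yY).
split.
- by move=> d x /DRk_deg_nice[X xX]; exists (completed g x) => //; exact (completed_Pol ad' xX).
- move=> d x y /DRk_deg_nice[X xX] /DRk_deg_nice[Y yY].
  by rewrite (completed_add ad' xX yY) /Polk_cls (zmD (@cls_zm _ _)).
- by move=> d e x y /DRk_deg_nice[X xX] /DRk_deg_nice[Y yY]; exact: mulE xX yY.
move=> d e x c /DRk_deg_nice[X xX] ce.
rewrite (mulE _ _ _ _ _ _ (nice_scal iota ce) xX) completed_nm_scal // -/(Tk_scal _ _ _).
(* Linearity is the Leibniz rule with a first factor on which the derivation vanishes. *)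
have -> : completed g (DRk_scal iota e c) = 0.
  rewrite (completed_scal ad' ce) big1 // => i _.
  by rewrite (nd_A gN) //; exact: hom_deg.
have xP := completed_Pol ad xX.
have P0 : Pol iota 0 0 (0 : ser) by move=> m; exact: Dop0.
rewrite (Tk_mulE _ P0 xP) ser_mul0l; last exact: Pol_good xP.
by rewrite /Polk_cls (zm0 (@cls_zm _ _)) add0r.
Qed.

End Derivation.
End Morphism.

Lemma completed_shifts (theta : tens -> ser) (s p p' : int) : admissible theta s p -> (p' <= p)%R ->
  shifts_GF p' s (fun x => cls (completed theta x)).
Proof.
move=> ad pp q d x xq; exists (completed theta x) => //.
have [X xX] := DRk_GF_deg xq.
apply: GFfil_of_FS; first exact (completed_FS ad xX).
by apply: FS_mono (completed_GF ad xq) => m; lia.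
Qed.

(** For p <= 0 the filtration step is the whole of T_Delta, so a negative p may be raised to 0;
    [admissible] works with nonnegative shifts, and a shift by p' >= p implies the one by p. *)
Lemma GFfil_max p r (u : ser) : GFfil iota 0 p r u ->
  exists p', [/\ (0 <= p')%R, (p <= p')%R & GFfil iota 0 p' r u].
Proof.
move=> up; case: (neg_or_pos p) => p0; last by exists p.
have [uF _] := GFfil_FS up; exists 0; split=> //; first by lia.
apply: GFfil_of_FS => m; have := uF m; first by rewrite addr0.
case: (neg_or_pos (m + 0)) => m0; last by apply: Dop_mono; lia.
by move=> /(Dop_neg m0) ->; exact: Dop0.
Qed.

End Assembly.

Theorem lemma1p32 (R : cdga) (ratR : {rmorphism rat -> R})
    (A : cdga) (iota : cdga_hom R A) (M : strict_line_bundle A)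
    (k : nat) (hk : (1 <= k)%N)
    (Delta : QPolk iota M k) (hDelta : Polk_GF 2 1 Delta) :
  exists mu : DRk iota k -> TPolk iota M k,
    [/\ is_alg_morphism mu,
        shifts_GF 0 0 mu,
        forall D : ser M, QPol iota 1 D -> Polk_cls iota 1 k D = Delta ->
          exists phi : tens iota -> ser M,
            [/\ nerve_map D phi,
                forall phi', nerve_map D phi' -> phi' = phi
              & induced_by phi mu]
      & forall (p r : int) (rho : TPolk iota M k), Polk_GF p r rho ->
          exists nu : DRk iota k -> TPolk iota M k,
            [/\ is_derivation mu r nu,
                shifts_GF p (r - 1) nu
              & forall D rho' : ser M,
                  QPol iota 1 D -> Polk_cls iota 1 k D = Delta ->
                  TPol iota r rho' -> Polk_cls iota 0 k rho' = rho ->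
                  forall phi : tens iota -> ser M, nerve_map D phi ->
                  exists psi : tens iota -> ser M,
                    [/\ nerve_der phi r rho' psi,
                        forall psi', nerve_der phi r rho' psi' -> psi' = psi
                      & induced_by psi nu]]].
Proof.
(* The morphism is built from a lift that lies in (G * F~)^2 itself; this is what makes the
   completed sums converge. *)
case: hDelta => D0 hD0 D0E; have hQ0 := GF_QPol hD0.
have fN0 := phi_nerve hQ0; set f0 := @phi _ _ iota _ D0 in fN0.
have ad := admissible_nm hD0 fN0.
(* An arbitrary lift is only known to lie in [QPol]; it is controlled through its difference from
   D0, and that suffices on normalised cochains. *)
have liftD D : QPol iota 1 D -> Polk_cls iota 1 k D = Delta ->
    FS iota (fun m => m - k%:Z + 1) 1 (D0 - D).
  by move=> hQ DE; apply: Polk_lift hQ0 hQ _; rewrite D0E DE.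
exists (fun x => Polk_cls iota 0 k (completed f0 x)); split.
- exact: completed_alg_morphism hD0 fN0 hk.
- exact: completed_shifts ad _.
- move=> D hQ DE; have fN := phi_nerve hQ; exists (phi D); split=> //.
    by move=> f' fN'; exact: nerve_map_unique fN' fN.
  move=> n e x /norm_tens_NG xN; rewrite (completed_emb hk ad xN).
  exact: Polk_eq (nm_NG_diff hQ0 fN0 hQ fN (liftD _ hQ DE) xN).
move=> p r rho [rho0 hrho0 rhoE]; have [p' [p'0 pp' hrho]] := GFfil_max hrho0.
have hT0 := GF_TPol hrho; have gN0 := psi_nerve hQ0 hT0.
set g0 := @psi _ _ iota _ D0 r rho0 in gN0.
have ad' := admissible_nd hD0 fN0 p'0 hrho gN0.
exists (fun x => Polk_cls iota 0 k (completed g0 x)); split.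
- exact (completed_derivation k hD0 fN0 p'0 hrho gN0).
- exact: completed_shifts ad' pp'.
move=> D rho' hQ DE hT rE f fN.
(* By uniqueness the given nerve map is the constructed one, for which the derivation is
   available. *)
have Ef := nerve_map_unique fN (phi_nerve hQ).
have gN : nerve_der f r rho' (psi D r rho') by rewrite Ef; exact: psi_nerve.
exists (psi D r rho'); split=> //.
  by move=> g' gN'; exact: nerve_der_unique gN' gN.
move=> n e x /norm_tens_NG xN; rewrite (completed_emb hk ad' xN).
have hrr : FS iota (fun m => m - k%:Z) r (rho0 - rho').
  have rF : FS iota (fun m => m - k%:Z + 0) r (rho0 - rho').
    by apply: Polk_lift hT0 hT _; rewrite rhoE rE.
  by apply: FS_mono rF => m; rewrite addr0.
exact: Polk_eq (nd_NG_diff hQ0 fN0 hQ fN (liftD _ hQ DE) hT0 gN0 hT gN hrr xN).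
Qed.
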